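(* Let $d,e\ge 1$ be integers, and let $R=S/I$ be the coordinate ring of the weighted rational curve of type $(d,e)$. Then: (1) $R$ is Cohen--Macaulay. (2) $I$ is generated by the $2\times 2$ minors of the $2\times(d+e-1)$ matrix $$M=\begin{bmatrix} x_0 & x_1 & \cdots & x_{d-2} & x_{d-1}^e & y_0 & \cdots & y_{e-2}\\ x_1 & x_2 & \cdots & x_{d-1} & y_0 & y_1 & \cdots & y_{e-1}\end{bmatrix},$$ all of whose entries are variables except for the single entry $x_{d-1}^e$. (3) The Eagon--Northcott complex of $M$ is a free resolution of $R$ over $S$. (4) There is a monomial order $<$ on $S$ such that the initial ideal $\mathrm{in}_<(I)$ is generated by quadratic monomials, i.e. by products of two (not necessarily distinct) variables.
   Context: Let $k$ be a field and $S=k[x_0,\dots,x_{d-1},y_0,\dots,y_{e-1}]$, graded by $\deg x_i=1$, $\deg y_i=e$ (the coordinate ring of the weighted projective space $\mathbb P(1^d,e^e)$ with $d$ weights equal to $1$ and $e$ weights equal to $e$). Let $\varphi:S\to k[s,t]$ be the $k$-algebra map with $\varphi(x_i)=s^{d-i}t^i$ for $0\le i\le d-1$ and $\varphi(y_i)=s^{e-1-i}t^{ed-(e-1)+i}$ for $0\le i\le e-1$. The weighted rational curve of type $(d,e)$ is the image of the corresponding closed immersion $\mathbb P^1\to\mathbb P(1^d,e^e)$. Its defining ideal is $I=\ker\varphi$ and its coordinate ring is $R=S/I$. The columns of $M$ are, in order: $(x_{i-1},x_i)^T$ for $1\le i\le d-1$; then $(x_{d-1}^e,y_0)^T$; then $(y_{i-1},y_i)^T$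 for $1\le i\le e-1$. Eagon--Northcott complex of a $2\times n$ matrix $M$ over $S$: let $F=S^n$ with basis $f_1,\dots,f_n$ (indexed by columns) and $G=S^2$ (indexed by rows). Its terms are $EN_0=S$ and $EN_k=(\mathrm{Sym}_{k-1}G)^*\otimes\bigwedge^{k+1}F$ for $k\ge1$. The map $EN_1=\bigwedge^2F\to S$ sends $f_a\wedge f_b$ to the minor of $M$ on columns $a<b$. For $k\ge 2$, writing $u^{(a)}v^{(b)}$ ($a+b=k-1$) for the basis of $(\mathrm{Sym}_{k-1}G)^*$ dual to the monomial basis, the map $EN_k\to EN_{k-1}$ sends $u^{(a)}v^{(b)}\otimes f_{j_0}\wedge\cdots\wedge f_{j_k}$ to $\sum_{l}(-1)^l\big(M_{1,j_l}u^{(a-1)}v^{(b)}+M_{2,j_l}u^{(a)}v^{(b-1)}\big)\otimes f_{j_0}\wedge\cdots\widehat{f_{j_l}}\cdots\wedge f_{j_k}$ (terms with negative exponents are zero). *)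

(* Defs.v *)
From HB Require Import structures.
From mathcomp Require Import all_boot all_order all_algebra.
From mathcomp Require Import ring_quotient.
From mathcomp Require Import mpoly.

Set Implicit Arguments.
Unset Strict Implicit.
Unset Printing Implicit Defensive.

Import GRing.Theory.
Local Open Scope ring_scope.
Local Open Scope quotient_scope.

(* Ideals are [Prop]-valued because the predicates of [ring_quotient] are     *)
(* boolean, so that quantifying over them would only reach decidable ideals.  *)
Section CohenMacaulay.
Variable A : comNzRingType.
Implicit Types (I J P G : A -> Prop) (s : seq A).

Definition is_ideal I : Prop :=
  [/\ I 0, forall a b, I a -> I b -> I (a + b) & forall c a, I a -> I (c * a)].

Definition prime_ideal P : Prop :=
  [/\ is_ideal P, ~ P 1 & forall a b, P (a * b) -> P a \/ P b].

Definition maximal_ideal P : Prop :=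
  [/\ is_ideal P, ~ P 1 &
      forall J, is_ideal J -> ~ J 1 -> (forall a, P a -> J a) ->
      forall a, J a -> P a].

Definition ideal_gen G : A -> Prop := fun a =>
  exists2 cg : seq (A * A),
    {in cg, forall u, G u.2} & a = \sum_(u <- cg) u.1 * u.2.

Definition noetherian : Prop :=
  forall I, is_ideal I ->
  exists s, forall a, I a <-> ideal_gen (fun g => g \in s) a.

Definition regular_sequence s : Prop :=
  (forall i, (i < size s)%N -> forall a,
     ideal_gen (fun g => g \in take i s) (s`_i * a) ->
     ideal_gen (fun g => g \in take i s) a)
  /\ ~ ideal_gen (fun g => g \in s) 1.

Definition depth_eq P (n : nat) : Prop :=
  (exists s, [/\ regular_sequence s, {in s, forall a, P a} & size s = n])
  /\ forall s, regular_sequence s -> {in s, forall a, P a} -> (size s <= n)%N.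

Definition prime_chain_to P (n : nat) (Q : nat -> A -> Prop) : Prop :=
  [/\ forall i, (i <= n)%N -> prime_ideal (Q i),
      forall i, (i < n)%N ->
        (forall a, Q i a -> Q i.+1 a) /\ (exists2 a, Q i.+1 a & ~ Q i a) &
      forall a, Q n a <-> P a].

Definition height_eq P (n : nat) : Prop :=
  (exists Q, prime_chain_to P n Q)
  /\ forall m Q, prime_chain_to P m Q -> (m <= n)%N.

(* depth(P, A) = codim P at every maximal ideal P; this avoids localizing and *)
(* is the same as depth A_P = dim A_P for every such P.                       *)
Definition Cohen_Macaulay : Prop :=
  noetherian /\
  forall P, maximal_ideal P -> exists2 n, depth_eq P n & height_eq P n.

End CohenMacaulay.

Section Resolutions.
Variable S : comNzRingType.

Definition finite_free (V : lmodType S) : Prop :=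
  exists (B : finType) (b : B -> V),
  forall v, exists! c : {ffun B -> S}, v = \sum_i c i *: b i.

Definition free_resolution (F : nat -> lmodType S)
    (bd : forall k, F k.+1 -> F k) (N : lmodType S) (eps : F 0 -> N) : Prop :=
  [/\ forall k, finite_free (F k),
      (forall k, linear (bd k)) /\ linear eps,
      forall k z, bd k z = 0 <-> exists w, z = bd k.+1 w,
      forall z, eps z = 0 <-> exists w, z = bd 0 w &
      forall v, exists z, eps z = v].

End Resolutions.

Section EagonNorthcott.
Variables (S : comNzRingType) (n : nat) (M : 'M[S]_(2, n)).

Definition minor2 (a b : 'I_n) : S := \det (colsub (tnth [tuple a; b]) M).

(* Basis of EN_(k+1) = (Sym_k G)^* (x) /\^(k+2) F: the pair (a, J) stands for *)
(* u^(a) v^(k-a) (x) f_J, where f_J is the wedge of the f_j, j in J, taken in *)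
(* increasing order.                                                          *)
Definition EN_basis (k : nat) : finType :=
  ('I_k.+1 * {J : {set 'I_n} | #|J| == k.+2})%type.

Definition EN (k : nat) : lmodType S :=
  if k is k'.+1 then {ffun EN_basis k' -> S^o} : lmodType S
  else S^o : lmodType S.

Definition EN_elt (k a : nat) (J : {set 'I_n}) : EN k.+1 :=
  [ffun p : EN_basis k => ((p.1 == a :> nat) && (val p.2 == J))%:R].

Definition EN_bd0 (p : EN_basis 0) : EN 0 :=
  \sum_(a < n) \sum_(b < n | (a < b)%N && (val p.2 == [set a; b])) minor2 a b.

(* The position of j in J is the number of elements of J below j. The second  *)
(* component of (a, k+1-a) is positive iff a <= k.                            *)
Definition EN_bdS (k : nat) (p : EN_basis k.+1) : EN k.+1 :=
  let J := val p.2 in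
  \sum_(j in J) (-1) ^+ #|[set i in J | (i < j)%N]| *:
    ((if nat_of_ord p.1 is a.+1 then M 0 j *: EN_elt k a (J :\ j) else 0)
     + (if (p.1 <= k)%N then M 1 j *: EN_elt k p.1 (J :\ j) else 0)).

Definition EN_bd (k : nat) : EN k.+1 -> EN k :=
  match k return EN k.+1 -> EN k with
  | 0 => fun z : {ffun EN_basis 0 -> S^o} => \sum_p z p *: EN_bd0 p
  | k'.+1 => fun z : {ffun EN_basis k'.+1 -> S^o} => \sum_p z p *: EN_bdS p
  end.

End EagonNorthcott.

Section MonomialOrders.
Variable n : nat.

Definition monomial_order (le : rel 'X_{1..n}) : Prop :=
  [/\ total le, antisymmetric le, transitive le,
      forall m m1 m2, le m1 m2 -> le (m + m1)%MM (m + m2)%MM &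
      forall m, le 0%MM m].

Variable k : fieldType.

Definition is_lead_monomial (le : rel 'X_{1..n}) (f : {mpoly k[n]})
    (m : 'X_{1..n}) : Prop :=
  m \in msupp f /\ {in msupp f, forall m', le m' m}.

Definition initial_ideal (le : rel 'X_{1..n}) (I : {mpoly k[n]} -> Prop) :
    {mpoly k[n]} -> Prop :=
  ideal_gen (fun g =>
    exists f m, [/\ I f, is_lead_monomial le f m & g = 'X_[m]]).

Definition monomial_ideal (Q : 'X_{1..n} -> Prop) : {mpoly k[n]} -> Prop :=
  ideal_gen (fun g => exists2 m, Q m & g = 'X_[m]).

Definition quadratic_monomial (m : 'X_{1..n}) : Prop :=
  exists i j : 'I_n, m = (U_(i) + U_(j))%MM.

End MonomialOrders.

(* S = k[x_0, ..., x_(d-1), y_0, ..., y_(e-1)] is {mpoly k[d + e]}, with the  *)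
(* x_i first; k[s, t] is {mpoly k[2]}, with s = 'X_0 and t = 'X_1.            *)
Section WeightedRationalCurve.
Variables (k : fieldType) (d e : nat).
Local Notation S := {mpoly k[d + e]}.

Definition wrc_image (i : 'I_(d + e)) : {mpoly k[2]} :=
  match split i with
  | inl i => 'X_0 ^+ (d - i) * 'X_1 ^+ i
  | inr i => 'X_0 ^+ (e - 1 - i) * 'X_1 ^+ (e * d - (e - 1) + i)
  end.

Definition wrc_map (p : S) : {mpoly k[2]} :=
  p \mPo [tuple wrc_image i | i < d + e].

Definition wrc_ideal : {pred S} := [pred p | wrc_map p == 0].

Fact wrc_ideal_closed : idealr_closed wrc_ideal.
Proof.
split=> [||c u v]; rewrite !inE /wrc_map ?rmorph0 ?rmorph1 ?oner_eq0 //.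
by move=> /eqP hu /eqP hv; rewrite rmorphD rmorphM /= hu hv mulr0 addr0.
Qed.

HB.instance Definition _ :=
  isIdealr.Build S wrc_ideal wrc_ideal_closed.

Definition wrc_ring : Type := {ideal_quot wrc_ideal}.
HB.instance Definition _ := GRing.ComNzRing.on wrc_ring.

Definition wrc_proj (p : S) : wrc_ring := \pi_{ideal_quot wrc_ideal} p.

Definition wrc_scale (p : S) (r : wrc_ring) : wrc_ring := wrc_proj p * r.

Fact wrc_scaleA p q r : wrc_scale p (wrc_scale q r) = wrc_scale (p * q) r.
Proof. by rewrite /wrc_scale /wrc_proj rmorphM mulrA. Qed.
Fact wrc_scale1 : left_id 1 wrc_scale.
Proof. by move=> r; rewrite /wrc_scale /wrc_proj rmorph1 mul1r. Qed.
Fact wrc_scaleDr : right_distributive wrc_scale +%R.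
Proof. by move=> p r r'; rewrite /wrc_scale mulrDr. Qed.
Fact wrc_scaleDl r : {morph wrc_scale^~ r : p q / p + q}.
Proof. by move=> p q; rewrite /wrc_scale /wrc_proj rmorphD mulrDl. Qed.

HB.instance Definition _ := GRing.Zmodule_isLmodule.Build S wrc_ring
  wrc_scaleA wrc_scale1 wrc_scaleDr wrc_scaleDl.

(* The default value 0 is never reached by the entries of [wrc_matrix].       *)
Definition wrc_x (i : nat) : S :=
  if insub i is Some j then 'X_(lshift e (j : 'I_d)) else 0.
Definition wrc_y (i : nat) : S :=
  if insub i is Some j then 'X_(rshift d (j : 'I_e)) else 0.

Definition wrc_matrix : 'M[S]_(2, d + e - 1) :=
  \matrix_(r < 2, j < d + e - 1)
    if (j < d - 1)%N then (if r == 0 then wrc_x j else wrc_x j.+1)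
    else if j == (d - 1)%N :> nat
         then (if r == 0 then wrc_x (d - 1) ^+ e else wrc_y 0)
    else (if r == 0 then wrc_y (j - d) else wrc_y (j - d).+1).

End WeightedRationalCurve.

Arguments wrc_ideal : clear implicits.
Arguments wrc_proj : clear implicits.
Arguments EN_bd {S n} M k z.

(* Main.v *)
(* Every column of M has ratio t/s under phi, so the minors lie in I. For a   *)
(* suitable weight order each minor has a quadratic leading term, and the     *)
(* monomials divisible by none of these are products of two powers of         *)
(* consecutive "corner" variables x_0, x_(d-1), y_(e-1) and at most one       *)
(* further variable; distinct ones have distinct images under phi. Hence the  *)
(* minors are a Groebner basis of I.                                          *)
(*                                                                            *)
(* For another weight the diagonal terms of the minors lead, and the leading  *)
(* part of the Eagon-Northcott differential is a multigraded complex whose    *)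
(* cells are pairs of column sets A < B. Inserting or deleting the last       *)
(* column dividing the multidegree (in B), or else the first one (in A), is a *)
(* perfect matching on the cells of positive degree, and it is triangular for *)
(* the full differential; this gives exactness with no grade computation.     *)
(*                                                                            *)
(* R is a subring of k[s,t], so any three elements are algebraically          *)
(* dependent; the lowest term of a dependence bounds by 2 both the length of  *)
(* chains of primes and that of regular sequences. A maximal ideal contains   *)
(* nonzero polynomials f(s^d) and g(t^(ed)) by the Nullstellensatz. They form *)
(* a regular sequence because k[s,t] / R has no g(t^(ed))-torsion, and an     *)
(* ideal maximal among those containing the first and missing the products of *)
(* elements outside P with powers of the second is a prime strictly between 0 *)
(* and P.                                                                     *)

Require Import Defs.
From HB Require Import structures.
From mathcomp Require Import all_boot all_order all_algebra.
From mathcomp Require Import perm ring_quotient.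
From mathcomp Require Import mpoly.
From mathcomp Require Import zify ring.
From Stdlib Require Import ClassicalEpsilon.

Set Implicit Arguments.
Unset Strict Implicit.
Unset Printing Implicit Defensive.

Import GRing.Theory.
Local Open Scope ring_scope.

(** * The Eagon-Northcott complex *)

(** Statements (2) and (4) rest on one normal form. Modulo the minors every monomial reduces to a
    standard one of the same bidegree ([exists_std]), and a standard monomial is determined by its
    bidegree ([std_uniq]). Comparing coefficients then identifies the kernel of phi with the ideal
    of minors ([wrc_idealP]) and shows that no leading monomial of the kernel is standard
    ([wrc_initial_ideal]).

    For (3), the differential squares to zero over any commutative ring ([EN_complex]). Exactness is
    proved for matrices of monomials in [monomial_EN_exact]: [nontarget_pivot] and [cells_reduce]
    bring a cycle, modulo boundaries, into the span of the target cells, and there the differential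
    is injective by [target_triangular] and [cells_injective].

    For (1), depth and height are both 2 at every maximal ideal. The upper bounds
    [prime_chain_bound] and [regular_sequence_bound] follow from [dimension_identity]. For the lower
    bounds, [maximal_meets_line] supplies two elements of the maximal ideal, [wrc_regular] shows
    that they form a regular sequence, by [theta_divides] and [tdeg_shift], and [prime_between]
    turns this sequence into a chain of primes. *)

Lemma sum_antisym (n : nat) (V : zmodType) (J : {set 'I_n})
    (F : 'I_n -> 'I_n -> V) :
  (forall i j, i \in J -> j \in J -> (i < j)%N -> F j i = - F i j) ->
  \sum_(j in J) \sum_(i in J :\ j) F j i = 0.
Proof.
move=> anti.
have -> : \sum_(j in J) \sum_(i in J :\ j) F j i =
    \sum_(j in J) \sum_(i in J | (i < j)%N) F j i
    + \sum_(j in J) \sum_(i in J | (j < i)%N) F j i.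
  rewrite -big_split /=; apply: eq_bigr => j jJ.
  rewrite (bigID (fun i : 'I_n => (i < j)%N)) /=; congr (_ + _).
    by apply: eq_bigl => i; rewrite !inE -val_eqE /=; case: ltngtP; rewrite ?andbT ?andbF.
  by apply: eq_bigl => i; rewrite !inE -val_eqE /=; case: ltngtP; rewrite ?andbT ?andbF.
rewrite [X in _ + X](exchange_big_dep (mem J)) //=; last by move=> i j _ /andP[].
rewrite -big_split big1 //= => j jJ.
rewrite [X in _ + X](eq_bigl (fun i => (i \in J) && (i < j)%N)); last first.
  by move=> i; rewrite jJ.
rewrite -big_split big1 //= => i /andP[iJ ij].
by rewrite (anti i j) // addNr.
Qed.

Section EagonNorthcottComplex.
Variables (S : comNzRingType) (n : nat) (M : 'M[S]_(2, n)).
Implicit Types (J : {set 'I_n}) (k a : nat).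

Definition below j J := #|[set i in J | (i < j)%N]|.

(** Deleting the smaller element i lowers the position of j by one, whereas deleting j leaves the
    position of i unchanged. *)
Lemma below_antisym J (i j : 'I_n) : i \in J -> j \in J -> (i < j)%N ->
  (-1) ^+ below j J * (-1) ^+ below i (J :\ j)
  = - ((-1) ^+ below i J * (-1) ^+ below j (J :\ i)) :> S.
Proof.
move=> iJ jJ ij.
have -> : below i (J :\ j) = below i J.
  apply: eq_card => l; rewrite !inE; case: (altP (l =P j)) => //= ->.
  by rewrite ltnNge (ltnW ij) andbF.
have -> : below j J = (below j (J :\ i)).+1.
  rewrite /below (cardsD1 i) inE iJ ij add1n; congr _.+1.
  by apply: eq_card => l; rewrite !inE andbA.
by rewrite exprS mulN1r mulNr mulrC.
Qed.

(* The second index of EN_elt shifted by 2, so that applying the differential *)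
(* twice never leaves the natural numbers.                                    *)
Definition EN_shift k a J : EN S n k.+1 :=
  if a is a'.+2 then EN_elt S k a' J else 0.

Lemma EN_elt0 k a J : (#|J| != k.+2) || (k < a)%N -> EN_elt S k a J = 0.
Proof.
move=> h; apply/ffunP=> -[b [J' cJ']]; rewrite !ffunE /=.
case: eqP => //= ba; case: eqP => //= J'J.
by move: h; rewrite -J'J cJ' /= -ba ltnNge -ltnS ltn_ord.
Qed.

Lemma EN_elt_delta k (p : EN_basis n k) :
  EN_elt S k p.1 (val p.2) = [ffun q => (q == p)%:R].
Proof.
apply/ffunP=> q; rewrite !ffunE; congr (_%:R).
Qed.

Lemma EN_expand k (z : EN S n k.+1) :
  z = \sum_p (z : {ffun EN_basis n k -> S}) p *: EN_elt S k p.1 (val p.2).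
Proof.
apply/ffunP=> q; rewrite sum_ffunE (bigD1 q) //= big1.
  by rewrite EN_elt_delta !ffunE eqxx addr0 /= [_ *: _]mulr1.
move=> p pq; rewrite EN_elt_delta !ffunE eq_sym (negbTE pq).
by rewrite scaler0.
Qed.

Lemma EN_bd_linear k : linear (EN_bd M k).
Proof.
case: k => [|k] c x y /=.
all: rewrite scaler_sumr -big_split; apply: eq_bigr => p _ /=.
all: by rewrite !ffunE scalerDl scalerA.
Qed.

Lemma EN_bd_0 k : EN_bd M k 0 = 0.
Proof.
by have := @EN_bd_linear k (-1) 0 0; rewrite scaler0 addr0 scaleN1r addNr.
Qed.

Lemma EN_bd_sum k (I : Type) (r : seq I) (P : pred I) (F : I -> EN S n k.+1) :
  EN_bd M k (\sum_(i <- r | P i) F i) = \sum_(i <- r | P i) EN_bd M k (F i).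
Proof.
elim/big_rec2: _ => [|i x y _ <-]; first exact: EN_bd_0.
by have := @EN_bd_linear k 1 (F i) y; rewrite !scale1r.
Qed.

Lemma EN_bdZ k c (x : EN S n k.+1) : EN_bd M k (c *: x) = c *: EN_bd M k x.
Proof.
by have := @EN_bd_linear k c x 0; rewrite !addr0 EN_bd_0 addr0.
Qed.

Lemma EN_bdD k (x y : EN S n k.+1) : EN_bd M k (x + y) = EN_bd M k x + EN_bd M k y.
Proof. by have := @EN_bd_linear k 1 x y; rewrite !scale1r. Qed.

Lemma EN_bd_basis k (p : EN_basis n k.+1) :
  EN_bd M k.+1 (EN_elt S k.+1 p.1 (val p.2)) = EN_bdS M p.
Proof.
rewrite /= (bigD1 p) //= big1; last first.
  move=> q qp; have /= := EN_elt_delta p => ->; rewrite ffunE (negbTE qp).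
  exact: scale0r.
by have /= := EN_elt_delta p => ->; rewrite ffunE eqxx addr0 [_ *: _]scale1r.
Qed.

(** In shifted form the case distinctions of [EN_bdS] disappear: an exponent or a set out of range
    gives the zero vector, so the formula holds for all [a] and [J] and can be iterated. *)
Lemma EN_bd_shift k a J :
  EN_bd M k.+1 (EN_shift k.+1 a J) =
  \sum_(j in J) (-1) ^+ below j J *:
    (M 0 j *: EN_shift k a.-1 (J :\ j) + M 1 j *: EN_shift k a (J :\ j)).
Proof.
case: a => [|[|a]]; try by rewrite EN_bd_0 big1 //= => j _; rewrite !scaler0 addr0 scaler0.
have [cJ|cJ] := boolP (#|J| == k.+3); last first.
  rewrite [EN_shift _ _ _]EN_elt0 ?cJ // EN_bd_0 big1 // => j jJ.
  have hz b : EN_elt S k b (J :\ j) = 0.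
    by rewrite EN_elt0 //; move: cJ; rewrite (cardsD1 j) jJ add1n eqSS => ->.
  by case: a => [|a]; rewrite /= ?hz !scaler0 addr0 scaler0.
have [ak|ak] := ltnP k.+1 a.
  rewrite [EN_shift _ _ _]EN_elt0 ?ak ?orbT // EN_bd_0 big1 // => j jJ.
  case: a ak => [|a] //= ak.
  have ak1 : (k < a)%N by [].
  rewrite (@EN_elt0 k a) ?ak1 ?orbT // (@EN_elt0 k a.+1) ?(ltnW ak) ?orbT //.
  by rewrite !scaler0 addr0 scaler0.
have la : (a < k.+2)%N by rewrite ltnS.
pose p : EN_basis n k.+1 := (Ordinal la, exist _ J cJ).
rewrite (EN_bd_basis p) /EN_bdS /=; apply: eq_bigr => j _.
congr (_ *: (_ + _)); first by case: (a) => //; rewrite scaler0.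
by case: leqP => // h; rewrite EN_elt0 ?h ?orbT ?scaler0.
Qed.

(** The two orders of deleting a pair carry opposite signs, while the products of entries are
    symmetric in the pair once the two mixed ones are exchanged; [sum_antisym] concludes. *)
Lemma EN_bd_bd_shift k a J : EN_bd M k.+1 (EN_bd M k.+2 (EN_shift k.+2 a J)) = 0.
Proof.
rewrite EN_bd_shift EN_bd_sum.
under eq_bigr => j jJ.
  rewrite EN_bdZ EN_bdD !EN_bdZ !EN_bd_shift !scaler_sumr -big_split scaler_sumr.
  over.
rewrite sum_antisym // => i j iJ jJ ij /=.
have -> : (J :\ i) :\ j = (J :\ j) :\ i by apply/setP=> l; rewrite !inE andbCA.
rewrite !scalerDr !scalerA.
have sg (x y : S) : (-1) ^+ below j J * x * (-1) ^+ below i (J :\ j) * y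
   = - ((-1) ^+ below i J * y * (-1) ^+ below j (J :\ i) * x).
  have := below_antisym iJ jJ ij; move: ((-1) ^+ _) ((-1) ^+ _) ((-1) ^+ _) ((-1) ^+ _).
  move=> s4 s3 s2 s1 h; transitivity (s1 * s2 * (x * y)); first by ring.
  by rewrite h; ring.
rewrite (sg (M 0 j) (M 0 i)) (sg (M 0 j) (M 1 i)) (sg (M 1 j) (M 0 i)) (sg (M 1 j) (M 1 i)).
rewrite !scaleNr -!opprD; congr (- _).
by rewrite -!addrA; congr (_ + _); rewrite addrCA.
Qed.

Lemma minor2E (a b : 'I_n) : minor2 M a b = M 0 a * M 1 b - M 0 b * M 1 a.
Proof.
rewrite /minor2 (expand_det_row _ ord0) !big_ord_recl big_ord0 addr0.
rewrite /cofactor !det_mx11 !mxE !(tnth_nth a) /= expr0 expr1 mulN1r mul1r mulrN.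
by congr (_ * M _ _ - _ * M _ _); apply: val_inj.
Qed.

Lemma EN_bd0_basis (p : EN_basis n 0) :
  EN_bd M 0 (EN_elt S 0 p.1 (val p.2)) = EN_bd0 M p.
Proof.
rewrite /= (bigD1 p) //= big1; last first.
  move=> q qp; have /= := EN_elt_delta p => ->; rewrite ffunE (negbTE qp).
  exact: scale0r.
by have /= := EN_elt_delta p => ->; rewrite ffunE eqxx addr0 [_ *: _]scale1r.
Qed.

Lemma EN_bd0E (p : EN_basis n 0) (a b : 'I_n) : (a < b)%N ->
  val p.2 = [set a; b] -> EN_bd0 M p = minor2 M a b.
Proof.
move=> ab eJ.
have nba : (b == a) = false by rewrite -val_eqE gtn_eqF.
rewrite /EN_bd0 /= (bigD1 a) //= (bigD1 b) //= ?ab ?eJ ?eqxx //.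
rewrite big1; last first.
  move=> i /andP[/andP[ai /eqP/setP e] ib]; move/(_ b): e.
  by rewrite !inE eqxx nba eq_sym (negbTE ib).
rewrite big1; last first.
  move=> c ca; rewrite big1 // => i /andP[ci /eqP e].
  have: a \in [set c; i] by rewrite -e !inE eqxx.
  rewrite !inE eq_sym (negbTE ca) /= => /eqP ai.
  have: b \in [set c; i] by rewrite -e !inE eqxx orbT.
  by rewrite !inE -ai nba orbF => /eqP bc; move: ci; rewrite -bc -ai ltnNge ltnW.
by rewrite !addr0.
Qed.

(** Writing the minor as a signed sum over ordered pairs gives the last differential the same shape
    as the others, ready for antisymmetry. *)
Lemma EN_bd0_pairs (J : {set 'I_n}) : #|J| == 2 ->
  EN_bd M 0 (EN_elt S 0 0 J) =
  \sum_(j in J) \sum_(i in J :\ j)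
    (-1) ^+ below j J * (-1) ^+ below i (J :\ j) * (M 0 j * M 1 i).
Proof.
move=> cJ; pose p : EN_basis n 0 := (ord0, exist _ J cJ).
have -> : EN_bd M 0 (EN_elt S 0 0 J) = EN_bd0 M p by exact: (EN_bd0_basis p).
have /cards2P [a [b [ab eJ]]] := cJ.
wlog {ab} ab : a b eJ / (a < b)%N.
  move=> H; move: ab; rewrite -val_eqE neq_ltn => /orP[]; first exact: H.
  by apply: H; rewrite setUC.
have nab : (a == b) = false by rewrite -val_eqE ltn_eqF.
have nba : (b == a) = false by rewrite eq_sym.
have Ja : J :\ a = [set b] by apply/setP=> l; rewrite eJ !inE; case: eqP => //= ->; rewrite nab.
have Jb : J :\ b = [set a].
  by apply/setP=> l; rewrite eJ !inE; case: (l =P b) => //= [->|]; rewrite ?nba ?orbF.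
rewrite [RHS](big_setD1 a) ?eJ ?inE ?eqxx //= -eJ Ja !big_set1 Jb big_set1.
have s1 (x : 'I_n) : below x [set x] = 0%N.
  by apply/eqP; rewrite cards_eq0 -subset0; apply/subsetP=> l; rewrite !inE;
     case: eqP => //= ->; rewrite ltnn.
have bJa : below a J = 0%N.
  apply/eqP; rewrite cards_eq0 -subset0; apply/subsetP=> l; rewrite eJ !inE.
  by case: eqP => [->|_]; rewrite ?ltnn //=; case: eqP => //= ->; rewrite ltnNge ltnW.
have bJb : below b J = 1%N.
  rewrite /below -[RHS](cards1 a); apply: eq_card => l; rewrite eJ !inE.
  by case: (l =P a) => [->|_] //=; case: eqP => //= ->; rewrite ltnn.
rewrite bJa bJb !s1.
rewrite (@EN_bd0E p a b) //.
by rewrite minor2E !(expr0, expr1, mul1r, mulr1, mulN1r, addr0).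
Qed.

Local Arguments EN_bd : simpl never.

(** This is the vanishing of a 3 by 3 determinant with a repeated row of [M]. The minors are
    expanded starting with that row, by [bd0] for the top and [bd1] for the bottom one, so that two
    entries of the same row are multiplied and the terms cancel in pairs. *)
Lemma EN_bd0_bd1 (p : EN_basis n 1) :
  EN_bd M 0 (EN_bd M 1 (EN_elt S 1 p.1 (val p.2))) = 0.
Proof.
set J := val p.2; have cJ : #|J| == 3 := valP p.2.
have cJj j : j \in J -> #|J :\ j| == 2 by move=> jJ; move: cJ; rewrite (cardsD1 j) jJ.
have := EN_bd_shift 0 p.1.+2 J; rewrite /EN_shift => ->; rewrite EN_bd_sum.
have bd0 j : j \in J -> EN_bd M 0 (EN_elt S 0 0 (J :\ j)) =
   \sum_(i in J :\ j) (-1) ^+ below i (J :\ j) * M 0 i *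
     (\sum_(l in J :\ j :\ i) (-1) ^+ below l (J :\ j :\ i) * M 1 l).
  move=> jJ; rewrite EN_bd0_pairs ?cJj //; apply: eq_bigr => i _.
  by rewrite mulr_sumr; apply: eq_bigr => l _; rewrite -!mulrA; congr (_ * _); rewrite mulrCA.
have bd1 j : j \in J -> EN_bd M 0 (EN_elt S 0 0 (J :\ j)) =
   - \sum_(i in J :\ j) (-1) ^+ below i (J :\ j) * M 1 i *
     (\sum_(l in J :\ j :\ i) (-1) ^+ below l (J :\ j :\ i) * M 0 l).
  move=> jJ; rewrite EN_bd0_pairs ?cJj //; apply/eqP; rewrite -subr_eq0 opprK; apply/eqP.
  under [X in _ + X]eq_bigr => i _ do rewrite mulr_sumr.
  rewrite -big_split /=.
  under eq_bigr => i _ do rewrite -big_split /=.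
  rewrite sum_antisym // => i l iJ lJ il.
  have := below_antisym iJ lJ il.
  move: ((-1) ^+ _) ((-1) ^+ _) ((-1) ^+ _) ((-1) ^+ _) => s4 s3 s2 s1 h.
  transitivity ((s1 * s2) * (M 0 l * M 1 i + M 1 l * M 0 i)); first by ring.
  by rewrite h; ring.
have scE (x : S) (y : S^o) : x *: y = x * y :> S by [].
have JC (i j : 'I_n) : J :\ i :\ j = J :\ j :\ i by apply/setP=> l; rewrite !inE andbCA.
have sg (i j : 'I_n) (x : S) : i \in J -> j \in J -> (i < j)%N ->
   (-1) ^+ below j J * ((-1) ^+ below i (J :\ j) * x)
   = - ((-1) ^+ below i J * ((-1) ^+ below j (J :\ i) * x)).
  by move=> iJ jJ ij; rewrite mulrA below_antisym // mulNr !mulrA.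
case: (p.1 : nat) (ltn_ord p.1) => [|[|]] //= _.
  under eq_bigr => j jJ.
    rewrite scaler0 add0r !EN_bdZ bd1 // scalerN scalerN !scaler_sumr.
    over.
  rewrite sumrN sum_antisym ?oppr0 // => i j iJ jJ ij; rewrite [J :\ i :\ j]JC.
  set X := \sum_(_ in _) _.
  rewrite !scE.
  have := sg i j (M 1 i * M 1 j * X) iJ jJ ij.
  move: ((-1) ^+ _) ((-1) ^+ _) ((-1) ^+ _) ((-1) ^+ _) => s4 s3 s2 s1 h.
  transitivity (s1 * (s2 * (M 1 i * M 1 j * X))); first by ring.
  by rewrite h; ring.
under eq_bigr => j jJ.
  rewrite [EN_elt S 0 1 _]EN_elt0 ?orbT // scaler0 addr0 !EN_bdZ bd0 // !scaler_sumr.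
  over.
rewrite sum_antisym // => i j iJ jJ ij; rewrite [J :\ i :\ j]JC.
set X := \sum_(_ in _) _.
rewrite !scE.
have := sg i j (M 0 i * M 0 j * X) iJ jJ ij.
move: ((-1) ^+ _) ((-1) ^+ _) ((-1) ^+ _) ((-1) ^+ _) => s4 s3 s2 s1 h.
transitivity (s1 * (s2 * (M 0 i * M 0 j * X))); first by ring.
by rewrite h; ring.
Qed.

Lemma EN_complex k (z : EN S n k.+2) : EN_bd M k (EN_bd M k.+1 z) = 0.
Proof.
rewrite [in LHS](EN_expand z) [EN_bd M k.+1 _]EN_bd_sum EN_bd_sum big1 // => p _.
rewrite [EN_bd M k.+1 _]EN_bdZ EN_bdZ.
case: k z p => [|k] z p; first by rewrite EN_bd0_bd1 scaler0.
by have := EN_bd_bd_shift k p.1.+2 (val p.2) => /= ->; rewrite scaler0.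
Qed.

Lemma EN_finite_free k : finite_free (EN S n k).
Proof.
case: k => [|k].
  exists unit, (fun=> 1 : S^o) => v; exists [ffun=> v]; split.
    by rewrite (big_pred1 tt) ?ffunE => [|[]//]; rewrite [_ *: _]mulr1.
  move=> c ->; apply/ffunP=> -[]; rewrite ffunE (big_pred1 tt) => [|[]//].
  by rewrite [_ *: _]mulr1.
exists (EN_basis n k), (fun p : EN_basis n k => EN_elt S k p.1 (val p.2)) => v; exists v; split.
  exact: EN_expand.
move=> c ->; apply/ffunP=> q; rewrite sum_ffunE (bigD1 q) //= big1.
  by rewrite EN_elt_delta !ffunE eqxx addr0 [_ *: _]mulr1.
by move=> p pq; rewrite EN_elt_delta !ffunE eq_sym (negbTE pq) scaler0.
Qed.

End EagonNorthcottComplex.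

(** * Discrete Morse theory on cells of free modules *)

Section PolynomialCells.
Variables (K : fieldType) (N : nat) (P : finType).
Local Notation S := {mpoly K[N]}.
Local Notation V := {ffun P -> S^o}.
Implicit Types (z : V) (c : 'X_{1..N}) (p : P).

Definition cell c p : V := [ffun q => if q == p then 'X_[c] else 0].

Lemma cell_expand z :
  z = \sum_p \sum_(c <- msupp (z p)) ((z p)@_c)%:MP *: cell c p.
Proof.
apply/ffunP=> q; rewrite sum_ffunE (bigD1 q) //= [X in _ + X]big1 ?addr0; last first.
  move=> p pq; rewrite sum_ffunE big1 // => c _.
  by rewrite !ffunE eq_sym (negbTE pq) scaler0.
rewrite sum_ffunE {1}[z q]mpolyE; apply: eq_bigr => c _.
by rewrite !ffunE eqxx -mul_mpolyC.
Qed.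

(* Discrete Morse theory: [A t b] is the coefficient of [b] in the boundary   *)
(* of [t]; the hypothesis makes A triangular on the cells of T.               *)
Lemma cells_injective (C : Type) (A : 'X_{1..N} -> P -> C -> K)
    (T : 'X_{1..N} -> P -> Prop) (nu : 'X_{1..N} -> P -> nat) z :
  (forall c p, T c p -> exists b, A c p b != 0 /\
     forall c' p', T c' p' -> A c' p' b != 0 ->
       (c', p') = (c, p) \/ (nu c p < nu c' p')%N) ->
  (forall c p, (z p)@_c != 0 -> T c p) ->
  (forall b, \sum_p \sum_(c <- msupp (z p)) (z p)@_c * A c p b = 0) ->
  z = 0.
Proof.
move=> triang suppT zero.
(* [nu] is bounded on the finite support of z, so the coefficients can be shown to vanish by
   induction downwards from the largest value. *)
pose B := (\max_p \max_(c <- msupp (z p)) nu c p)%N.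
have leB c p : (z p)@_c != 0 -> (nu c p <= B)%N.
  rewrite -mcoeff_msupp => cz; apply: leq_trans (leq_bigmax p).
  exact: (leq_bigmax_seq (F := fun c => nu c p) c cz).
suff z0 m c p : (B - nu c p <= m)%N -> (z p)@_c = 0.
  by apply/ffunP=> p; apply/mpolyP=> c; rewrite ffunE mcoeff0 (z0 (B - nu c p)%N).
elim/ltn_ind: m c p => m IH c p lem; apply/eqP/negPn/negP => zcp.
have [b [Ab trb]] := triang c p (suppT _ _ zcp).
have others c' p' : c' \in msupp (z p') -> (c', p') != (c, p) -> A c' p' b = 0.
  rewrite mcoeff_msupp => zcp' ne; apply/eqP; apply: contraTT ne => Ab'.
  case: (trb c' p' (suppT _ _ zcp') Ab') => [->|lt]; first by rewrite eqxx.
  have lt' : (B - nu c' p' < m)%N.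
    by apply: leq_trans lem; have := leB _ _ zcp'; have := leB _ _ zcp; lia.
  by have := IH _ lt' c' p' (leqnn _) => z0; rewrite z0 eqxx in zcp'.
have := zero b; rewrite (bigD1 p) //= [X in _ + X]big1 ?addr0; last first.
  move=> p' ne; rewrite big_seq big1 // => c' c'z; rewrite others ?mulr0 //.
  by apply: contraNneq ne => -[_ ->].
have cz : c \in msupp (z p) by rewrite mcoeff_msupp.
rewrite (bigD1_seq c) ?msupp_uniq //= big_seq_cond big1 ?addr0; last first.
  move=> c' /andP[c'z ne]; rewrite others ?mulr0 //.
  by apply: contraNneq ne => -[->].
by move/eqP; rewrite mulf_eq0 (negbTE zcp) (negbTE Ab).
Qed.

(** Modulo the image of D, a cell outside T is a combination of cells of smaller [mu], by its pivot;
    since [mu] takes values in the naturals, the replacement ends inside T. *)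
Lemma cells_reduce (W : lmodType S) (D : W -> V)
    (T : 'X_{1..N} -> P -> Prop) (mu : 'X_{1..N} -> P -> nat) z :
  linear D ->
  (forall c p, ~ T c p -> exists w, (D w p)@_c != 0 /\
     forall c' p', (D w p')@_c' != 0 ->
       (c', p') = (c, p) \/ (mu c' p' < mu c p)%N) ->
  exists w, forall c p, ((z - D w) p)@_c != 0 -> T c p.
Proof.
move=> linD pivot.
have D0 : D 0 = 0 by have := linD (-1) 0 0; rewrite scaler0 addr0 scaleN1r addNr.
have DD x y : D (x + y) = D x + D y by have := linD 1 x y; rewrite !scale1r.
have DZ a x : D (a *: x) = a *: D x by have := linD a x 0; rewrite D0 !addr0.
pose good z := exists w, forall c p, ((z - D w) p)@_c != 0 -> T c p.
have goodD x y : good x -> good y -> good (x + y).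
  move=> [w hw] [w' hw']; exists (w + w') => c p nz.
  have [e|ne] := eqVneq (((x - D w) p)@_c) 0; last exact: hw ne.
  apply: hw'; apply: contra nz => /eqP e'; move: e e'.
  rewrite DD !ffunE !mcoeffD !mcoeffN mcoeffD => e e'.
  by rewrite opprD addrACA e e' addr0.
have goodZ a x : good x -> good (a%:MP *: x).
  move=> [w hw]; exists (a%:MP *: w) => c p nz; apply: hw; apply: contra nz.
  rewrite DZ -scalerBr !ffunE /= => /eqP e.
  by rewrite [_ *: _]mul_mpolyC mcoeffZ e mulr0.
have good0 : good 0 by exists 0 => c p; rewrite D0 subrr !ffunE mcoeff0 eqxx.
have good_cells (x : V) : (forall c p, (x p)@_c != 0 -> good (cell c p)) -> good x.
  move=> h; rewrite (cell_expand x); elim/big_ind: _ => // p _.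
  rewrite big_seq; elim/big_ind: _ => // c cx; apply/goodZ/h.
  by rewrite -mcoeff_msupp.
suff good_cell m c p : (mu c p <= m)%N -> good (cell c p).
  by apply: good_cells => c p _; apply: (good_cell (mu c p)).
elim/ltn_ind: m c p => m IH c p lem.
have [Tcp|nT] := classic (T c p).
  exists 0 => c' p'; rewrite D0 subr0 ffunE.
  case: (p' =P p) => [->|_]; last by rewrite mcoeff0 eqxx.
  by rewrite mcoeffX; case: (c =P c') => [<-|_]; rewrite ?eqxx.
have [w [nz low]] := pivot c p nT; set u := (D w p)@_c in nz.
pose r := cell c p - D ((u^-1)%:MP *: w).
have -> : cell c p = r + D ((u^-1)%:MP *: w) by rewrite subrK.
apply: goodD; last first.
  by exists ((u^-1)%:MP *: w) => c' p'; rewrite subrr ffunE mcoeff0 eqxx.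
apply: good_cells => c' p'.
rewrite /r DZ !ffunE mcoeffD mcoeffN [_ *: D w p']mul_mpolyC mcoeffZ => nz'.
have [e|ne] := eqVneq (c', p') (c, p).
  by case: e nz' => -> ->; rewrite eqxx mcoeffX eqxx mulVf // subrr eqxx.
have z0 : (if p' == p then 'X_[c] else 0 : S)@_c' = 0.
  case: (p' =P p) ne => [->|_]; last by rewrite mcoeff0.
  by rewrite mcoeffX; case: (c =P c') => [->|//]; rewrite eqxx.
have : (D w p')@_c' != 0.
  by apply: contraNneq nz' => ->; rewrite z0 mulr0 subrr.
case/low => [e|lt]; first by rewrite e eqxx in ne.
by apply: (IH (mu c' p')) => //; apply: leq_trans lem.
Qed.

End PolynomialCells.

(** * The Eagon-Northcott complex of a matrix of monomials *)

Section Ranks.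
Variable n : nat.
Implicit Types (J : {set 'I_n}) (i j : 'I_n).

Lemma below_ltn J i j : i \in J -> (i < j)%N -> (below i J < below j J)%N.
Proof.
move=> iJ ij; apply/proper_card/properP; split.
  by apply/subsetP=> l; rewrite !inE => /andP[-> li]; apply: ltn_trans ij.
by exists i; rewrite !inE ?iJ ?ij ?ltnn ?andbF.
Qed.

Lemma below_size J j : j \in J -> (below j J < #|J|)%N.
Proof.
move=> jJ; apply/proper_card/properP; split.
  by apply/subsetP=> l; rewrite inE => /andP[].
by exists j; rewrite ?inE ?ltnn ?andbF.
Qed.

Lemma below_setD1 J i j : below i J = (below i (J :\ j) + ((j \in J) && (j < i)))%N.
Proof.
rewrite /below (cardsD1 j) inE addnC; congr (_ + _)%N.
by apply: eq_card => l; rewrite !inE andbA.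
Qed.

Lemma below_surj J r : (r < #|J|)%N -> exists2 j, j \in J & below j J = r.
Proof.
move em: #|J| => m; elim: m J em r => [|m IH] J cJ r //.
rewrite ltnS => rm.
have /card_gt0P [j0 j0J] : (0 < #|J|)%N by rewrite cJ.
case: (arg_maxnP (fun j : 'I_n => j : nat) j0J) => j jJ' jmax.
have jJ : j \in J by [].
have cJj : #|J :\ j| = m by move: cJ; rewrite (cardsD1 j) jJ add1n => -[].
move: rm; rewrite leq_eqVlt => /orP[/eqP->|rm].
  exists j => //; rewrite -cJj; apply: eq_card => l; rewrite !inE andbC.
  case lJ: (l \in J); rewrite ?andbF ?andbT //.
  rewrite ltn_neqAle val_eqE; case: eqP => //= _.
  by apply: jmax.
have [i] := IH _ cJj r rm; rewrite !inE => /andP[ij iJ] <-.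
exists i => //; rewrite (below_setD1 J i j) ltnNge.
by rewrite (jmax i iJ : (i <= j)%N) /= andbF addn0.
Qed.

Lemma below_leq J i j : i \in J -> j \in J -> (below i J <= below j J)%N -> (i <= j)%N.
Proof.
by move=> iJ jJ; rewrite leqNgt => h; rewrite leqNgt; apply: contra h; apply: below_ltn.
Qed.

Lemma setD1_inj J i j : i \in J -> j \in J -> J :\ i = J :\ j -> i = j.
Proof.
by move=> iJ jJ /setP/(_ i); rewrite !inE eqxx iJ andbT /=; case: eqP.
Qed.

End Ranks.

(** Lexicographic comparison packed into one number: the tie-breaker r is at most 2, so a strict
    inequality between the weights decides. *)
Lemma ltn_3MD (x y r s : nat) : (x < y)%N -> (r <= 2)%N -> (3 * x + r < 3 * y + s)%N.
Proof. lia. Qed.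

Section MonomialEagonNorthcott.
Variables (K : fieldType) (N n : nat) (tm bm : 'I_n -> 'X_{1..N}).
Variable w : 'X_{1..N} -> nat.
Local Notation S := {mpoly K[N]}.
Variable M : 'M[S]_(2, n).
Hypothesis M0 : forall j, M 0 j = 'X_[tm j].
Hypothesis M1 : forall j, M 1 j = 'X_[bm j].
Hypothesis wD : {morph w : x y / (x + y)%MM >-> (x + y)%N}.
(** The diagonal term of each minor leads for [w]. The disjointness conditions below make it
    possible to insert a column into a cell without changing its multidegree. *)
Hypothesis w_lead : forall i j : 'I_n, (i < j)%N ->
  (w (bm i + tm j)%MM < w (tm i + bm j)%MM)%N.
Let disj (x y : 'X_{1..N}) := forall v, x v = 0%N \/ y v = 0%N.
Hypothesis tm_disj : forall i j, i != j -> disj (tm i) (tm j).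
Hypothesis bm_disj : forall i j, i != j -> disj (bm i) (bm j).
Hypothesis tb_disj : forall i j : 'I_n, (i < j)%N -> disj (tm i) (bm j).

Implicit Types (J : {set 'I_n}) (i j : 'I_n) (c m : 'X_{1..N}).

(* The multidegree of the cell of the initial complex with the [t] smallest   *)
(* columns of J taken from the top row and the others from the bottom row.    *)
Definition lab t J : 'X_{1..N} :=
  (\sum_(j in J) (if below j J < t then tm j else bm j)%N)%MM.

(** With [lab_bot], this describes the faces that keep the multidegree: the deleted column is taken
    from the row which its position in J assigns to it. *)
Lemma lab_top t J j : j \in J -> (below j J <= t)%N ->
  lab t.+1 J = (tm j + lab t (J :\ j))%MM.
Proof.
move=> jJ jt; rewrite /lab (big_setD1 j) //= ltnS jt; congr (_ + _)%MM.
apply: eq_bigr => i; rewrite !inE => /andP[ij iJ].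
rewrite (below_setD1 J i j) jJ /=.
case: (ltngtP j i) (ij) => [ji|ji|/val_inj->]; last by rewrite eqxx.
  by rewrite /= addn1 ltnS.
have lt := below_ltn iJ ji; have := below_setD1 J i j.
rewrite jJ /= ltnNge (ltnW ji) /= addn0 => e _.
have lt' := leq_trans lt jt.
by rewrite -e lt' ltnS ltnW.
Qed.

Lemma lab_bot t J j : j \in J -> (t <= below j J)%N ->
  lab t J = (bm j + lab t (J :\ j))%MM.
Proof.
move=> jJ jt; rewrite /lab (big_setD1 j) //= ltnNge jt; congr (_ + _)%MM.
apply: eq_bigr => i; rewrite !inE => /andP[ij iJ].
rewrite (below_setD1 J i j) jJ /=.
case: (ltngtP j i) (ij) => [ji|ji|/val_inj->]; last by rewrite eqxx.
  have lt := below_ltn jJ ji; have := below_setD1 J i j.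
  by rewrite jJ /= ji addn1 => e _;
     rewrite !ltnNge -e (leq_trans jt (ltnW lt)) -ltnS -e (leq_ltn_trans jt lt).
by rewrite /= addn0.
Qed.

Let setD1C J i j : J :\ i :\ j = J :\ j :\ i.
Proof. by apply/setP=> l; rewrite !inE andbCA. Qed.

(** Let i be the column of position t, so that i < j. The two multidegrees differ by exchanging the
    diagonal product of the columns i and j for the other one, and [w_lead] compares these.
    [lab_bot_low] is the mirror image. *)
Lemma lab_top_low t J j : j \in J -> (t < below j J)%N ->
  (w (tm j + lab t (J :\ j))%MM < w (lab t.+1 J))%N.
Proof.
move=> jJ tj; have [i iJ it] := below_surj (ltn_trans tj (below_size jJ)).
have ij : (i < j)%N.
  by rewrite ltnNge; apply/negP=> ji; move: tj; rewrite -it ltnNge;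
     case: ltngtP ji => // [ji _|/val_inj-> _]; rewrite ?leqnn // ltnW // below_ltn.
have ne : i != j by rewrite -val_eqE ltn_eqF.
rewrite (@lab_top t J i) ?it // (@lab_bot t (J :\ i) j); last first.
- by move: tj; rewrite (below_setD1 J j i) iJ ij addn1 ltnS.
- by rewrite !inE eq_sym ne.
rewrite (@lab_bot t (J :\ j) i) ?inE ?ne //; last first.
  by rewrite -it (below_setD1 J i j) [(j < i)%N]ltnNge (ltnW ij) andbF addn0.
rewrite [J :\ i :\ j]setD1C; have := w_lead ij; rewrite !wD; lia.
Qed.

Lemma lab_bot_low t J j : j \in J -> (below j J < t)%N -> (t < #|J|)%N ->
  (w (bm j + lab t (J :\ j))%MM < w (lab t J))%N.
Proof.
move=> jJ jt tJ; have [i iJ it] := below_surj tJ.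
have ji : (j < i)%N.
  by rewrite ltnNge; apply/negP=> ij; move: jt; rewrite -it ltnNge;
     case: ltngtP ij => // [ij _|/val_inj-> _]; rewrite ?leqnn // ltnW // below_ltn.
have ne : i != j by rewrite -val_eqE gtn_eqF.
case: t jt tJ it => // t jt tJ it.
rewrite (@lab_bot t.+1 J i) ?it // (@lab_top t (J :\ i) j); last first.
- by move: jt; rewrite (below_setD1 J j i) [(i < j)%N]ltnNge (ltnW ji) andbF addn0 ltnS.
- by rewrite !inE eq_sym ne.
rewrite (@lab_top t (J :\ j) i) ?inE ?ne //; last first.
  by have := it; rewrite (below_setD1 J i j) jJ ji addn1 => -[->].
rewrite [J :\ i :\ j]setD1C; have := w_lead ji; rewrite !wD; lia.
Qed.

Lemma lab_tm t J j : j \in J -> (below j J < t)%N -> (tm j <= lab t J)%MM.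
Proof. by case: t => // t jJ jt; rewrite (@lab_top _ _ j) // lem_addr. Qed.

Lemma lab_bm t J j : j \in J -> (t <= below j J)%N -> (bm j <= lab t J)%MM.
Proof. by move=> jJ jt; rewrite (@lab_bot _ _ j) // lem_addr. Qed.

Definition is_last m b := (bm b <= m)%MM && [forall j, (bm j <= m)%MM ==> (j <= b)%N].
Definition is_first m a := (tm a <= m)%MM && [forall j, (tm j <= m)%MM ==> (a <= j)%N].
Definition has_last m J := [exists b, is_last m b && (b \in J)].
Definition has_first m J := [exists a, is_first m a && (a \in J)].

Lemma is_last_inj m b b' : is_last m b -> is_last m b' -> b = b'.
Proof.
move=> /andP[h /forallP x] /andP[h' /forallP x']; apply/val_inj/eqP => /=.
by rewrite eqn_leq (implyP (x _) h') (implyP (x' _) h).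
Qed.

Lemma is_first_inj m b b' : is_first m b -> is_first m b' -> b = b'.
Proof.
move=> /andP[h /forallP x] /andP[h' /forallP x']; apply/val_inj/eqP => /=.
by rewrite eqn_leq (implyP (x _) h') (implyP (x' _) h).
Qed.

Lemma has_lastE m J b : is_last m b -> has_last m J = (b \in J).
Proof.
move=> hb; apply/existsP/idP => [[b' /andP[hb' b'J]]|bJ]; last by exists b; rewrite hb.
by rewrite (is_last_inj hb hb').
Qed.

Lemma has_firstE m J b : is_first m b -> has_first m J = (b \in J).
Proof.
move=> hb; apply/existsP/idP => [[b' /andP[hb' b'J]]|bJ]; last by exists b; rewrite hb.
by rewrite (is_first_inj hb hb').
Qed.

Lemma is_last_leq m b j : is_last m b -> (bm j <= m)%MM -> (j <= b)%N.
Proof. by case/andP=> _ /forallP h; apply/implyP. Qed.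

Lemma is_first_leq m a j : is_first m a -> (tm j <= m)%MM -> (a <= j)%N.
Proof. by case/andP=> _ /forallP h; apply/implyP. Qed.

Lemma exists_last m j : (bm j <= m)%MM -> exists b, is_last m b.
Proof.
move=> jm; case: (@arg_maxnP _ j (fun i => (bm i <= m)%MM) (fun i : 'I_n => i : nat) jm).
move=> b bm' bmax; exists b; rewrite /is_last bm' /=.
by apply/forallP=> i; apply/implyP=> /bmax.
Qed.

Lemma exists_first m j : (tm j <= m)%MM -> exists a, is_first m a.
Proof.
move=> jm; case: (@arg_minnP _ j (fun i => (tm i <= m)%MM) (fun i : 'I_n => i : nat) jm).
move=> a am amin; exists a; rewrite /is_first am /=.
by apply/forallP=> i; apply/implyP=> /amin.
Qed.

Section Cell.
Variables (k t : nat) (c : 'X_{1..N}) (J : {set 'I_n}).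
Hypotheses (cJ : #|J| = k.+2) (tk : (t <= k)%N).
Let m := (c + lab t.+1 J)%MM.

(** The largest element of J has position k+1 > t, hence contributes its bottom entry to the
    multidegree; so a last column exists, and it is not to the left of any element of J.
    [cell_first] uses the smallest element in the same way. *)
Lemma cell_last : exists2 b, is_last m b &
  (forall j, j \in J -> (j <= b)%N) /\ (b \in J -> below b J = k.+1).
Proof.
have [y yJ yk] : exists2 y, y \in J & below y J = k.+1.
  by apply: below_surj; rewrite cJ.
have ym : (bm y <= m)%MM.
  by apply: lepm_trans (lem_addl _ _); apply: lab_bm => //; rewrite yk.
have [b hb] := exists_last ym; exists b => //.
have yb := is_last_leq hb ym.
have Jy j : j \in J -> (j <= y)%N.
  by move=> jJ; apply: (below_leq jJ yJ); rewrite yk -ltnS -cJ below_size.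
split=> [j /Jy jy|bJ]; first exact: leq_trans jy yb.
by rewrite -yk; congr (below _ J); apply/eqP; rewrite eqn_leq yb Jy.
Qed.

Lemma cell_first : exists2 a, is_first m a &
  (forall j, j \in J -> (a <= j)%N) /\ (a \in J -> below a J = 0%N).
Proof.
have [y yJ y0] : exists2 y, y \in J & below y J = 0%N.
  by apply: below_surj; rewrite cJ.
have ym : (tm y <= m)%MM.
  by apply: lepm_trans (lem_addl _ _); apply: lab_tm => //; rewrite y0.
have [a ha] := exists_first ym; exists a => //.
have ay := is_first_leq ha ym.
have yJl j : j \in J -> (y <= j)%N by move=> jJ; apply: (below_leq yJ jJ); rewrite y0.
split=> [j /yJl|aJ]; first exact: leq_trans.
by rewrite -y0; congr (below _ J); apply/eqP; rewrite eqn_leq ay yJl.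
Qed.

(** No variable of x occurs in the label, so all of x must come from the coefficient c. Applied to
    the entry of a column to be inserted, this allows the entry to be moved from c to the label. *)
Lemma disj_lab (x : 'X_{1..N}) :
  (forall j, j \in J -> (below j J < t.+1)%N -> disj x (tm j)) ->
  (forall j, j \in J -> (t < below j J)%N -> disj x (bm j)) ->
  (x <= m)%MM -> (x <= c)%MM.
Proof.
move=> xt xb /mnm_lepP xm; apply/mnm_lepP=> v.
have [->//|xv] := eqVneq (x v) 0%N.
have lv : lab t.+1 J v = 0%N.
  rewrite /lab mnm_sumE big1 // => j jJ; case: ltnP => jt.
    by case: (xt j jJ jt v) => // e; rewrite e in xv.
  by case: (xb j jJ jt v) => // e; rewrite e in xv.
by have := xm v; rewrite mnmDE lv addn0.
Qed.

Lemma cell_add_last b : is_last m b -> b \notin J ->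
  [/\ (b |: J) :\ b = J, (bm b <= c)%MM, lab t.+1 (b |: J) = (bm b + lab t.+1 J)%MM
    & below b (b |: J) = k.+2].
Proof.
move=> hb bJ; have [b' hb' [Jb _]] := cell_last.
rewrite -(is_last_inj hb hb') in Jb.
have e : (b |: J) :\ b = J by rewrite setU1K.
have Jltb j : j \in J -> (j < b)%N.
  move=> jJ; rewrite ltn_neqAle Jb // andbT.
  by apply: contraNneq bJ => /val_inj <-.
have rb : below b (b |: J) = k.+2.
  rewrite (below_setD1 _ _ b) e ltnn andbF addn0 -cJ; apply: eq_card => j.
  by rewrite !inE; case jJ: (j \in J) => //=; apply: Jltb.
split=> //.
  apply: disj_lab; last by case/andP: hb.
    by move=> j jJ _ v; case: (tb_disj (Jltb j jJ) v); [right|left].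
  by move=> j jJ _; apply: bm_disj; rewrite -val_eqE gtn_eqF ?Jltb.
by rewrite (@lab_bot _ _ b) ?e ?setU11 // rb ltnS ltnW.
Qed.

Lemma cell_add_first a : is_first m a -> a \notin J ->
  [/\ (a |: J) :\ a = J, (tm a <= c)%MM, lab t.+2 (a |: J) = (tm a + lab t.+1 J)%MM
    & below a (a |: J) = 0%N].
Proof.
move=> ha aJ; have [a' ha' [Ja _]] := cell_first.
rewrite -(is_first_inj ha ha') in Ja.
have e : (a |: J) :\ a = J by rewrite setU1K.
have Jgta j : j \in J -> (a < j)%N.
  move=> jJ; rewrite ltn_neqAle Ja // andbT.
  by apply: contraNneq aJ => /val_inj ->.
have ra : below a (a |: J) = 0%N.
  rewrite (below_setD1 _ _ a) e ltnn andbF addn0; apply: eq_card0 => j.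
  rewrite !inE; case jJ: (j \in J) => //=; apply/negbTE.
  by rewrite -leqNgt ltnW // Jgta.
split=> //.
  apply: disj_lab; last by case/andP: ha.
    by move=> j jJ _; apply: tm_disj; rewrite -val_eqE ltn_eqF ?Jgta.
  by move=> j jJ _; apply: tb_disj; apply: Jgta.
by rewrite (@lab_top _ _ a) ?e ?setU11 // ra.
Qed.

End Cell.

(** * The matching on the cells and its triangularity *)

Local Notation basis := (EN_basis n).

Definition tot k c (p : basis k) := (c + lab p.1.+1 (val p.2))%MM.

(* The cells matched with one of lower degree: the last column of the bottom  *)
(* row dividing the multidegree is removed if another bottom column remains,  *)
(* and otherwise the first such column of the top row.                        *)
Definition target k c (p : basis k) :=
  has_last (tot c p) (val p.2)
  && ((p.1 < k)%N || has_first (tot c p) (val p.2)).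

(** Both [nu] and [mu] compare first by the weight of the multidegree. The last summand, at most 2,
    breaks ties within a multidegree: in [nu] among the target cells, in [mu] between a cell and the
    other faces of its pivot. *)
Definition nu k c (p : basis k) :=
  (3 * w (tot c p) + (if (p.1 < k)%N then 2 else 1))%N.

Definition mu k c (p : basis k) :=
  (3 * w (tot c p) + (if ~~ has_last (tot c p) (val p.2) then 2
                      else if ~~ has_first (tot c p) (val p.2) then 1 else 0))%N.

Definition bd_coef k c (p : basis k.+1) c' (q : basis k) : K :=
  ('X_[c] * (EN_bdS M p : {ffun basis k -> S}) q)@_c'.

Lemma basis_card k (p : basis k) : #|val p.2| = k.+2.
Proof. exact/eqP/(valP p.2). Qed.

Lemma basis_leq k (p : basis k) : (p.1 <= k)%N.
Proof. by rewrite -ltnS ltn_ord. Qed.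

Lemma basis_eq k (p q : basis k) : p.1 = q.1 :> nat -> val p.2 = val q.2 -> p = q.
Proof.
by case: p q => [a J] [a' J'] /= e e'; congr (_, _); apply: val_inj.
Qed.

Lemma EN_bdS_val k (p : basis k.+1) (q : basis k) :
  (EN_bdS M p : {ffun basis k -> S}) q =
  \sum_(j in val p.2 | val p.2 :\ j == val q.2) (-1) ^+ below j (val p.2) *
    (if p.1 == q.1.+1 :> nat then M 0 j else if p.1 == q.1 :> nat then M 1 j else 0).
Proof.
have scE x (f : {ffun basis k -> S^o}) : (x *: f) q = x * f q :> S by rewrite ffunE.
have EN_eltE a J : (EN_elt S k a J : {ffun basis k -> S}) q
    = ((q.1 == a :> nat) && (val q.2 == J))%:R by rewrite ffunE.
rewrite /EN_bdS sum_ffunE big_mkcondr; apply: eq_bigr => j _.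
rewrite [LHS]scE [in RHS]eq_sym ffunE.
have -> b : (if b then M 1 j *: EN_elt S k p.1 (val p.2 :\ j) else 0 :
      {ffun basis k -> S^o}) q
    = if b then M 1 j * ((q.1 == p.1 :> nat) && (val q.2 == val p.2 :\ j))%:R else 0.
  by case: b; rewrite ?[LHS]scE ?EN_eltE // ffunE.
have -> : (if p.1 : nat is a.+1 then M 0 j *: EN_elt S k a (val p.2 :\ j) else 0 :
      {ffun basis k -> S^o}) q
    = if p.1 : nat is a.+1
      then M 0 j * ((q.1 == a :> nat) && (val q.2 == val p.2 :\ j))%:R else 0.
  by case: (p.1 : nat) => [|a]; rewrite ?[LHS]scE ?EN_eltE // ffunE.
have [e|ne] := eqVneq (val q.2) (val p.2 :\ j); last first.
  by case: (p.1 : nat) => [|a]; rewrite !andbF /= ?if_same !mulr0 ?if_same addr0 mulr0.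
congr (_ * _); have := basis_leq q; rewrite !andbT.
case: (p.1 : nat) => [|a] qk.
  by rewrite leq0n add0r /= eq_sym; case: eqP => _; rewrite ?mulr1 ?mulr0.
rewrite ?andbT eqSS (eq_sym a) (eq_sym a.+1).
case: (altP (q.1 =P a :> nat)) => [->|_].
  by rewrite ltn_eqF //; case: ifP; rewrite mulr1 ?mulr0 addr0.
rewrite mulr0 add0r; case: eqP => [e'|_]; last by case: ifP; rewrite ?mulr0.
by rewrite -e' qk mulr1.
Qed.

Lemma EN_bdS_face k (p : basis k.+1) (q : basis k) j :
  j \in val p.2 -> val q.2 = val p.2 :\ j ->
  (EN_bdS M p : {ffun basis k -> S}) q = (-1) ^+ below j (val p.2) *
    (if p.1 == q.1.+1 :> nat then M 0 j else if p.1 == q.1 :> nat then M 1 j else 0).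
Proof.
move=> jJ e; rewrite EN_bdS_val (big_pred1 j) // => i /=.
apply/andP/eqP => [[iJ /eqP]|->]; last by rewrite jJ e.
by rewrite e; apply: setD1_inj.
Qed.

Lemma mcoeff_signX e m m' c : ('X_[m] * ((-1) ^+ e * 'X_[m'] : S))@_c
  = (-1) ^+ e * (c == (m + m')%MM)%:R.
Proof.
rewrite mulrCA -mpolyXD -mpolyC1 -mpolyCN -rmorphXn /= mul_mpolyC mcoeffZ mcoeffX.
by rewrite eq_sym.
Qed.

(** A face keeps the multidegree when the deleted column is taken from the row its position assigns
    to it ([lab_top], [lab_bot]); otherwise an exchange lowers the weight ([lab_top_low],
    [lab_bot_low]). *)
Lemma bd_coef_hit k c (p : basis k.+1) c' (q : basis k) : bd_coef c p c' q != 0 ->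
  exists2 j, j \in val p.2 /\ val q.2 = val p.2 :\ j &
    (w (tot c' q) < w (tot c p))%N \/
    tot c' q = tot c p /\
     ([/\ p.1 = q.1.+1 :> nat, c' = (c + tm j)%MM & (below j (val p.2) <= p.1)%N]
      \/ [/\ p.1 = q.1 :> nat, c' = (c + bm j)%MM & (p.1 < below j (val p.2))%N]).
Proof.
rewrite /bd_coef; case: (pickP (fun j => (j \in val p.2) && (val p.2 :\ j == val q.2))).
  move=> j /andP[jJ /eqP e]; rewrite (EN_bdS_face jJ (esym e)) => nz.
  exists j; first by rewrite e.
  move: nz; case: (p.1 =P q.1.+1 :> nat) => [pq|_].
    rewrite M0 mcoeff_signX; case: (c' =P _) => [-> _|_]; last by rewrite mulr0 eqxx.
    rewrite /tot -e pq -addmA.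
    case: (leqP (below j (val p.2)) q.1.+1) => h; [right|left].
      by rewrite (lab_top jJ h); split=> //; left.
    by rewrite !(wD c) ltn_add2l; apply: lab_top_low.
  case: (p.1 =P q.1 :> nat) => [pq|_]; last by rewrite !mulr0 mcoeff0 eqxx.
  rewrite M1 mcoeff_signX; case: (c' =P _) => [-> _|_]; last by rewrite mulr0 eqxx.
  rewrite /tot -e pq -addmA.
  case: (ltnP q.1 (below j (val p.2))) => h; [right|left].
    by rewrite (lab_bot jJ h); split=> //; right.
  rewrite !(wD c) ltn_add2l; apply: lab_bot_low => //.
  by rewrite basis_card !ltnS (leq_trans (basis_leq q)).
move=> none; rewrite EN_bdS_val big_pred0 ?mulr0 ?mcoeff0 ?eqxx //.
Qed.

Lemma bd_coef_top k c (p : basis k.+1) (q : basis k) j :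
  j \in val p.2 -> val q.2 = val p.2 :\ j -> p.1 = q.1.+1 :> nat ->
  bd_coef c p (c + tm j)%MM q != 0.
Proof.
move=> jJ e pq; rewrite /bd_coef (EN_bdS_face jJ e) pq eqxx M0 mcoeff_signX eqxx.
by rewrite mulr1 signr_eq0.
Qed.

Lemma bd_coef_bot k c (p : basis k.+1) (q : basis k) j :
  j \in val p.2 -> val q.2 = val p.2 :\ j -> p.1 = q.1 :> nat ->
  bd_coef c p (c + bm j)%MM q != 0.
Proof.
move=> jJ e pq; rewrite /bd_coef (EN_bdS_face jJ e) pq eqxx M1.
by rewrite ltn_eqF // mcoeff_signX eqxx mulr1 signr_eq0.
Qed.

Lemma basis_last k c (p : basis k) : exists2 b, is_last (tot c p) b &
  (forall j, j \in val p.2 -> (j <= b)%N) /\ (b \in val p.2 -> below b (val p.2) = k.+1).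
Proof. exact: cell_last (basis_card p) (basis_leq p). Qed.

Lemma basis_first k c (p : basis k) : exists2 a, is_first (tot c p) a &
  (forall j, j \in val p.2 -> (a <= j)%N) /\ (a \in val p.2 -> below a (val p.2) = 0%N).
Proof. exact: cell_first (basis_card p). Qed.

(** The face chosen deletes the last column from the bottom row or, when the exponent [p.1] is
    maximal, the first column from the top row. A target cell of equal multidegree with the same
    face must contain that column too, hence arises by inserting it again. *)
Lemma target_triangular k c (p : basis k.+1) : target c p ->
  exists b : 'X_{1..N} * basis k, bd_coef c p b.1 b.2 != 0 /\
    forall c' p', target c' p' -> bd_coef c' p' b.1 b.2 != 0 ->
      (c', p') = (c, p) \/ (nu c p < nu c' p')%N.
Proof.
have [b hb [Jb rb]] := basis_last c p; have [a ha [Ja ra]] := basis_first c p.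
rewrite /target (has_lastE _ hb) (has_firstE _ ha) => /andP[bJ].
have cD1 j : j \in val p.2 -> #|val p.2 :\ j| == k.+2.
  by move=> jJ; have := basis_card p; rewrite (cardsD1 j) jJ add1n => -[->].
have [pk _|pk /= aJ] := ltnP p.1 k.+1.
  pose q : basis k := (Ordinal pk, exist _ (val p.2 :\ b) (cD1 b bJ)).
  exists ((c + bm b)%MM, q) => /=; split; first exact: bd_coef_bot.
  have tq : tot (c + bm b)%MM q = tot c p.
    by rewrite /tot /= -addmA (@lab_bot _ (val p.2) b) // rb // !ltnS -ltnS.
  move=> c' p' tp' /bd_coef_hit [j [jJ' /= qj] [lt|[tt sides]]].
    by right; rewrite tq in lt; apply: ltn_3MD lt _; case: ifP.
  left; have bJ' : b \in val p'.2.
    by move: tp'; rewrite /target -tt tq (has_lastE _ hb) => /andP[].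
  have jb : j = b.
    apply/eqP; move/setP/(_ b): qj; rewrite !inE eqxx bJ' andbT /= => /esym/negbFE.
    by rewrite eq_sym.
  have [b' hb' [_ rb']] := basis_last c' p'.
  have bb' : b' = b by apply: is_last_inj hb' _; rewrite -tt tq.
  rewrite bb' in rb'; subst j.
  case: sides => [[_ _]|[pq ce _]].
    by rewrite rb' // => /leq_trans/(_ (basis_leq p')); rewrite ltnn.
  congr (_, _); last first.
    apply: basis_eq => //.
    by have := setD1K bJ; have := setD1K bJ'; rewrite -qj => -> ->.
  by apply/eqP; rewrite -(eqm_add2r (bm b)) ce.
have pk' : p.1 = k.+1 :> nat by apply/eqP; rewrite eqn_leq pk basis_leq.
pose q : basis k := (ord_max, exist _ (val p.2 :\ a) (cD1 a aJ)).
exists ((c + tm a)%MM, q) => /=; split; first exact: bd_coef_top.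
have tq : tot (c + tm a)%MM q = tot c p.
  by rewrite /tot /= -addmA pk' (@lab_top _ (val p.2) a) // ra.
move=> c' p' tp' /bd_coef_hit [j [jJ' /= qj] [lt|[tt sides]]].
  by right; rewrite tq in lt; apply: ltn_3MD lt _; case: ifP.
have [p'k|p'k] := ltnP p'.1 k.+1.
  (* A target cell with nonmaximal exponent may lack the first column; the tie-breaker 2 against 1
     places it above the present cell. *)
  by right; rewrite /nu -tt tq p'k [(p.1 < _)%N]ltnNge pk ltn_add2l.
left; have aJ' : a \in val p'.2.
  by move: tp'; rewrite /target -tt tq (has_firstE _ ha) ltnNge p'k => /andP[].
have ja : j = a.
  apply/eqP; move/setP/(_ a): qj; rewrite !inE eqxx aJ' andbT /= => /esym/negbFE.
  by rewrite eq_sym.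
subst j; case: sides => [[pq ce _]|[pq _ _]]; last first.
  by move: p'k; rewrite pq ltnn.
congr (_, _); last first.
  apply: basis_eq; first by rewrite pk'.
  by have := setD1K aJ; have := setD1K aJ'; rewrite -qj => -> ->.
by apply/eqP; rewrite -(eqm_add2r (tm a)) ce.
Qed.

(** The pivot inserts the last column if it is missing, and otherwise the first one. Its other faces
    of the same multidegree retain the inserted column, which lowers the tie-breaker in [mu]. *)
Lemma nontarget_pivot k c (p : basis k) : ~~ target c p ->
  exists c0 (p0 : basis k.+1), bd_coef c0 p0 c p != 0 /\
    forall c' p', bd_coef c0 p0 c' p' != 0 ->
      (c', p') = (c, p) \/ (mu c' p' < mu c p)%N.
Proof.
have [b hb [Jb rb]] := basis_last c p; have [a ha [Ja ra]] := basis_first c p.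
rewrite /target (has_lastE _ hb) (has_firstE _ ha).
have [bJ|bJ _] := boolP (b \in val p.2); last first.
  have [eJ bc lJ rJ] := cell_add_last (basis_card p) (basis_leq p) hb bJ.
  have cJ : #|b |: val p.2| == k.+3 by rewrite cardsU1 bJ basis_card.
  have pk : (p.1 < k.+2)%N by rewrite ltnW // ltnS ltnS basis_leq.
  pose p0 : basis k.+1 := (Ordinal pk, exist _ (b |: val p.2) cJ).
  have ce : (c - bm b + bm b)%MM = c by rewrite submK.
  exists (c - bm b)%MM, p0; split.
    by rewrite -{2}ce; apply: bd_coef_bot => //=; rewrite ?setU11.
  have t0 : tot (c - bm b)%MM p0 = tot c p.
    by rewrite /tot /= lJ addmA ce.
  move=> c' p' /bd_coef_hit [j /= [jJ qj] [lt|[tt sides]]].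
    by right; rewrite t0 in lt; apply: ltn_3MD lt _; do ![case: ifP => _].
  move: tt; rewrite t0 => tt.
  have [jb|jb] := eqVneq j b; last first.
    have {}qj : val p'.2 = (b |: val p.2) :\ j := qj.
    right; rewrite /mu tt !(has_lastE _ hb) bJ qj !inE eqxx eq_sym jb /=.
    by rewrite ltn_add2l; case: ifP.
  left; subst j; case: sides => [[_ _]|[pq -> _]].
    by rewrite rJ leqNgt => /negP[].
  by rewrite ce; congr (_, _); apply: basis_eq; rewrite ?[val p'.2]qj ?eJ.
rewrite andTb negb_or -leqNgt => /andP[kp aJ].
have [eJ ac lJ rJ] := cell_add_first (basis_card p) ha aJ.
have cJ : #|a |: val p.2| == k.+3 by rewrite cardsU1 aJ basis_card.
have pk : p.1 = k :> nat by apply/eqP; rewrite eqn_leq kp basis_leq.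
pose p0 : basis k.+1 := (ord_max, exist _ (a |: val p.2) cJ).
have ce : (c - tm a + tm a)%MM = c by rewrite submK.
exists (c - tm a)%MM, p0; split.
  by rewrite -{2}ce; apply: bd_coef_top => //=; rewrite ?setU11 ?pk.
have t0 : tot (c - tm a)%MM p0 = tot c p.
  have lJ' : lab k.+2 (a |: val p.2) = (tm a + lab p.1.+1 (val p.2))%MM.
    by rewrite -lJ pk.
  by rewrite /tot [lab _ _]lJ' addmA ce.
move=> c' p' /bd_coef_hit [j /= [jJ qj] [lt|[tt sides]]].
  by right; rewrite t0 in lt; apply: ltn_3MD lt _; do ![case: ifP => _].
move: tt; rewrite t0 => tt.
have top : k.+1 = p'.1.+1 /\ c' = (c - tm a + tm j)%MM /\ (below j (a |: val p.2) <= k.+1)%N.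
  case: sides => [[h h' h'']|[h _ _]]; first by split.
  by have := basis_leq p'; rewrite -h ltnn.
case: top => -[pq] [ec rj]; rewrite ec in tt *.
have [jb|ja] := eqVneq j a.
  by left; subst j; rewrite ce; congr (_, _); apply: basis_eq; rewrite ?[val p'.2]qj ?eJ ?pk.
(* Deletion from the top row reaches only positions up to k+1, whereas the insertion of a has moved
   b to position k+2; so the face still contains b. *)
right; have jb : j != b.
  apply: contraTneq rj => ->; have := below_setD1 (a |: val p.2) b a.
  rewrite setU11 eJ rb //= => ->.
  have -> : (a < b)%N by rewrite ltn_neqAle Ja // andbT; apply: contraNneq aJ => /val_inj ->.
  by rewrite addn1 ltnn.
have {}qj : val p'.2 = (a |: val p.2) :\ j := qj.
rewrite /mu tt !(has_lastE _ hb) !(has_firstE _ ha) bJ (negbTE aJ) qj !inE.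
by rewrite (eq_sym a) (eq_sym b) ja jb eqxx bJ orbT ltn_add2l.
Qed.

Definition bd0_coef c (p : basis 0) c' : K := ('X_[c] * (EN_bd0 M p : S))@_c'.

Lemma basis0_pair (p : basis 0) : exists x y : 'I_n,
  [/\ (x < y)%N, val p.2 = [set x; y] & lab p.1.+1 (val p.2) = (tm x + bm y)%MM].
Proof.
have cJ := basis_card p; set J := val p.2 in cJ *.
have [x xJ x0] : exists2 x, x \in J & below x J = 0%N by apply: below_surj; rewrite cJ.
have [y yJ y1] : exists2 y, y \in J & below y J = 1%N by apply: below_surj; rewrite cJ.
have xy : (x < y)%N.
  have le : (x <= y)%N by apply: (below_leq xJ yJ); rewrite x0.
  by rewrite ltn_neqAle le andbT; apply: contra_eqN x0 => /eqP/val_inj->; rewrite y1.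
have ne : x != y by rewrite -val_eqE ltn_eqF.
have eJ : J = [set x; y].
  apply/eqP; rewrite eq_sym eqEcard cJ cards2 ne andbT.
  by apply/subsetP=> i; rewrite !inE => /orP[] /eqP->.
exists x, y; split=> //.
have -> : (p.1 : nat) = 0%N by case: (p.1) => -[].
rewrite (@lab_top _ J x) ?x0 // (@lab_bot _ (J :\ x) y) ?inE 1?eq_sym ?ne //.
have -> : J :\ x :\ y = set0 by apply/setP=> i; rewrite eJ !inE; do 2!case: eqP.
by rewrite /lab big_set0 addm0.
Qed.

Lemma bd0_coefE c (p : basis 0) (x y : 'I_n) c' : (x < y)%N -> val p.2 = [set x; y] ->
  bd0_coef c p c' = (c' == c + (tm x + bm y))%MM%:R - (c' == c + (bm x + tm y))%MM%:R.
Proof.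
move=> xy eJ; rewrite /bd0_coef (EN_bd0E M xy eJ) minor2E !M0 !M1 mulrBr -!mpolyXD.
by rewrite mcoeffB !mcoeffX (addmC (tm y)) !(eq_sym _ c').
Qed.

(** Here a target cell contains both the first and the last column, so its two-element set is
    determined by the multidegree, which is the leading term of the minor times c. *)
Lemma target_triangular0 c (p : basis 0) : target c p ->
  exists b, bd0_coef c p b != 0 /\
    forall c' p', target c' p' -> bd0_coef c' p' b != 0 ->
      (c', p') = (c, p) \/ (nu c p < nu c' p')%N.
Proof.
move=> tp; exists (tot c p).
have hit c' p' b : bd0_coef c' p' b != 0 -> b = tot c' p' \/ (w b < w (tot c' p'))%N.
  have [x [y [xy eJ eL]]] := basis0_pair p'; rewrite (bd0_coefE _ _ xy eJ) /tot eL.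
  case: (b =P (c' + (tm x + bm y))%MM) => [->|_]; first by left.
  case: (b =P (c' + (bm x + tm y))%MM) => [->|_]; last by rewrite subrr eqxx.
  by right; rewrite !(wD c') ltn_add2l w_lead.
split.
  have [x [y [xy eJ eL]]] := basis0_pair p; rewrite (bd0_coefE _ _ xy eJ) /tot eL eqxx.
  case: (_ =P (c + (bm x + tm y))%MM) => [e|_]; last by rewrite subr0 oner_eq0.
  by have := w_lead xy; have := congr1 w e; rewrite !(wD c) => /addnI ->; rewrite ltnn.
move=> c' p' tp' /hit [tt|lt]; last by right; apply: ltn_3MD lt _.
left.
have [b hb [_ rb]] := basis_last c p; have [a ha [_ ra]] := basis_first c p.
have [b' hb' [_ rb']] := basis_last c' p'; have [a' ha' [_ ra']] := basis_first c' p'.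
move: tp tp'; rewrite /target !ltn0 /= (has_lastE _ hb) (has_firstE _ ha).
rewrite -tt in hb' ha' *; rewrite (has_lastE _ hb) (has_firstE _ ha).
rewrite (is_last_inj hb' hb) (is_first_inj ha' ha) in rb' ra'.
move=> /andP[bJ aJ] /andP[bJ' aJ'].
have ne : a != b by apply: contra_eqN (ra aJ) => /eqP->; rewrite rb.
have eJ (J : {set 'I_n}) : #|J| = 2 -> a \in J -> b \in J -> J = [set a; b].
  move=> cJ aj bj; apply/eqP; rewrite eq_sym eqEcard cJ cards2 ne andbT.
  by apply/subsetP=> i; rewrite !inE => /orP[] /eqP->.
have e : p' = p.
  apply: basis_eq; first by case: (p.1) (p'.1) => -[] // ? [[]].
  by rewrite (eJ _ (basis_card p) aJ bJ) (eJ _ (basis_card p') aJ' bJ').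
by congr (_, _) => //; apply/eqP; move/eqP: tt; rewrite /tot e eqm_add2r eq_sym.
Qed.

Lemma sum_cells k (z : {ffun basis k -> S}) (F : basis k -> S) c :
  \sum_p \sum_(c' <- msupp (z p)) (z p)@_c' * ('X_[c'] * F p)@_c
  = (\sum_p z p * F p)@_c.
Proof.
rewrite raddf_sum /=; apply: eq_bigr => p _.
rewrite [in RHS](mpolyE (z p)) mulr_suml raddf_sum /=; apply: eq_bigr => c' _.
by rewrite -scalerAl mcoeffZ.
Qed.

Theorem monomial_EN_exact k (z : EN S n k.+1) :
  EN_bd M k z = 0 -> exists u, z = EN_bd M k.+1 u.
Proof.
move=> zk.
have [|c p /negP nT|u hu] := @cells_reduce K N _ _ (EN_bd M k.+1)
    (fun c p => target c p) (@mu k) z.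
- exact: EN_bd_linear.
- have [c0 [p0 [nz low]]] := nontarget_pivot nT.
  have e c' p' : ((EN_bd M k.+1 ('X_[c0] *: EN_elt S k.+1 p0.1 (val p0.2))
     : {ffun basis k -> S}) p')@_c' = bd_coef c0 p0 c' p'.
    by rewrite EN_bdZ EN_bd_basis ffunE.
  exists ('X_[c0] *: EN_elt S k.+1 p0.1 (val p0.2)); rewrite e; split=> // c' p'.
  by rewrite e; apply: low.
exists u; apply/eqP; rewrite -subr_eq0; apply/eqP.
set y := z - _ in hu *.
have : EN_bd M k y = 0.
  by rewrite /y -scaleN1r EN_bdD EN_bdZ EN_complex zk scaler0 addr0.
clearbody y; clear z zk u; case: k y hu => [|k] y hu y0.
  apply: (@cells_injective K N _ _ bd0_coef (fun c p => target c p) (@nu 0)) => //.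
    exact: target_triangular0.
  by move=> b; rewrite sum_cells; move/(congr1 (mcoeff b)): y0; rewrite mcoeff0.
apply: (@cells_injective K N _ _ (fun c p b => bd_coef c p b.1 b.2)
   (fun c p => target c p) (@nu k.+1)) => //.
  exact: target_triangular.
move=> [c q]; rewrite sum_cells /=.
have /ffunP/(_ q) := y0; rewrite /EN_bd sum_ffunE ffunE => e.
rewrite -[RHS](mcoeff0 _ c) -[in RHS]e; congr (_@__).
rewrite (eq_bigr (fun p : basis k.+1 =>
  ((y p : S) *: (EN_bdS M p : {ffun basis k -> S^o})) q)) // => p _.
by rewrite ffunE.
Qed.

End MonomialEagonNorthcott.

(** * A quadratic initial ideal of the curve *)

Section IdealGen.
Variable A : comNzRingType.
Implicit Types (G : A -> Prop) (a b c : A).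

Lemma ideal_gen_mem G a : G a -> ideal_gen G a.
Proof.
move=> Ga; exists [:: (1, a)]; last by rewrite big_seq1 mul1r.
by move=> u; rewrite inE => /eqP->.
Qed.

Lemma ideal_gen_ideal G : is_ideal (ideal_gen G).
Proof.
split; first by exists [::]; rewrite ?big_nil.
  move=> a b [s hs ->] [s' hs' ->]; exists (s ++ s'); last by rewrite big_cat.
  by move=> u; rewrite mem_cat => /orP[/hs|/hs'].
move=> c a [s hs ->]; exists [seq (c * u.1, u.2) | u <- s].
  by move=> u /mapP[v /hs h ->].
by rewrite big_map mulr_sumr; apply: eq_bigr => u _; rewrite mulrA.
Qed.

Lemma ideal_sum (J : A -> Prop) (I : eqType) (r : seq I) (P : pred I) (F : I -> A) :
  is_ideal J -> (forall i, i \in r -> P i -> J (F i)) -> J (\sum_(i <- r | P i) F i).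
Proof.
case=> J0 JD _ JF; rewrite big_seq_cond; elim/big_rec: _ => // i x /andP[ir Pi].
by apply: JD; apply: JF.
Qed.

Lemma ideal_gen_sub G (J : A -> Prop) a :
  is_ideal J -> (forall g, G g -> J g) -> ideal_gen G a -> J a.
Proof.
move=> idJ GJ [s hs ->]; apply: ideal_sum => // u /hs Gu _.
by case: idJ => _ _; apply; apply: GJ.
Qed.

Lemma idealN (J : A -> Prop) a : is_ideal J -> J a -> J (- a).
Proof. by case=> _ _ JM Ja; rewrite -mulN1r; apply: JM. Qed.

Lemma idealB (J : A -> Prop) a b : is_ideal J -> J a -> J b -> J (a - b).
Proof. by move=> idJ Ja Jb; case: (idJ) => _ JD _; apply: JD => //; apply: idealN. Qed.

End IdealGen.

Section LinearForms.
Variable N : nat.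
Implicit Types (c : nat -> nat) (m : 'X_{1..N}).

Definition lin c m := (\sum_(i < N) m i * c i)%N.

Lemma linD c : {morph lin c : x y / (x + y)%MM >-> (x + y)%N}.
Proof.
move=> x y; rewrite /lin -big_split; apply: eq_bigr => i _.
by rewrite mnmDE mulnDl.
Qed.

Lemma lin_mul c (i : 'I_N) k : lin c (U_(i) *+ k)%MM = (k * c i)%N.
Proof.
rewrite /lin (bigD1 i) //= big1 => [|j ji]; rewrite mulmnE mnm1E.
  by rewrite eqxx mul1n addn0.
by rewrite eq_sym (negbTE ji).
Qed.

Lemma lin1 c (i : 'I_N) : lin c U_(i)%MM = c i.
Proof. by rewrite -[U_(i)%MM]mulm1n lin_mul mul1n. Qed.

End LinearForms.

Section WeightedCurve.
Variables d e : nat.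
Hypotheses (d_gt0 : (0 < d)%N) (e_gt0 : (0 < e)%N).
Local Notation N := (d + e)%N.
Implicit Types (m : 'X_{1..N}) (j : 'I_(N - 1)) (a b : 'I_N).

Lemma lo_subproof j : (j < N)%N.
Proof. exact: leq_trans (ltn_ord j) (leq_subr _ _). Qed.

Lemma hi_subproof j : (j.+1 < N)%N.
Proof. by have := ltn_ord j; rewrite ltn_subRL add1n. Qed.

Definition lo j : 'I_N := Ordinal (lo_subproof j).
Definition hi j : 'I_N := Ordinal (hi_subproof j).

(** Number the variables z_0, ..., z_(d+e-1), the x's first. Column j of the matrix is then z_j to
    the power [top_exp j] over z_(j+1), without the three cases of [wrc_matrix]. *)
Definition top_exp (j : nat) := if j == (d - 1)%N then e else 1%N.
Definition topm j : 'X_{1..N} := (U_(lo j) *+ top_exp j)%MM.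
Definition botm j : 'X_{1..N} := U_(hi j)%MM.

Definition sdeg (i : nat) := if (i < d)%N then (d - i)%N else (e - 1 - (i - d))%N.
Definition tdeg (i : nat) := if (i < d)%N then i else (e * d - (e - 1) + (i - d))%N.
Definition wdeg (i : nat) := if (i < d)%N then 1%N else e.

Lemma sdeg_tdeg i : (i < N)%N -> (sdeg i + tdeg i = wdeg i * d)%N.
Proof. by move=> iN; rewrite /sdeg /wdeg /tdeg; case: ltnP; nia. Qed.

Lemma sdeg_top j : (top_exp j * sdeg j = sdeg j.+1 + 1)%N.
Proof.
have := ltn_ord j; move: (j : nat) => i iN; rewrite /top_exp /sdeg.
case: eqP => [->|ne]; last by case: ltnP => ?; case: ltnP => ?; lia.
have -> : (d - 1 < d)%N by lia.
by rewrite subKn // muln1 subn1 prednK // ltnn subnn; lia.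
Qed.

Lemma tdeg_top j : (top_exp j * tdeg j + 1 = tdeg j.+1)%N.
Proof.
have := ltn_ord j; move: (j : nat) => i iN; rewrite /top_exp /tdeg.
have ed : (e <= e * d)%N by rewrite leq_pmulr.
case: eqP => [->|ne]; last by case: ltnP => ?; case: ltnP => ?; lia.
have -> : (d - 1 < d)%N by lia.
have -> : (d - 1).+1 = d by lia.
by rewrite ltnn subnn mulnBr muln1; lia.
Qed.

Definition bideg m : 'X_{1..2} := (U_(0%R) *+ lin sdeg m + U_(1%R) *+ lin tdeg m)%MM.

Lemma bideg0 m : bideg m 0 = lin sdeg m.
Proof. by rewrite mnmDE !mulmnE !mnm1E /= mul1n addn0. Qed.

Lemma bideg1 m : bideg m 1 = lin tdeg m.
Proof. by rewrite mnmDE !mulmnE !mnm1E /= mul1n. Qed.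

Lemma bidegP m m' : lin sdeg m = lin sdeg m' -> lin tdeg m = lin tdeg m' ->
  bideg m = bideg m'.
Proof. by rewrite /bideg => -> ->. Qed.

Lemma bidegE m m' : bideg m = bideg m' ->
  lin sdeg m = lin sdeg m' /\ lin tdeg m = lin tdeg m'.
Proof. by move=> E; rewrite -!bideg0 -!bideg1 E. Qed.

Lemma lin_sdeg_tdeg m : (lin sdeg m + lin tdeg m = lin wdeg m * d)%N.
Proof.
rewrite /lin -big_split big_distrl; apply: eq_bigr => i _ /=.
by rewrite -mulnDr sdeg_tdeg // mulnA.
Qed.

Lemma bideg_minor i j :
  bideg (topm i + botm j)%MM = bideg (botm i + topm j)%MM.
Proof.
apply: bidegP; rewrite !linD !lin_mul !lin1 /=.
  by rewrite !sdeg_top addnAC addnA.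
by rewrite -!tdeg_top -addnA [(1 + _)%N]addnC addnC -addnA.
Qed.

Variable k : fieldType.
Local Notation S := {mpoly k[N]}.
Local Notation M := (wrc_matrix k d e).

Lemma wrc_xE (i : nat) (z : 'I_N) : (i < d)%N -> z = i :> nat ->
  wrc_x k d e i = 'X_z.
Proof.
move=> id zi; rewrite /wrc_x insubT /=; congr 'X__.
by apply: val_inj; rewrite /= zi.
Qed.

Lemma wrc_yE (i : nat) (z : 'I_N) : (i < e)%N -> z = (d + i)%N :> nat ->
  wrc_y k d e i = 'X_z.
Proof.
move=> id zi; rewrite /wrc_y insubT /=; congr 'X__.
by apply: val_inj; rewrite /= zi.
Qed.

Lemma wrc_matrix0 j : M 0 j = 'X_[topm j].
Proof.
have jn := ltn_ord j; rewrite mxE eqxx -mpolyXn /top_exp.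
case: ltnP => jd; first by rewrite ltn_eqF // expr1; apply: wrc_xE => //; lia.
case: eqP => e1; first by congr (_ ^+ _); apply: wrc_xE => //=; lia.
by rewrite expr1; apply: wrc_yE => /=; lia.
Qed.

Lemma wrc_matrix1 j : M 1 j = 'X_[botm j].
Proof.
have jn := ltn_ord j; rewrite mxE /=.
case: ltnP => jd; first by apply: wrc_xE => //; lia.
case: eqP => e1; first by apply: wrc_yE => //=; lia.
by apply: wrc_yE => /=; lia.
Qed.

Lemma wrc_minor i j : minor2 M i j = 'X_[topm i + botm j] - 'X_[botm i + topm j].
Proof.
by rewrite minor2E !wrc_matrix0 !wrc_matrix1 -!mpolyXD [(topm j + _)%MM]addmC.
Qed.

Lemma wrc_imageE (i : 'I_N) :
  wrc_image k i = 'X_[(U_(0%R) *+ sdeg i + U_(1%R) *+ tdeg i)%MM].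
Proof.
rewrite mpolyXD -!mpolyXn /wrc_image /sdeg /tdeg.
by case: splitP => l -> //; rewrite addKn.
Qed.

Lemma wrc_mapX m : wrc_map ('X_[m] : S) = 'X_[bideg m].
Proof.
rewrite /wrc_map comp_mpolyX.
under eq_bigr => i _ do rewrite tnth_mktuple wrc_imageE.
rewrite mprodXnE; congr 'X_[_]; apply/mnmP=> l.
rewrite mnm_sumE /bideg mnmDE !mulmnE /lin !big_distrr -big_split.
apply: eq_bigr => i _ /=; rewrite mulmnE mnmDE !mulmnE mulnDl.
by rewrite -!mulnA ![(_ * m i)%N]mulnC.
Qed.

Lemma wrc_mapE (p : S) : wrc_map p = \sum_(m <- msupp p) p@_m *: 'X_[bideg m].
Proof.
rewrite {1}(mpolyE p) /wrc_map raddf_sum /=; apply: eq_bigr => m _.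
by rewrite comp_mpolyZ -[_ \mPo _]/(wrc_map _) wrc_mapX.
Qed.

Lemma mcoeff_wrc_map (p : S) c :
  (wrc_map p)@_c = \sum_(m <- msupp p | bideg m == c) p@_m.
Proof.
rewrite wrc_mapE raddf_sum /= [RHS]big_mkcond; apply: eq_bigr => m _.
by rewrite mcoeffZ mcoeffX; case: ifP => _; rewrite ?mulr1 ?mulr0.
Qed.

Lemma minor_in_wrc_ideal i j : minor2 M i j \in wrc_ideal k d e.
Proof.
rewrite inE wrc_minor /wrc_map raddfB /=.
by rewrite -![_ \mPo _]/(wrc_map _) !wrc_mapX bideg_minor subrr.
Qed.

Lemma wrc_ideal_is_ideal : is_ideal (fun p => p \in wrc_ideal k d e).
Proof.
have E (p : S) : (p \in wrc_ideal k d e) = (wrc_map p == 0) by [].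
split=> [|a b|c a]; rewrite !E /wrc_map ?comp_mpoly0 //.
  by move=> /eqP ha /eqP hb; rewrite comp_mpolyD ha hb addr0.
by move=> /eqP ha; rewrite rmorphM /= ha mulr0.
Qed.

(* Twice the weight of z_i. Being concave in i on the x's and on the y's, it  *)
(* makes the term of each minor that is a product of two variables lead, even *)
(* against a term containing x_(d-1)^e.                                       *)
Definition vwt (i : nat) :=
  if (i < d)%N then (d * (d - 1) - i * i.+1)%N
  else ((i - d).+1 * (2 * e - (i - d)))%N.
Definition vdeg := @lin N vwt.

(** The quadratic leading terms of the minors: products of two x's other than x_0 and x_(d-1), of an
    x other than x_(d-1) with a y, and of two y's other than y_(e-1). *)
Definition quad (a b : nat) :=
  [|| (1 <= a <= b)%N && (b.+1 < d)%N, (a.+1 < d)%N && (d <= b < N)%N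
    | (d <= a <= b)%N && (b.+1 < N)%N].

Definition std m := [forall a : 'I_N, forall b : 'I_N,
  quad a b ==> ~~ (U_(a) + U_(b) <= m)%MM].

Lemma vwt_x (i : nat) : (i.+1 < d)%N -> (vwt i.+1 + 2 * i.+1 = vwt i)%N.
Proof.
move=> id; rewrite /vwt id ltnW //.
have : (i.+2 * i.+1 <= d * (d - 1))%N by apply: leq_mul; lia.
by move: (d * (d - 1))%N => D; lia.
Qed.

Lemma vwt_mid : vwt (d - 1) = 0%N /\ vwt d = (2 * e)%N.
Proof.
rewrite /vwt ltnn subnn subn0 mul1n; case: ltnP => [|h]; last by lia.
have -> : (d - 1).+1 = d by lia.
by rewrite mulnC subnn.
Qed.

Lemma vwt_y (i : nat) : (d <= i)%N -> (i.+1 < N)%N ->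
  (vwt i.+1 = vwt i + 2 * (e - (i - d) - 1))%N.
Proof.
move=> di iN; rewrite /vwt !ltnNge di (leqW di) /= subSn //.
have : (i - d < e)%N by lia.
move: (i - d)%N => r re; have -> : e = (r + (e - r - 1).+1)%N by lia.
by move: (e - r - 1)%N => q; nia.
Qed.

(** Inside a block, concavity prefers z_a z_b to z_(a-1) z_(b+1). Across the blocks, the weight
    decreases along the x's and increases along the y's, so it prefers z_a z_b to the pair moved one
    step towards the middle. *)
Lemma quad_reduce a b : quad a b -> exists i j,
  [/\ (U_(a) + U_(b))%MM = (topm i + botm j)%MM &
      (vdeg (botm i + topm j)%MM < vdeg (topm i + botm j)%MM)%N].
Proof.
have [v0 vd] := vwt_mid; have aN := ltn_ord a; have bN := ltn_ord b.
have main (i j : 'I_(N - 1)) : (i : nat) != (d - 1)%N ->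
    (U_(lo i) + U_(hi j))%MM = (U_(a) + U_(b))%MM :> 'X_{1..N} ->
    (vwt i.+1 + vwt j < vwt i + vwt j.+1)%N ->
    exists i j, [/\ (U_(a) + U_(b))%MM = (topm i + botm j)%MM &
      (vdeg (botm i + topm j)%MM < vdeg (topm i + botm j)%MM)%N].
  move=> ne e1 lt; exists i, j; rewrite /topm /botm -e1 /vdeg !linD !lin1 !lin_mul.
  (* The exponent e occurs only on z_(d-1), whose weight is 0. *)
  have vj : (top_exp j * vwt j = vwt j)%N.
    by rewrite /top_exp; case: eqP => [->|_]; rewrite ?mul1n // v0 muln0.
  by rewrite vj /top_exp (negbTE ne) mul1n mulm1n.
case/or3P => /andP[].
- move=> /andP[a1 ab] bd.
  have iP : (b < N - 1)%N by lia.
  have jP : (a - 1 < N - 1)%N by lia.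
  apply: (main (Ordinal iP) (Ordinal jP)) => /=; first by apply/eqP; lia.
    by rewrite addmC; congr (U_(_) + U_(_))%MM; apply: val_inj => //=; lia.
  have := @vwt_x b bd; have /= := @vwt_x (a - 1); lia.
- move=> ad /andP[db _].
  have iP : (a < N - 1)%N by lia.
  have jP : (b - 1 < N - 1)%N by lia.
  apply: (main (Ordinal iP) (Ordinal jP)) => /=; first by apply/eqP; lia.
    by congr (U_(_) + U_(_))%MM; apply: val_inj => //=; lia.
  have := @vwt_x a ad; have -> : (b - 1).+1 = b by lia.
  move: db; rewrite leq_eqVlt => /orP[/eqP<-|db]; first by rewrite vd v0; lia.
  have := @vwt_y (b - 1); have -> : (b - 1).+1 = b by lia.
  by move=> /(_ _ bN) ->; lia.
- move=> /andP[da ab] bN'.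
  have iP : (b < N - 1)%N by lia.
  have jP : (a - 1 < N - 1)%N by lia.
  apply: (main (Ordinal iP) (Ordinal jP)) => /=; first by apply/eqP; lia.
    by rewrite addmC; congr (U_(_) + U_(_))%MM; apply: val_inj => //=; lia.
  have := @vwt_y b (leq_trans da ab) bN'; have -> : (a - 1).+1 = a by lia.
  move: (da); rewrite leq_eqVlt => /orP[/eqP ad|ad]; first by rewrite -ad vd v0; lia.
  have := @vwt_y (a - 1); have -> : (a - 1).+1 = a by lia.
  by move=> /(_ _ aN) ->; lia.
Qed.

Definition minor_ideal : S -> Prop :=
  ideal_gen (fun g => exists i j, g = minor2 M i j).

Lemma nonstd_reduce m : ~~ std m -> exists m',
  [/\ bideg m' = bideg m, (vdeg m' < vdeg m)%N & minor_ideal ('X_[m] - 'X_[m'])].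
Proof.
rewrite negb_forall => /existsP[a]; rewrite negb_forall => /existsP[b].
rewrite negb_imply negbK => /andP[/quad_reduce [i [j [-> lt]]] le].
exists (m - (topm i + botm j) + (botm i + topm j))%MM.
have em := submK le; set c := (m - _)%MM in em *.
split.
- apply: bidegP; rewrite -em !linD.
    by have [e1 _] := bidegE (bideg_minor i j); rewrite -linD -e1 linD.
  by have [_ e1] := bidegE (bideg_minor i j); rewrite -linD -e1 linD.
- by rewrite -em /vdeg !(linD _ c) ltn_add2l.
rewrite -{1}em mpolyXD [X in _ - X]mpolyXD -mulrBr -wrc_minor.
by case: (ideal_gen_ideal (fun g => exists i j, g = minor2 M i j)) => _ _; apply;
   apply: ideal_gen_mem; exists i, j.
Qed.

Lemma exists_std m : exists m',
  [/\ std m', bideg m' = bideg m, (vdeg m' <= vdeg m)%N & minor_ideal ('X_[m] - 'X_[m'])].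
Proof.
move em: (vdeg m) => v; elim/ltn_ind: v m em => v IH m em.
have idJ := ideal_gen_ideal (fun g => exists i j, g = minor2 M i j).
have [sm|/nonstd_reduce[m' [bm' lt Jm']]] := boolP (std m).
  by exists m; split; rewrite ?em // subrr; case: idJ.
rewrite em in lt; have [m0 [sm0 b0 v0 J0]] := IH _ lt m' erefl.
exists m0; split; rewrite ?b0 //; first exact: leq_trans v0 (ltnW lt).
by rewrite -['X_[m]](subrK 'X_[m']) -addrA; case: (idJ) => _ JD _; apply: JD.
Qed.

(** * Standard monomials and their bidegrees *)

Lemma N_gt0 : (0 < N)%N. Proof. by rewrite addn_gt0 d_gt0. Qed.

Definition zn (i : nat) : 'I_N := insubd (Ordinal N_gt0) i.

Lemma znE (i : nat) : (i < N)%N -> zn i = i :> nat.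
Proof. by move=> iN; rewrite val_insubd iN. Qed.

Lemma zn_val (a : 'I_N) (i : nat) : a = i :> nat -> zn i = a.
Proof. by move=> ai; apply: val_inj; rewrite /= znE -?ai. Qed.

(* The standard monomials: the middle variable occurs when r is positive.     *)
Definition nf_x (u r v : nat) : 'X_{1..N} :=
  (U_(zn 0) *+ u + U_(zn (d - 1 - r)) *+ (0 < r) + U_(zn (d - 1)) *+ v)%MM.
Definition nf_y (u r v : nat) : 'X_{1..N} :=
  (U_(zn (N - 1)) *+ u + U_(zn (d - 1 + r)) *+ (0 < r) + U_(zn (d - 1)) *+ v)%MM.

(** Serves both shapes of standard monomials: the ends are x_0 and x_(d-1) with the remaining x's
    inside, or x_(d-1) and y_(e-1) with the remaining y's inside. *)
Lemma two_ended (m : 'X_{1..N}) (p q : 'I_N) (inner : pred 'I_N) :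
  p != q -> ~~ inner p -> ~~ inner q ->
  (forall i, m i != 0%N -> [|| i == p, i == q | inner i]) ->
  (forall a b : 'I_N, (a <= b)%N -> inner a -> inner b -> ~~ (U_(a) + U_(b) <= m)%MM) ->
  m = (U_(q) *+ m q + U_(p) *+ m p)%MM \/
  exists2 a, inner a & m = (U_(q) *+ m q + U_(a) + U_(p) *+ m p)%MM.
Proof.
move=> pq ip iq supp sq.
have two a b : a != b -> inner a -> inner b -> m a != 0%N -> m b = 0%N.
  move=> ne ia ib ma; apply/eqP; apply: contraT => mb.
  have le : (U_(a) + U_(b) <= m)%MM.
    apply/mnm_lepP=> i; rewrite mnmDE !mnm1E.
    case: (altP (a =P i)) => [<-|_]; first by rewrite eq_sym (negbTE ne) addn0 lt0n.
    by case: eqP => [<-|] //; rewrite lt0n.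
  have [ab|/ltnW ba] := leqP a b; first by have := sq a b ab ia ib; rewrite le.
  by have := sq b a ba ib ia; rewrite addmC le.
have one a : inner a -> (m a <= 1)%N.
  move=> ia; rewrite leqNgt; apply/negP=> ma; have /negP[] := sq a a (leqnn a) ia ia.
  apply/mnm_lepP=> i; rewrite mnmDE !mnm1E.
  by case: (a =P i) => [<-|].
case: (pickP [pred a | inner a && (m a != 0%N)]) => [a /andP[ia ma]|none].
  right; exists a => //; apply/mnmP=> i; rewrite !mnmDE !mulmnE !mnm1E.
  have ap : a != p by apply: contraNneq ip => <-.
  have aq : a != q by apply: contraNneq iq => <-.
  have [<-|qi] := eqVneq q i; first by rewrite (negbTE aq) (negbTE pq) mul1n !addn0.
  have [<-|pi] := eqVneq p i; first by rewrite (negbTE ap) mul1n.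
  have [<-|ai] := eqVneq a i; first by apply/eqP; rewrite eqn_leq one //= lt0n.
  apply/eqP; apply: contraT => mi.
  have := supp i mi; rewrite eq_sym (negbTE pi) eq_sym (negbTE qi) /= => ii.
  by rewrite (two a i) // in mi.
left; apply/mnmP=> i; rewrite !mnmDE !mulmnE !mnm1E.
have [<-|qi] := eqVneq q i; first by rewrite (negbTE pq) mul1n addn0.
have [<-|pi] := eqVneq p i; first by rewrite mul1n.
apply/eqP; apply: contraT => mi; have := none i; rewrite /= mi andbT => ni.
by have := supp i mi; rewrite eq_sym (negbTE pi) eq_sym (negbTE qi) ni.
Qed.

Lemma stdP m (a b : 'I_N) : std m -> quad a b -> ~~ (U_(a) + U_(b) <= m)%MM.
Proof. by move=> /forallP/(_ a)/forallP/(_ b)/implyP. Qed.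

Lemma std_shape m : std m ->
  (exists u r v, [/\ (1 < d)%N, (r < d - 1)%N & m = nf_x u r v]) \/
  (exists u r v, (r < e)%N /\ m = nf_y u r v).
Proof.
move=> sm; set p := zn (d - 1).
have pE : p = (d - 1)%N :> nat by rewrite znE //; lia.
have ne_val (a b : 'I_N) : (a != b) = ((a : nat) != b) by [].
case: (pickP [pred b : 'I_N | (d <= b)%N && (m b != 0%N)]) => [b /andP[db mb]|none].
  right; set q := zn (N - 1).
  have qE : q = (N - 1)%N :> nat by rewrite znE //; lia.
  have [||||a b' ab' /andP[da aN] /andP[db' bN']|e1|[a /andP[da aN] e1]] := @two_ended m p q
      [pred a : 'I_N | (d <= a)%N && (a.+1 < N)%N].
  - by rewrite ne_val pE qE; lia.
  - by rewrite /= pE; lia.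
  - by rewrite /= qE; lia.
  - move=> i mi; rewrite -!val_eqE /= pE qE.
    have : ~~ (i.+1 < d)%N.
      apply/negP=> id; have qd : quad i b by rewrite /quad id db ltn_ord /= orbT.
      have /negP[] := stdP sm qd.
      apply/mnm_lepP=> l; rewrite mnmDE !mnm1E.
      have ib : i != b by rewrite ne_val; lia.
      case: (altP (i =P l)) => [<-|_]; first by rewrite eq_sym (negbTE ib) addn0 lt0n.
      by case: eqP => [<-|] //; rewrite lt0n.
    by have := ltn_ord i; lia.
  - by apply: stdP => //; rewrite /quad da ab' bN' !orbT.
  - exists (m q), 0%N, (m p); split; first by [].
    by rewrite {1}e1 /nf_y mulm0n addm0.
  exists (m q), (a - d).+1, (m p); split; first by lia.
  rewrite {1}e1 /nf_y mulm1n; congr (_ + U_(_) + _)%MM.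
  by apply/esym/zn_val; lia.
(* For d = 1 the corners x_0 and x_(d-1) coincide, and the monomial is a power of x_0, counted among
   the [nf_y]. *)
have [d1|d1] := leqP d 1.
  right; exists 0%N, 0%N, (m p); split=> //; rewrite /nf_y !mulm0n !add0m.
  apply/mnmP=> i; rewrite mulmnE mnm1E; have [->|pi] := eqVneq p i; first by rewrite mul1n.
  have := none i; rewrite /= => /negbT; rewrite negb_and => /orP[|/negPn/eqP//].
  by move: pi; rewrite ne_val pE; lia.
left; set q := zn 0.
have qE : q = 0%N :> nat by rewrite znE //; lia.
have [||||a b' ab' /andP[da aN] /andP[db' bN']|e1|[a /andP[da aN] e1]] := @two_ended m p q
    [pred a : 'I_N | (1 <= a)%N && (a.+1 < d)%N].
- by rewrite ne_val pE qE; lia.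
- by rewrite /= pE; lia.
- by rewrite /= qE.
- move=> i mi; rewrite -!val_eqE /= pE qE.
  by have := none i; rewrite /= mi; lia.
- by apply: stdP => //; rewrite /quad da ab' bN'.
- exists (m q), 0%N, (m p); split; [by []|lia|].
  by rewrite {1}e1 /nf_x mulm0n addm0.
exists (m q), (d - 1 - a)%N, (m p); split; [by []|lia|].
have r0 : (0 < d - 1 - a)%N by lia.
rewrite {1}e1 /nf_x r0 mulm1n; congr (_ + U_(_) + _)%MM.
by apply/esym/zn_val; lia.
Qed.

Lemma lin_nf_x c u r v : (r < d)%N ->
  lin c (nf_x u r v) = (u * c 0 + (0 < r) * c (d - 1 - r) + v * c (d - 1))%N.
Proof.
by move=> rd; rewrite /nf_x !linD !lin_mul !znE //; lia.
Qed.

Lemma lin_nf_y c u r v : (r <= e)%N ->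
  lin c (nf_y u r v) = (u * c (N - 1) + (0 < r) * c (d - 1 + r) + v * c (d - 1))%N.
Proof.
by move=> rd; rewrite /nf_y !linD !lin_mul !znE //; lia.
Qed.

(** The s-degree exceeds the weighted degree by (d-1)u + r, so for r < d-1 Euclidean division
    recovers u and r. For [nf_y] it falls short by eu + r, so the sign of the difference separates
    the two shapes. *)
Lemma nf_x_deg u r v : (r < d)%N ->
  lin wdeg (nf_x u r v) = (u + (0 < r) + v)%N /\
  lin sdeg (nf_x u r v) = (lin wdeg (nf_x u r v) + (d - 1) * u + r)%N.
Proof.
move=> rd; rewrite !lin_nf_x // /wdeg /sdeg d_gt0.
have -> : (d - 1 < d)%N by lia.
have -> : (d - 1 - r < d)%N by lia.
by case: r rd => [|r] rd; split; nia.
Qed.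

Lemma nf_y_deg u r v : (r < e)%N ->
  lin wdeg (nf_y u r v) = (v + e * (u + (0 < r)))%N /\
  lin wdeg (nf_y u r v) = (lin sdeg (nf_y u r v) + e * u + r)%N.
Proof.
move=> re; have rl := ltnW re; rewrite !lin_nf_y // /wdeg /sdeg.
have -> : (d - 1 < d)%N by lia.
have -> : (N - 1 < d)%N = false by lia.
have -> : (e - 1 - (N - 1 - d) = 0)%N by lia.
have -> : (d - (d - 1) = 1)%N by lia.
case: r re {rl} => [|r] re; rewrite ?addn0 /=; first by split; nia.
have -> : (d - 1 + r.+1 < d)%N = false by lia.
have -> : (d - 1 + r.+1 - d = r)%N by lia.
by split; nia.
Qed.

Lemma divmod_uniq (q u r u' r' : nat) : (r < q)%N -> (r' < q)%N ->
  (q * u + r = q * u' + r')%N -> u = u' /\ r = r'.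
Proof.
move=> rq rq' E; have q0 : (0 < q)%N by apply: leq_ltn_trans rq.
have uu : u = u'.
  have := congr1 (divn^~ q) E; rewrite /= ![(q * _)%N]mulnC !divnMDl //.
  by rewrite !divn_small // !addn0.
by move: E; rewrite uu => /addnI.
Qed.

Lemma sandwich_zero (A W P Q r s : nat) : (A = W + P + r)%N -> (W = A + Q + s)%N ->
  [/\ P = 0, r = 0, Q = 0 & s = 0]%N.
Proof. by move=> E E'; split; lia. Qed.

(** The bidegree determines the weighted degree and the s-degree. Two monomials of the same shape
    agree by uniqueness of Euclidean division; for different shapes the difference of degrees must
    be zero, and both are the same power of x_(d-1). *)
Lemma std_uniq m m' : std m -> std m' -> bideg m = bideg m' -> m = m'.
Proof.
move=> sm sm' /bidegE[es et].
have ew : lin wdeg m = lin wdeg m'.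
  by apply/eqP; rewrite -(eqn_pmul2r d_gt0) -!lin_sdeg_tdeg es et.
case: (std_shape sm) (std_shape sm') => [[u [r [v [d1 rd e1]]]]|[u [r [v [re e1]]]]]
  [[u' [r' [v' [_ rd' e2]]]]|[u' [r' [v' [re' e2]]]]].
- have rl : (r < d)%N by lia.
  have rl' : (r' < d)%N by lia.
  have [w1 s1] := nf_x_deg u v rl; have [w2 s2] := nf_x_deg u' v' rl'.
  move: s1 s2; rewrite -e1 -e2 es -ew => -> /eqP; rewrite -!addnA eqn_add2l => /eqP.
  case/(divmod_uniq rd rd') => uu rr; move: w1 w2; rewrite -e1 -e2 -ew uu rr => ->.
  by move=> /addnI vv; rewrite e1 e2 uu rr vv.
- have rl : (r < d)%N by lia.
  have [w1 s1] := nf_x_deg u v rl; have [w2 s2] := nf_y_deg u' v' re'.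
  rewrite -e1 in w1 s1; rewrite -e2 in w2 s2.
  rewrite -es -ew in s2; have [du r0 eu r0'] := sandwich_zero s1 s2.
  have u0 : u = 0%N by move/eqP: du; rewrite muln_eq0 => /orP[|/eqP//]; lia.
  have u0' : u' = 0%N by move/eqP: eu; rewrite muln_eq0 => /orP[|/eqP//]; lia.
  have vv : v = v' by move: w1 w2; rewrite u0 r0 u0' r0' ew ltnn !add0n muln0 => ->; lia.
  by rewrite e1 e2 u0 r0 u0' r0' vv /nf_x /nf_y !mulm0n.
- have rl' : (r' < d)%N by lia.
  have [w1 s1] := nf_y_deg u v re; have [w2 s2] := nf_x_deg u' v' rl'.
  rewrite -e1 in w1 s1; rewrite -e2 in w2 s2.
  have d1 : (1 < d)%N by lia.
  rewrite -es -ew in s2; have [du r0' eu r0] := sandwich_zero s2 s1.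
  have u0 : u' = 0%N by move/eqP: du; rewrite muln_eq0 => /orP[|/eqP//]; lia.
  have u0' : u = 0%N by move/eqP: eu; rewrite muln_eq0 => /orP[|/eqP//]; lia.
  have vv : v = v' by move: w1 w2; rewrite u0 r0 u0' r0' ew ltnn !add0n muln0 => ->; lia.
  by rewrite e1 e2 u0 r0 u0' r0' vv /nf_x /nf_y !mulm0n.
have [w1 s1] := nf_y_deg u v re; have [w2 s2] := nf_y_deg u' v' re'.
rewrite -e1 in w1 s1; rewrite -e2 in w2 s2.
move: s1; rewrite ew s2 es -!addnA => /addnI/esym/(divmod_uniq re re')[uu rr].
move: w1; rewrite ew w2 uu rr => /addIn vv; by rewrite e1 e2 uu rr vv.
Qed.

(** Inverts [nf_x_deg]: u and r are the quotient and remainder of A - W by d-1, and a power of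
    x_(d-1) fills up the weighted degree. *)
Lemma exists_x_monomial (W A : nat) : (W <= A)%N -> (A <= W * d)%N ->
  exists m, lin wdeg m = W /\ lin sdeg m = A.
Proof.
move=> WA AW; have [d1|d1] := leqP d 1.
  have dE : d = 1%N by lia.
  exists (U_(zn 0) *+ W)%MM; rewrite !lin_mul znE ?N_gt0 // /wdeg /sdeg d_gt0 muln1.
  by split=> //; rewrite dE; move: AW; rewrite dE; lia.
have q0 : (0 < d - 1)%N by lia.
set u := ((A - W) %/ (d - 1))%N; set r := ((A - W) %% (d - 1))%N.
have rq : (r < d - 1)%N by rewrite ltn_mod.
have E : (A - W = (d - 1) * u + r)%N by rewrite mulnC -divn_eq.
have le : (u + (0 < r) <= W)%N.
  have : ((d - 1) * u + r <= (d - 1) * W)%N.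
    by rewrite -E mulnBl mul1n leq_sub2r // mulnC.
  rewrite -[(d - 1)%N]prednK // in rq *; case: (r) => [|r'].
    by rewrite !addn0 leq_pmul2l.
  move=> h; rewrite addn1 -(ltn_pmul2l (ltn0Sn (d - 1).-1)).
  by apply: leq_trans h; rewrite addnS ltnS leq_addr.
have rd : (r < d)%N by lia.
exists (nf_x u r (W - (u + (0 < r)))%N).
have [-> ->] := nf_x_deg u (W - (u + (0 < r)))%N rd; rewrite subnKC //.
by split=> //; rewrite -addnA -E subnKC.
Qed.

(** A standard monomial divisible by y_(e-1), whose image is t^(ed), loses one such factor.
    Otherwise its s-degree is at least its weighted degree minus e, and a monomial in the x's has
    the required bidegree. *)
Lemma tdeg_shift m B : lin tdeg m = (B + e * d)%N ->
  exists m', lin sdeg m' = lin sdeg m /\ lin tdeg m' = B.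
Proof.
have [m0 [sm0 bm0 _ _]] := exists_std m; have [<- <-] := bidegE bm0.
move=> {bm0 m} tB; have ST := lin_sdeg_tdeg m0; rewrite tB in ST.
have We : (e <= lin wdeg m0)%N by rewrite -(leq_pmul2r d_gt0) -ST addnA leq_addl.
have sub (W A : nat) : (A + B = W * d)%N -> (W <= A)%N ->
    exists m', lin sdeg m' = A /\ lin tdeg m' = B.
  move=> AB WA; have [|m' [w' s']] := exists_x_monomial WA; first by rewrite -AB leq_addr.
  exists m'; split=> //; apply: (@addnI A); rewrite AB -w' -s'.
  exact: lin_sdeg_tdeg.
have ABW : (lin sdeg m0 + B = (lin wdeg m0 - e) * d)%N.
  by apply: (@addIn (e * d)); rewrite -addnA ST -mulnDl subnK.
case: (std_shape sm0) => [[u [r [v [d1 rd e1]]]]|[u [r [v [re e1]]]]].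
  have rl : (r < d)%N by lia.
  have [_ s1] := nf_x_deg u v rl; rewrite -e1 in s1.
  apply: sub ABW _; rewrite s1 -addnA; exact: leq_trans (leq_subr _ _) (leq_addr _ _).
case: u e1 => [|u] e1.
  have [_ w1] := nf_y_deg 0 v re; rewrite -e1 muln0 addn0 in w1.
  by apply: sub ABW _; rewrite leq_subLR w1 addnC leq_add2r ltnW.
exists (nf_y u r v).
have e2 : m0 = (U_(zn (N - 1)) + nf_y u r v)%MM by rewrite e1 /nf_y mulmS -!addmA.
move: tB; rewrite e2 !linD !lin1 znE; last by lia.
rewrite /sdeg /tdeg; have -> : (N - 1 < d)%N = false by lia.
have -> : (e - 1 - (N - 1 - d) = 0)%N by lia.
have -> : (e * d - (e - 1) + (N - 1 - d) = e * d)%N.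
  by have : (e <= e * d)%N; [rewrite leq_pmulr|move: (e * d)%N => ed; lia].
by rewrite addnC => /addIn ->.
Qed.

Lemma nf_exists m : exists m', std m' && (bideg m' == bideg m).
Proof. by have [m' [sm' bm' _ _]] := exists_std m; exists m'; rewrite sm' bm' eqxx. Qed.

Definition nf m := xchoose (nf_exists m).

Lemma nfP m : [/\ std (nf m), bideg (nf m) = bideg m, (vdeg (nf m) <= vdeg m)%N
  & minor_ideal ('X_[m] - 'X_[nf m])].
Proof.
have /andP[sn /eqP bn] := xchooseP (nf_exists m).
have [m' [sm' bm' vm' Jm']] := exists_std m.
by have -> : nf m = m' by apply: std_uniq; rewrite // bn bm'.
Qed.

Lemma minor_ideal_is_ideal : is_ideal minor_ideal.
Proof. exact: ideal_gen_ideal. Qed.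

(** Modulo the minors, p is congruent to its normal form q. Distinct standard monomials have
    distinct bidegrees, so each coefficient of q is a coefficient of the image of p and vanishes
    with it. *)
Lemma wrc_idealP (p : S) : p \in wrc_ideal k d e <-> minor_ideal p.
Proof.
split=> [|Jp]; last first.
  apply: ideal_gen_sub wrc_ideal_is_ideal _ Jp => _ [i [j ->]].
  exact: minor_in_wrc_ideal.
move=> /eqP p0.
pose q := \sum_(m <- msupp p) p@_m *: ('X_[nf m] : S).
suff q0 : q = 0.
  rewrite -[p]subr0 -q0 /q {1}(mpolyE p) -sumrB.
  apply: ideal_sum minor_ideal_is_ideal _ => m _ _; rewrite -scalerBr -mul_mpolyC.
  by case: minor_ideal_is_ideal => _ _; apply; case: (nfP m).
apply/mpolyP=> c; rewrite mcoeff0 /q raddf_sum /=.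
have [[m1 cE]|none] := classic (exists m, nf m = c); last first.
  rewrite big1 // => m _; rewrite mcoeffZ mcoeffX; case: eqP => [mc|]; last by rewrite mulr0.
  by case: none; exists m.
have [sm1 bm1 _ _] := nfP m1.
transitivity ((wrc_map p)@_(bideg c)); last by rewrite p0 mcoeff0.
rewrite mcoeff_wrc_map [RHS]big_mkcond; apply: eq_bigr => m _.
rewrite mcoeffZ mcoeffX; have [sm bm _ _] := nfP m; rewrite -bm.
case: (nf m =P c) => [->|ne]; first by rewrite eqxx mulr1.
case: eqP => [E|]; last by rewrite mulr0.
by case: ne; apply: std_uniq => //; rewrite -cE.
Qed.

Definition mon_le (m1 m2 : 'X_{1..N}) :=
  (vdeg m1 < vdeg m2)%N || (vdeg m1 == vdeg m2) && (m1 <= m2)%O.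

Lemma mon_le_order : monomial_order mon_le.
Proof.
split.
- move=> x y; rewrite /mon_le; case: (ltngtP (vdeg x) (vdeg y)) => //= _.
  exact: Order.TotalTheory.le_total.
- move=> x y; rewrite /mon_le; case: (ltngtP (vdeg x) (vdeg y)) => //= _.
  exact: Order.POrderTheory.le_anti.
- move=> y x z; rewrite /mon_le => /orP[xy|/andP[/eqP xy lxy]] /orP[yz|/andP[/eqP yz lyz]].
  + by rewrite (ltn_trans xy yz).
  + by rewrite -yz xy.
  + by rewrite xy yz.
  + by rewrite xy yz eqxx ltnn (Order.POrderTheory.le_trans lxy lyz).
- move=> m x y; rewrite /mon_le /vdeg !(linD _ m) ltn_add2l eqn_add2l => /orP[->//|/andP[-> xy]].
  by rewrite lemc_add2r xy orbT.
move=> m; rewrite /mon_le; have -> : vdeg 0%MM = 0%N.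
  by rewrite /vdeg /lin big1 // => i _; rewrite mnm0E.
by rewrite le0m andbT orbC -leq_eqVlt.
Qed.

Definition quad_lead (c : 'X_{1..N}) := exists a b : 'I_N, quad a b /\ c = (U_(a) + U_(b))%MM.

(** Suppose that f in the kernel had a standard leading monomial m. Any other monomial of f with the
    bidegree of m would be nonstandard and reduce to m with a strict drop of [vdeg], so it would
    exceed m. Hence the coefficient of m survives in the image of f, a contradiction. *)
Lemma wrc_initial_ideal (p : S) :
  initial_ideal mon_le (fun p => p \in wrc_ideal k d e) p <-> monomial_ideal quad_lead p.
Proof.
split.
  apply: ideal_gen_sub; first exact: ideal_gen_ideal.
  move=> _ [f [m [If [mf lead] ->]]].
  have [sm|] := boolP (std m); last first.
    rewrite negb_forall => /existsP[a]; rewrite negb_forall => /existsP[b].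
    rewrite negb_imply negbK => /andP[qab le]; rewrite -(submK le) mpolyXD.
    case: (ideal_gen_ideal (fun g : S => exists2 c, quad_lead c & g = 'X_[c])) => _ _; apply.
    by apply: ideal_gen_mem; exists (U_(a) + U_(b))%MM => //; exists a, b.
  have := If; rewrite inE => /eqP/(congr1 (mcoeff (bideg m))).
  rewrite mcoeff0 mcoeff_wrc_map -big_filter (bigD1_seq m) ?filter_uniq ?msupp_uniq //=; last first.
    by rewrite mem_filter eqxx.
  rewrite big_filter_cond big_seq_cond big1 ?addr0 => [f0|m']; last first.
    move=> /andP[m'f /andP[/eqP bm' ne]].
    have vm' : (vdeg m' <= vdeg m)%N.
      by have := lead m' m'f; rewrite /mon_le => /orP[/ltnW//|/andP[/eqP-> _]].
    have [sm'|/nonstd_reduce [m2 [b2 v2 _]]] := boolP (std m').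
      by rewrite (std_uniq sm' sm bm') eqxx in ne.
    have [sn bn vn _] := nfP m2.
    have e2 : nf m2 = m by apply: std_uniq; rewrite // bn b2.
    by rewrite e2 in vn; have := leq_ltn_trans vn v2; rewrite ltnNge vm'.
  by move: mf; rewrite mcoeff_msupp f0 eqxx.
apply: ideal_gen_sub; first exact: ideal_gen_ideal.
move=> _ [c [a [b [qab ->]]] ->]; apply: ideal_gen_mem.
have [i [j [-> lt]]] := quad_reduce qab.
have ne : (botm i + topm j == topm i + botm j)%MM = false.
  by apply: contraTF lt => /eqP->; rewrite ltnn.
exists (minor2 M i j), (topm i + botm j)%MM; split=> //; first exact: minor_in_wrc_ideal.
rewrite wrc_minor; split.
  by rewrite mcoeff_msupp mcoeffB !mcoeffX eqxx ne subr0 oner_eq0.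
move=> m'; rewrite mcoeff_msupp mcoeffB !mcoeffX.
have [<-|n1] := eqVneq (topm i + botm j)%MM m'.
  by rewrite /mon_le eqxx Order.POrderTheory.lexx orbT.
have [<- _|n2] := eqVneq (botm i + topm j)%MM m'; first by rewrite /mon_le lt.
by rewrite subrr eqxx.
Qed.

End WeightedCurve.

(** * The resolution *)

Section WeightedCurveResolution.
Variables (k : fieldType) (d e : nat).
Hypotheses (d_gt0 : (0 < d)%N) (e_gt0 : (0 < e)%N).
Local Notation N := (d + e)%N.
Local Notation S := {mpoly k[N]}.
Local Notation M := (wrc_matrix k d e).

(* Twice the convex weight of z_i; every minor has its diagonal term leading. *)
Definition dwt (i : nat) :=
  ((i - (d - 1)) * (i.+1 - (d - 1)) + (d - 1 - i) * (d - 1 - i - 1))%N.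

(** Convexity without subtraction: the increments 2(i+1) - 2(d-1) increase with i. *)
Lemma dwt_step i : (dwt i.+1 + 2 * (d - 1) = dwt i + 2 * i.+1)%N.
Proof.
rewrite /dwt; have [|] := leqP (d - 1) i => di.
  have -> : (d - 1 - i = 0)%N by lia.
  have -> : (d - 1 - i.+1 = 0)%N by lia.
  have [q ->] : exists q, i = (d - 1 + q)%N by exists (i - (d - 1))%N; lia.
  have -> : (d - 1 + q - (d - 1) = q)%N by lia.
  have -> : ((d - 1 + q).+1 - (d - 1) = q.+1)%N by lia.
  have -> : ((d - 1 + q).+2 - (d - 1) = q.+2)%N by lia.
  by move: (d - 1)%N => D; nia.
have [q E] : exists q, (d - 1 = i + q.+1)%N by exists (d - 1 - i.+1)%N; lia.
rewrite E; have -> : (i + q.+1 - i = q.+1)%N by lia.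
have -> : (i + q.+1 - i.+1 = q)%N by lia.
have -> : (i - (i + q.+1) = 0)%N by lia.
have -> : (i.+1 - (i + q.+1) = 0)%N by lia.
by rewrite !mul0n !add0n; case: q E => [|q] E; rewrite ?subSS ?subn0; nia.
Qed.

Lemma wrc_EN_exact l (z : EN S (N - 1) l.+1) :
  EN_bd M l z = 0 -> exists u, z = EN_bd M l.+1 u.
Proof.
apply: (@monomial_EN_exact k N (N - 1) (@topm d e) (@botm d e) (@lin N dwt) M).
- exact: wrc_matrix0.
- exact: wrc_matrix1.
- exact: linD.
- move=> i j ij; rewrite !linD !lin1 !lin_mul /=.
  (* [dwt] vanishes at d-1, the only index that carries the exponent e. *)
  have ex (a : 'I_(N - 1)) : (top_exp d e a * dwt a = dwt a)%N.
    rewrite /top_exp; case: eqP => [->|_]; last by rewrite mul1n.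
    by rewrite /dwt subnn mul0n muln0.
  by rewrite !ex; have := dwt_step i; have := dwt_step j; lia.
- move=> i j ij v; rewrite !mulmnE !mnm1E.
  have [<-|_] := eqVneq (lo i) v; last by left.
  by right; rewrite eq_sym -val_eqE /= (val_eqE i j) (negbTE ij).
- move=> i j ij v; rewrite !mnm1E.
  have [<-|_] := eqVneq (hi i) v; last by left.
  by right; rewrite eq_sym -val_eqE /= eqSS (val_eqE i j) (negbTE ij).
move=> i j ij v; rewrite !mulmnE !mnm1E.
have [<-|_] := eqVneq (lo i) v; last by left.
by right; rewrite eq_sym -val_eqE /= ltn_eqF // ltnW.
Qed.

Lemma EN_bd0_image (z : S) :
  (exists u : EN S (N - 1) 1, z = EN_bd M 0 u) <-> minor_ideal z.
Proof.
have idJ := @minor_ideal_is_ideal d e k; split=> [[u ->]|Jz].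
  apply: (ideal_sum idJ) => p _ _; case: (idJ) => _ _; apply; apply: ideal_gen_mem.
  have /cards2P[a [b [ab eJ]]] := valP p.2.
  have [lt|lt|/val_inj E] := ltngtP a b.
  - by exists a, b; apply: EN_bd0E lt eJ.
  - by exists b, a; apply: EN_bd0E lt _; rewrite [val _]eJ setUC.
  - by rewrite E eqxx in ab.
pose im z := exists u : EN S (N - 1) 1, z = EN_bd M 0 u.
have im_ideal : is_ideal im.
  split=> [|x y [u ->] [v ->]|c x [u ->]].
  - by exists 0; rewrite -[0 in RHS](scale0r 0) EN_bdZ scale0r.
  - by exists (u + v); rewrite EN_bdD.
  - by exists (c *: u); rewrite EN_bdZ.
apply: (ideal_gen_sub im_ideal _ Jz) => _ [i [j ->]].
have lt_im (a b : 'I_(N - 1)) : (a < b)%N -> im (minor2 M a b).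
  move=> ab; have cJ : #|[set a; b]| == 2%N.
    by rewrite cards2 (_ : a != b) // -val_eqE ltn_eqF.
  pose p : EN_basis (N - 1) 0 := (ord0, exist _ [set a; b] cJ).
  exists (EN_elt S 0 0 [set a; b]).
  by rewrite -(EN_bd0E M (p := p) ab) //; exact/esym/(EN_bd0_basis M p).
have [lt|lt|/val_inj->] := ltngtP i j; first exact: lt_im.
  have -> : minor2 M i j = - minor2 M j i by rewrite !minor2E opprB.
  exact: (idealN im_ideal (lt_im _ _ lt)).
by rewrite minor2E subrr; case: im_ideal.
Qed.

Lemma wrc_proj_eq (x y : S) :
  wrc_proj k d e x = wrc_proj k d e y <-> x - y \in wrc_ideal k d e.
Proof.
by rewrite Quotient.idealrBE; split=> /eqP.
Qed.

Lemma wrc_proj_surj (r : wrc_ring k d e) : exists x, wrc_proj k d e x = r.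
Proof. by exists (repr r); apply: reprK. Qed.

Lemma wrc_free_resolution :
  @free_resolution S (EN S (N - 1)) (EN_bd M) (wrc_ring k d e) (wrc_proj k d e).
Proof.
split.
- by move=> l; apply: EN_finite_free.
- split=> [l|a x y]; first exact: EN_bd_linear.
  by rewrite /wrc_proj rmorphD /= [a *: x]/(a * x) rmorphM.
- move=> l z; split=> [|[u ->]]; first exact: wrc_EN_exact.
  exact: EN_complex.
- move=> z; rewrite EN_bd0_image -wrc_idealP //.
  by have := wrc_proj_eq z 0; rewrite subr0 [wrc_proj k d e 0]rmorph0.
exact: wrc_proj_surj.
Qed.

End WeightedCurveResolution.

(** * Noetherianity and algebraic dependence *)

Section Noetherian.
Variables (K : fieldType) (N : nat).
Local Notation S := {mpoly K[N]}.

(** Dickson's lemma, by induction on the number of coordinates. A finite s covers L in the first n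
    coordinates, hence covers every element whose next coordinate is at least a bound B for s; each
    of the finitely many slices below B has its own finite cover. *)
Lemma dickson (T : eqType) (c : nat -> T -> nat) n (L : T -> Prop) :
  exists s : seq T, {in s, forall x, L x} /\
    forall x, L x -> exists2 y, y \in s & forall i, (i < n)%N -> (c i y <= c i x)%N.
Proof.
elim: n L => [|n IH] L.
  have [[x Lx]|none] := classic (exists x, L x).
    by exists [:: x]; split=> [y|y _]; [rewrite inE => /eqP->|exists x; rewrite ?inE].
  by exists [::]; split=> // x Lx; case: none; exists x.
have [s [sL scov]] := IH L.
have [B sB] : exists B, {in s, forall y, (c n y <= B)%N}.
  exists (\max_(y <- s) c n y)%N => y ys.
  exact: (leq_bigmax_seq (F := c n) y ys).
have [s' [s'L s'cov]] : exists s' : seq T, {in s', forall x, L x} /\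
    forall x, L x -> (c n x < B)%N ->
    exists2 y, y \in s' & forall i, (i < n.+1)%N -> (c i y <= c i x)%N.
  elim: B {sB} => [|b [s1 [s1L s1cov]]]; first by exists [::].
  have [s2 [s2L s2cov]] := IH (fun x => L x /\ c n x = b).
  exists (s1 ++ s2); split=> [x|x Lx].
    by rewrite mem_cat => /orP[/s1L|/s2L[]].
  rewrite ltnS leq_eqVlt => /orP[/eqP xb|/(s1cov x Lx)[y ys1 yx]]; last first.
    by exists y; rewrite ?mem_cat ?ys1.
  have [//|y ys2 yx] := s2cov x; exists y; first by rewrite mem_cat ys2 orbT.
  move=> i; rewrite ltnS leq_eqVlt => /orP[/eqP->|]; last exact: yx.
  by rewrite xb; have [_ ->] := s2L y ys2.
exists (s ++ s'); split=> [x|x Lx]; first by rewrite mem_cat => /orP[/sL|/s'L].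
have [xB|Bx] := ltnP (c n x) B.
  by have [y ys' yx] := s'cov x Lx xB; exists y; rewrite ?mem_cat ?ys' ?orbT.
have [y ys yx] := scov x Lx; exists y; first by rewrite mem_cat ys.
move=> i; rewrite ltnS leq_eqVlt => /orP[/eqP->|]; last exact: yx.
exact: leq_trans (sB y ys) Bx.
Qed.

(** Hilbert's basis theorem through leading monomials: s is a finite subset of I whose leading
    monomials cover those of I for divisibility, and division by s lowers the leading monomial. *)
Lemma mpoly_noetherian : noetherian S.
Proof.
move=> I idI; case: (idI) => I0 ID IM.
pose c (i : nat) (f : S) := if insub i is Some j then mlead f (j : 'I_N) else 0%N.
have [s [sL scov]] := @dickson S c N (fun f => I f /\ f != 0).
have idG := ideal_gen_ideal (fun g : S => g \in s).
exists s => a; split=> [|]; last by apply: ideal_gen_sub => // g /sL[].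
elim/(well_founded_ind (@ltom_wf N)): {a}(mlead a) {-2}a (erefl (mlead a)) => m IH a am Ia.
have [->|a0] := eqVneq a 0; first by case: idG.
have [//|g gs ga] := scov a; have [Ig g0] := sL g gs.
have le : (mlead g <= mlead a)%MM.
  by apply/mnm_lepP=> i; have := ga i (ltn_ord i); rewrite /c valK.
pose q := (mleadc a / mleadc g) *: 'X_[mlead a - mlead g] : S.
have gc : mleadc g != 0 by rewrite mleadc_eq0.
have q0 : q != 0.
  rewrite mscalerI negb_or mulf_neq0 ?invr_eq0 ?mleadc_eq0 //=.
  by rewrite -msize_poly_eq0 msizeX.
rewrite -[a](subrK (q * g)); case: (idG) => _ GD GM; apply: GD; last first.
  by apply: GM; apply: ideal_gen_mem.
have lqg : mlead (q * g) = mlead a.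
  by rewrite mleadM // /q mleadZ ?mleadXm ?submK // mulf_neq0 ?invr_eq0 // mleadc_eq0.
have cqg : (q * g)@_(mlead a) = mleadc a.
  have lq : mlead q = (mlead a - mlead g)%MM.
    by rewrite /q mleadZ ?mleadXm // mulf_neq0 ?invr_eq0 // mleadc_eq0.
  have := mleadcM q g; rewrite lq submK // => ->.
  by rewrite /q mcoeffZ mcoeffX eqxx mulr1 divfK.
have [->|r0] := eqVneq (a - q * g) 0; first by case: idG.
apply: (IH (mlead (a - q * g))) => //; last first.
  by apply: idealB => //; apply: IM.
rewrite -am Order.POrderTheory.lt_neqAle; apply/andP; split.
  apply: contra_neq (r0) => E; apply/eqP.
  by rewrite -mleadc_eq0 E mcoeffB cqg subrr.
by rewrite (Order.POrderTheory.le_trans (mleadB_le _ _)) // lqg Order.JoinTheory.joinxx.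
Qed.

End Noetherian.

(** * Evaluation of polynomials and algebraic dependence *)

Section PolynomialEvaluation.
Variables (A R : comNzRingType) (f : {rmorphism A -> R}) (a : R).

Definition polyev : {poly A} -> R := horner_morph (fun x => mulrC a (f x)).

HB.instance Definition _ :=
  GRing.RMorphism.copy polyev (horner_morph (fun x => mulrC a (f x))).

Lemma polyevC c : polyev c%:P = f c. Proof. exact: horner_morphC. Qed.

Lemma polyevX : polyev 'X = a. Proof. exact: horner_morphX. Qed.

Lemma polyevMXaddC p c : polyev (p * 'X + c%:P) = polyev p * a + f c.
Proof. by rewrite rmorphD rmorphM /= polyevX polyevC. Qed.

Lemma polyevE (p : {poly A}) n : (size p <= n)%N -> polyev p = \sum_(i < n) f p`_i * a ^+ i.
Proof.
move=> pn; rewrite /polyev /horner_morph (@horner_coef_wide _ n).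
  by apply: eq_bigr => i _; rewrite coef_map.
exact: leq_trans (size_poly _ _) pn.
Qed.

Lemma polyev_lowest (p : {poly A}) : p != 0 ->
  exists m c x, c != 0 /\ polyev p = a ^+ m * (f c + a * x).
Proof.
elim/poly_ind: p => [|p c IH]; first by rewrite eqxx.
have [->|c0] := eqVneq c 0.
  rewrite addr0 => pX; have p0 : p != 0 by apply: contraNneq pX => ->; rewrite mul0r.
  have [m [c' [x [c'0 E]]]] := IH p0; exists m.+1, c', x; split=> //.
  by rewrite rmorphM /= polyevX E exprSr -!mulrA; congr (_ * _); rewrite mulrC.
by exists 0%N, c, (polyev p); rewrite polyevMXaddC expr0 mul1r addrC mulrC.
Qed.

End PolynomialEvaluation.

Lemma rmorph_polyev (A R R' : comNzRingType) (f : {rmorphism A -> R})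
    (g : {rmorphism R -> R'}) (f' : {rmorphism A -> R'}) a (p : {poly A}) :
  (forall x, g (f x) = f' x) -> g (polyev f a p) = polyev f' (g a) p.
Proof.
move=> gf; elim/poly_ind: p => [|p c IH]; first by rewrite !rmorph0.
by rewrite !polyevMXaddC rmorphD rmorphM /= IH gf.
Qed.

Lemma linear_relation (K : fieldType) (I J : finType) (A : I -> J -> K) :
  (#|J| < #|I|)%N ->
  exists v : I -> K, (exists i, v i != 0) /\ forall j, \sum_i v i * A i j = 0.
Proof.
move=> JI; pose M := \matrix_(i < #|I|, j < #|J|) A (enum_val i) (enum_val j).
have : kermx M != 0.
  rewrite -mxrank_eq0 mxrank_ker subn_eq0 -ltnNge.
  exact: leq_ltn_trans (rank_leq_col M) JI.
case/rowV0Pn => u /sub_kermxP uM u0.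
exists (fun i => u 0 (enum_rank i)); split.
  have /rV0Pn[i ui] := u0; exists (enum_val i); by rewrite enum_valK.
move=> j; have /matrixP/(_ 0 (enum_rank j)) := uM.
rewrite !mxE => E; rewrite -[RHS]E (reindex (@enum_rank I)) /=; last first.
  exact/onW_bij/enum_rank_bij.
by apply: eq_bigr => i _; rewrite mxE !enum_rankK.
Qed.

Section AlgebraicDependence.
Variable K : fieldType.
Local Notation B := {mpoly K[2]}.

Lemma msizeM_leq (a b : B) : (msize (a * b) <= msize a + msize b)%N.
Proof.
have [->|a0] := eqVneq a 0; first by rewrite mul0r msize0.
have [->|b0] := eqVneq b 0; first by rewrite mulr0 msize0.
by rewrite msizeM // leq_pred.
Qed.

Lemma msizeXn_le (a : B) i : (msize (a ^+ i) <= (i * msize a).+1)%N.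
Proof.
elim: i => [|i IH]; first by rewrite expr0 msize1.
rewrite exprS; apply: leq_trans (msizeM_leq _ _) _.
by rewrite mulSn -addnS leq_add2l.
Qed.

(* The n^3 products with exponents below n live in a space of dimension       *)
(* O(n^2).                                                                    *)
Lemma alg_dependent (a1 a2 a3 : B) : exists F : {poly {poly {poly K}}}, F != 0 /\
  polyev (polyev (polyev (@mpolyC 2 K) a3) a2) a1 F = 0.
Proof.
pose D := (msize a1 + msize a2 + msize a3)%N.
(* The products have degree below m, hence involve at most m^2 monomials, and m^2 = n^2 n' < n^3. *)
pose n' := (9 * D.+1 ^ 2)%N; pose n := n'.+1; pose m := (3 * n * D.+1)%N.
pose mon (c : 'I_m * 'I_m) : 'X_{1..2} := (U_(0%R) *+ c.1 + U_(1%R) *+ c.2)%MM.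
pose prd (t : 'I_n * 'I_n * 'I_n) : B := a3 ^+ t.2 * a2 ^+ t.1.2 * a1 ^+ t.1.1.
have card : (#|{: 'I_m * 'I_m}| < #|{: 'I_n * 'I_n * 'I_n}|)%N.
  rewrite !card_prod !card_ord /m /n.
  have -> : (3 * n'.+1 * D.+1 * (3 * n'.+1 * D.+1) = n'.+1 * n'.+1 * n')%N.
    by rewrite /n' -mulnn; ring.
  by rewrite ltn_pmul2l.
have [v [[t0 vt0] vrel]] := linear_relation (fun t c => (prd t)@_(mon c)) card.
have small t : (msize (prd t) <= m)%N.
  case: t => [[i j] l]; rewrite /prd /=.
  apply: leq_trans (msizeM_leq _ _) _; apply: leq_trans (leq_add (msizeM_leq _ _) (leqnn _)) _.
  have h (q : 'I_n) (a : B) : (msize a <= D)%N -> (msize (a ^+ q) <= n * D.+1)%N.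
    move=> aD; apply: leq_trans (msizeXn_le _ _) _.
    have := ltn_ord q; move: (q : nat) (msize a) aD => x y yD; rewrite mulnS.
    move=> xn; apply: leq_ltn_trans (_ : x * y <= x * D)%N _; first by rewrite leq_mul2l yD orbT.
    apply: (@leq_ltn_trans (n * D)); first by rewrite leq_mul2r ltnW ?orbT.
    by rewrite -[X in (X < _)%N]add0n ltn_add2r.
  have -> : m = (n * D.+1 + n * D.+1 + n * D.+1)%N by rewrite /m; ring.
  by rewrite !leq_add // h // /D; lia.
have rel : \sum_t v t *: prd t = 0.
  apply/mpolyP=> c; rewrite mcoeff0 raddf_sum /=.
  have [cm|mc] := ltnP (mdeg c) m; last first.
    rewrite big1 // => t _; rewrite mcoeffZ memN_msupp_eq0 ?mulr0 //.
    by apply: msize_mdeg_ge; apply: leq_trans (small t) mc.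
  have c2 : mdeg c = (c 0%R + c 1%R)%N.
    by rewrite mdegE !big_ord_recl big_ord0 addn0; congr (c _ + c _)%N; apply: val_inj.
  have c0m : (c 0%R < m)%N by apply: leq_ltn_trans cm; rewrite c2 leq_addr.
  have c1m : (c 1%R < m)%N by apply: leq_ltn_trans cm; rewrite c2 leq_addl.
  have := vrel (Ordinal c0m, Ordinal c1m).
  have -> : mon (Ordinal c0m, Ordinal c1m) = c.
    apply/mnmP=> i; rewrite /mon mnmDE !mulmnE !mnm1E /=.
    by case: i => -[|[|]] // iP; rewrite ?mul1n ?mul0n ?addn0 ?add0n; congr (c _); apply: val_inj.
  by move=> E; rewrite -[RHS]E; apply: eq_bigr => t _; rewrite mcoeffZ.
pose w (i j l : nat) := v (inord i, inord j, inord l).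
exists (\poly_(i < n) \poly_(j < n) \poly_(l < n) w i j l); split.
  apply: contraNneq vt0 => /(congr1 (fun F : {poly {poly {poly K}}} => F`_t0.1.1`_t0.1.2`_t0.2)).
  rewrite !coef0; do 3![rewrite coef_poly ltn_ord]; rewrite /w !inord_val;
     case: t0 => [[? ?] ?] /= ->.
  by rewrite eqxx.
rewrite (polyevE _ _ (size_poly _ _)) -[RHS]rel.
rewrite (eq_bigr (fun i : 'I_n => \sum_(j < n) \sum_(l < n) v (i, j, l) *: prd (i, j, l))).
  by rewrite pair_big pair_big; apply: eq_bigr => -[[i j] l] _.
move=> i _; rewrite coef_poly ltn_ord /= (polyevE _ _ (size_poly _ _)) mulr_suml.
apply: eq_bigr => j _; rewrite coef_poly ltn_ord /= (polyevE _ _ (size_poly _ _)) !mulr_suml.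
apply: eq_bigr => l _; rewrite coef_poly ltn_ord /= /w !inord_val.
by rewrite -!mulrA mul_mpolyC /prd !mulrA.
Qed.

End AlgebraicDependence.

(** * Chains of primes and regular sequences *)

Section PrimeIdeals.
Variable R : comNzRingType.
Implicit Types (P Q J : R -> Prop) (a b c : R).

Lemma maximal_inverse P a : maximal_ideal P -> ~ P a -> exists u, P (a * u - 1).
Proof.
case=> idP P1 maxP nPa; have [P0 PD PM] := idP.
pose J x := exists y u, P y /\ x = y + a * u.
have idJ : is_ideal J.
  split=> [|x x' [y [u [Py ->]]] [y' [u' [Py' ->]]]|b x [y [u [Py ->]]]].
  - by exists 0, 0; rewrite mulr0 addr0.
  - by exists (y + y'), (u + u'); split; [apply: PD|rewrite mulrDr addrACA].
  - by exists (b * y), (b * u); split; [apply: PM|rewrite mulrDr mulrCA].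
have [[y [u [Py E]]]|nJ1] := classic (J 1).
  by exists u; rewrite E opprD addrCA subrr addr0 -mulN1r; apply: PM.
case: nPa; apply: (maxP J) => //.
  by move=> x Px; exists x, 0; rewrite mulr0 addr0.
by exists 0, 1; rewrite mulr1 add0r.
Qed.

Lemma maximal_is_prime P : maximal_ideal P -> prime_ideal P.
Proof.
move=> maxP; have [idP P1 _] := maxP; have [P0 PD PM] := idP.
split=> // a b Pab; have [Pa|nPa] := classic (P a); [by left|right].
have [u Pu] := maximal_inverse maxP nPa.
have -> : b = u * (a * b) - b * (a * u - 1) by ring.
by apply: (idealB idP); apply: PM.
Qed.

Lemma prime_exp P a n : prime_ideal P -> P (a ^+ n) -> P a.
Proof.
case=> _ P1 Pp; elim: n => [|n IH]; first by rewrite expr0 => /P1.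
by rewrite exprS => /Pp[].
Qed.

Lemma ideal_gen1 a b : ideal_gen (fun g => g \in [:: a]) b -> exists c, b = a * c.
Proof.
apply: (@ideal_gen_sub _ _ (fun b => exists c, b = a * c)).
  split=> [|x y [c ->] [c' ->]|x y [c ->]].
  - by exists 0; rewrite mulr0.
  - by exists (c + c'); rewrite mulrDr.
  - by exists (x * c); rewrite mulrCA.
by move=> g; rewrite inE => /eqP->; exists 1; rewrite mulr1.
Qed.

Lemma ideal_gen_nil b : ideal_gen (fun g : R => g \in [::]) b -> b = 0.
Proof.
apply: (@ideal_gen_sub _ _ (fun b => b = 0)) => //.
by split=> // [x y -> ->|x y ->]; rewrite ?addr0 ?mulr0.
Qed.

(** Without a maximal member, choice yields a strictly increasing chain in F; its union is finitely
    generated, hence already equal to a term of the chain. *)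
Lemma noetherian_maximal (F : (R -> Prop) -> Prop) J0 : noetherian R ->
  (forall J, F J -> is_ideal J) -> F J0 ->
  exists2 Q, F Q & forall J, F J -> (forall a, Q a -> J a) -> forall a, J a -> Q a.
Proof.
move=> noeth Fid FJ0; apply: NNPP => none.
have step (J : {J | F J}) : {J' : {J | F J} | (forall a, sval J a -> sval J' a) /\
    exists2 a, sval J' a & ~ sval J a}.
  apply: constructive_indefinite_description; case: J => J FJ /=.
  apply: NNPP => nx; apply: none; exists J => // J' FJ' JJ' a J'a.
  apply: NNPP => nJa; apply: nx; exists (exist _ J' FJ'); split=> //.
  by exists a.
pose C i := iter i (fun X => sval (step X)) (exist _ J0 FJ0).
have Cmono i j : (i <= j)%N -> forall a, sval (C i) a -> sval (C j) a.
  move=> ij a; rewrite -(subnK ij); elim: (j - i)%N => [//|l IH] Ca.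
  by rewrite addSn /C iterS; case: (svalP (step (C (l + i)%N))) => h _; apply: h; apply: IH.
pose U a := exists i, sval (C i) a.
have idU : is_ideal U.
  split=> [|x y [i Cx] [j Cy]|x y [i Cy]].
  - by exists 0%N; case: (Fid _ (svalP (C 0%N))).
  - exists (maxn i j); case: (Fid _ (svalP (C (maxn i j)))) => _ CD _.
    by apply: CD; [apply: Cmono Cx; rewrite leq_maxl|apply: Cmono Cy; rewrite leq_maxr].
  - by exists i; case: (Fid _ (svalP (C i))) => _ _; apply.
have [s Us] := noeth U idU.
have [n sn] : exists n, {in s, forall g, sval (C n) g}.
  have : {in s, forall g, U g} by move=> g gs; apply/Us; apply: ideal_gen_mem.
  elim: s {Us} => [|g s IH] Ug; first by exists 0%N.
  have [|n sn] := IH; first by move=> h hs; apply: Ug; rewrite inE hs orbT.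
  have [i Cg] := Ug g (mem_head _ _); exists (maxn i n) => h.
  rewrite inE => /orP[/eqP->|/sn]; first by apply: Cmono Cg; rewrite leq_maxl.
  by apply: Cmono; rewrite leq_maxr.
case: (svalP (step (C n))) => _ [a Ca]; apply.
have : U a by exists n.+1.
by move/Us; apply: ideal_gen_sub => //; apply/Fid/svalP.
Qed.

Lemma prime_between P a1 a2 : noetherian R -> prime_ideal P ->
  regular_sequence [:: a1; a2] -> P a1 -> P a2 ->
  exists Q, [/\ prime_ideal Q, Q a1, ~ Q a2 & forall a, Q a -> P a].
Proof.
move=> noeth [idP P1 Pp] [reg _] Pa1 Pa2; have [P0 PD PM] := idP.
pose W x := exists u n, ~ P u /\ x = u * a2 ^+ n.
pose F J := [/\ is_ideal J, J a1 & forall x, W x -> ~ J x].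
have idG := ideal_gen_ideal (fun g => g \in [:: a1]).
(* As a2 is regular modulo a1, a product u a2^n in the ideal of a1 forces u into that ideal, which
   lies in P. *)
have FG : F (ideal_gen (fun g => g \in [:: a1])).
  split=> //; first by apply: ideal_gen_mem; rewrite inE.
  move=> _ [u [n [nPu ->]]]; elim: n => [|n IH].
    by rewrite expr0 mulr1 => /ideal_gen1[c E]; apply: nPu; rewrite E mulrC; apply: PM.
  by rewrite exprS mulrCA => /(reg 1%N isT).
have [Q [idQ Qa1 QW] Qmax] :=
    @noetherian_maximal F _ noeth (fun J (FJ : F J) => let: And3 h _ _ := FJ in h) FG.
have [Q0 QD QM] := idQ.
have QP a : Q a -> P a.
  move=> Qa; apply: NNPP => nPa; apply: (QW a) => //.
  by exists a, 0%N; rewrite expr0 mulr1.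
exists Q; split=> //; last first.
  by apply: QW; exists 1, 1%N; rewrite mul1r expr1.
split=> //; first by apply: QW; exists 1, 0%N; rewrite mul1r expr0.
move=> a b Qab; apply: NNPP => nor.
(* By maximality of Q, the ideal generated by Q and c meets W. If a and b were both outside Q, the
   product of the two elements found would lie in W and in Q. *)
have meet c : ~ Q c -> exists w q r, [/\ W w, Q q & w = q + c * r].
  move=> nQc; pose J x := exists q r, Q q /\ x = q + c * r.
  have idJ : is_ideal J.
    split=> [|x x' [y [u [Py ->]]] [y' [u' [Py' ->]]]|z x [y [u [Py ->]]]].
    - by exists 0, 0; rewrite mulr0 addr0.
    - by exists (y + y'), (u + u'); split; [apply: QD|rewrite mulrDr addrACA].
    - by exists (z * y), (z * u); split; [apply: QM|rewrite mulrDr mulrCA].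
  have QJ x : Q x -> J x by move=> Qx; exists x, 0; rewrite mulr0 addr0.
  apply: NNPP => nW; apply: nQc; apply: (Qmax J) => //; last first.
    by exists 0, 1; rewrite mulr1 add0r.
  split=> //; first exact: QJ.
  by move=> w Ww [q [r [Qq E]]]; apply: nW; exists w, q, r.
have [|w1 [q1 [r1 [W1 Qq1 E1]]]] := meet a; first by move=> Qa; apply: nor; left.
have [|w2 [q2 [r2 [W2 Qq2 E2]]]] := meet b; first by move=> Qb; apply: nor; right.
apply: (QW (w1 * w2)).
  case: W1 W2 => [u1 [n1 [nu1 ->]]] [u2 [n2 [nu2 ->]]].
  exists (u1 * u2), (n1 + n2)%N; split; first by case/Pp.
  by rewrite exprD; ring.
have -> : w1 * w2 = w2 * q1 + ((a * r1) * q2 + (r1 * r2) * (a * b)).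
  by rewrite E1 E2; ring.
by apply: (QD (w2 * q1)); [|apply: (QD (a * r1 * q2))]; apply: QM.
Qed.

End PrimeIdeals.

Section Dimension.
Variables (K : fieldType) (R : comNzRingType) (C : {rmorphism K -> R}).
Variable iota : {rmorphism R -> {mpoly K[2]}}.
Hypothesis iota_inj : injective iota.
Hypothesis iotaC : forall c, iota (C c) = c%:MP.

Lemma iota_eq0 (a : R) : iota a = 0 -> a = 0.
Proof. by move=> ia; apply: iota_inj; rewrite ia rmorph0. Qed.

Lemma iota_domain (a b : R) : a * b = 0 -> a = 0 \/ b = 0.
Proof.
move/(congr1 iota); rewrite rmorphM rmorph0 => /eqP; rewrite mulf_eq0.
by case/orP => /eqP/iota_eq0; [left|right].
Qed.

Lemma iota_dependent (a1 a2 a3 : R) : exists F : {poly {poly {poly K}}}, F != 0 /\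
  polyev (polyev (polyev C a3) a2) a1 F = 0.
Proof.
have [F [F0 E]] := alg_dependent (iota a1) (iota a2) (iota a3).
exists F; split=> //; apply: iota_eq0; rewrite -[RHS]E.
apply: rmorph_polyev => G; apply: rmorph_polyev => H; apply: rmorph_polyev => c.
exact: iotaC.
Qed.

(* The lowest term of an algebraic relation, in the lexicographic order of    *)
(* the exponents, is this identity of Coquand and Lombardi.                   *)
Lemma dimension_identity (a1 a2 a3 : R) : exists m1 m2 m3 c x y z, c != 0 /\
  a1 ^+ m1 * (a2 ^+ m2 * (a3 ^+ m3 * (C c + a3 * x) + a2 * y) + a1 * z) = 0.
Proof.
have [F [F0 E]] := iota_dependent a1 a2 a3.
have [m1 [G [z [G0 E1]]]] := polyev_lowest (polyev (polyev C a3) a2) a1 F0.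
have [m2 [H [y [H0 E2]]]] := polyev_lowest (polyev C a3) a2 G0.
have [m3 [c [x [c0 E3]]]] := polyev_lowest C a3 H0.
exists m1, m2, m3, c, x, y, z; split=> //.
by rewrite -[RHS]E E1; rewrite /= E2 /= E3.
Qed.

Lemma unit_notin_proper (P : R -> Prop) c : is_ideal P -> ~ P 1 -> c != 0 -> ~ P (C c).
Proof.
case=> _ _ PM P1 c0 Pc; apply: P1.
by rewrite -(rmorph1 C) -(mulVf c0) rmorphM; apply: PM.
Qed.

(** In a chain of length 3 choose each a_i in Q_i but not in Q_(i-1). In the identity, the power of
    a_i is cancelled modulo Q_(i-1) and the multiple of a_i is dropped in Q_i; a nonzero constant
    remains in Q_3. *)
Lemma prime_chain_bound (P : R -> Prop) n Q : prime_chain_to P n Q -> (n <= 2)%N.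
Proof.
case=> prQ incl _; rewrite leqNgt; apply/negP=> n3.
have le3 i : (i <= 3)%N -> (i <= n)%N by move=> i3; apply: leq_trans i3 n3.
have lt3 i : (i < 3)%N -> (i < n)%N by move=> i3; apply: leq_trans i3 n3.
have [S0 [a1 Qa1 nQa1]] := incl 0%N (lt3 0%N isT).
have [S1 [a2 Qa2 nQa2]] := incl 1%N (lt3 1%N isT).
have [S2 [a3 Qa3 nQa3]] := incl 2%N (lt3 2%N isT).
have [m1 [m2 [m3 [c [x [y [z [c0 E]]]]]]]] := dimension_identity a1 a2 a3.
have [id0 _ p0] := prQ 0%N (le3 0%N isT); have [id1 _ p1] := prQ 1%N (le3 1%N isT).
have [id2 _ p2] := prQ 2%N (le3 2%N isT); have [id3 n3' _] := prQ 3%N (le3 3%N isT).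
have cancel i (a : R) m b : (i <= 3)%N -> ~ Q i a -> Q i (a ^+ m * b) -> Q i b.
  move=> i3 na; have pri := prQ i (le3 i i3); case: (pri) => _ _ pp /pp[] //.
  by move/(prime_exp pri).
have drop i (a b c' : R) : is_ideal (Q i) -> Q i a -> Q i (b + a * c') -> Q i b.
  move=> idi Qa h; have -> : b = (b + a * c') - c' * a by ring.
  by apply: (idealB idi) => //; case: (idi) => _ _; apply.
have : Q 0%N (a1 ^+ m1 * (a2 ^+ m2 * (a3 ^+ m3 * (C c + a3 * x) + a2 * y) + a1 * z)).
  by rewrite E; case: id0.
move/(cancel 0%N _ _ _ isT nQa1)/S0/(drop _ _ _ _ id1 Qa1).
move/(cancel 1%N _ _ _ isT nQa2)/S1/(drop _ _ _ _ id2 Qa2).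
move/(cancel 2%N _ _ _ isT nQa3)/S2/(drop _ _ _ _ id3 Qa3).
exact: unit_notin_proper.
Qed.

(** The same elimination, with the ideals generated by the first i elements instead of the primes
    and regularity instead of primality. *)
Lemma regular_sequence_bound (s : seq R) : regular_sequence s -> (size s <= 2)%N.
Proof.
case: s => [|a1 [|a2 [|a3 s]]] //; case=> reg proper.
have [m1 [m2 [m3 [c [x [y [z [c0 E]]]]]]]] := dimension_identity a1 a2 a3.
pose I i := ideal_gen (fun g => g \in take i [:: a1, a2, a3 & s]).
have idI i : is_ideal (I i) by apply: ideal_gen_ideal.
have cancel i m (b : R) : (i < 3)%N -> I i ([:: a1, a2, a3 & s]`_i ^+ m * b) -> I i b.
  move=> i3; elim: m => [|m IH]; first by rewrite expr0 mul1r.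
  by rewrite exprS -mulrA => h; apply: IH; apply: (reg i) => //; apply: leq_trans i3 _.
have up i b : I i b -> I i.+1 b.
  apply: ideal_gen_sub => // g gs; apply: ideal_gen_mem.
  apply/(nthP 0); move/(nthP 0): gs => [j]; rewrite !size_take_min => js <-.
  exists j; first by apply: leq_trans js _; rewrite leq_min !geq_min leqnSn /= leqnn orbT.
  by rewrite !nth_take //; move: js; rewrite leq_min => /andP[]// /ltnW.
have drop i (b c' : R) : (i < 3)%N -> I i.+1 (b + [:: a1, a2, a3 & s]`_i * c') -> I i.+1 b.
  move=> i3 h; set a := _`_i in h; have -> : b = (b + a * c') - c' * a by ring.
  apply: (idealB (idI _)) => //; case: (idI i.+1) => _ _; apply; apply: ideal_gen_mem.
  by rewrite /a; case: i i3 {h a} => [|[|[|]]] // _; rewrite !inE eqxx ?orbT.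
have : I 0%N (a1 ^+ m1 * (a2 ^+ m2 * (a3 ^+ m3 * (C c + a3 * x) + a2 * y) + a1 * z)).
  by rewrite E; case: (idI 0%N).
move/(@cancel 0%N _ _ isT)/up/(@drop 0%N _ _ isT).
move/(@cancel 1%N _ _ isT)/up/(@drop 1%N _ _ isT).
move/(@cancel 2%N _ _ isT)/up/(@drop 2%N _ _ isT) => Ic.
have : I 3 (C c) by [].
case: (unit_notin_proper (idI 3) _ c0) => // I1; apply: proper.
apply: ideal_gen_sub I1; first exact: ideal_gen_ideal.
move=> g gs; apply: ideal_gen_mem; exact: mem_take gs.
Qed.

End Dimension.

(** * Maximal ideals meet every polynomial line *)

Section Nullstellensatz.
Variables (K : fieldType) (R : comNzRingType) (C : {rmorphism K -> R}).
Variable iota : {rmorphism R -> {mpoly K[2]}}.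
Hypothesis iota_inj : injective iota.
Hypothesis iotaC : forall c, iota (C c) = c%:MP.
Variables (N : nat) (g : {rmorphism {mpoly K[N]} -> R}).
Hypothesis gC : forall c, g c%:MP = C c.
Hypothesis g_surj : forall r, exists x, g x = r.

Section Algebraic.
Variables (P : R -> Prop) (p : R).
Hypothesis maxP : maximal_ideal P.
Hypothesis trans : forall f : {poly K}, f != 0 -> ~ P (polyev C p f).
Local Notation ev := (polyev C p).
Local Notation z i := (g 'X_i).

Let idP : is_ideal P. Proof. by case: maxP. Qed.
Let P0 : P 0. Proof. by case: idP. Qed.
Let PD a b : P a -> P b -> P (a + b). Proof. by case: idP => _ PD _; apply: PD. Qed.
Let PM c a : P a -> P (c * a). Proof. by case: idP => _ _; apply. Qed.
Let PB a b : P a -> P b -> P (a - b). Proof. exact: idealB idP. Qed.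

(** Modulo P, the generator z_i satisfies an equation of degree r over K[p] with leading coefficient
    h(p): it is integral once h(p) is inverted. *)
Definition reduces (i : 'I_N) (h : {poly K}) (r : nat) :=
  exists c : nat -> {poly K}, P (ev h * z i ^+ r - \sum_(j < r) ev (c j) * z i ^+ j).

Lemma reducesM i h h' r : reduces i h r -> reduces i (h * h') r.
Proof.
move=> [c Pc]; exists (fun j => c j * h').
have -> : ev (h * h') * z i ^+ r - \sum_(j < r) ev (c j * h') * z i ^+ j =
    ev h' * (ev h * z i ^+ r - \sum_(j < r) ev (c j) * z i ^+ j).
  rewrite mulrBr mulr_sumr rmorphM /=; congr (_ - _); first by ring.
  by apply: eq_bigr => j _; rewrite rmorphM /=; ring.
exact: PM.
Qed.

Lemma reducesS i h r s : reduces i h r -> reduces i h (s + r).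
Proof.
elim: s => // s IH /IH[c]; rewrite addSn; move: (s + r)%N => q Pc.
exists (fun j => if j is j'.+1 then c j' else 0).
rewrite big_ord_recl rmorph0 mul0r add0r.
have -> : ev h * z i ^+ q.+1 - \sum_(j < q) ev (c j) * z i ^+ (lift ord0 j) =
    z i * (ev h * z i ^+ q - \sum_(j < q) ev (c j) * z i ^+ j).
  rewrite mulrBr mulr_sumr exprS; congr (_ - _); first by ring.
  by apply: eq_bigr => j _; rewrite /= /bump /= add1n exprS; ring.
exact: PM.
Qed.

(** A relation between h0, z_i and p, divided by its lowest power of h0 and taken modulo P, becomes
    a nonzero relation G between z_i and p; h is its leading coefficient in z_i. *)
Lemma exists_reduces (h0 : R) : P h0 -> h0 <> 0 -> forall i, exists2 h, h != 0 &
  exists r, reduces i h r.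
Proof.
move=> Ph0 h0n i; have [F [F0 E]] := iota_dependent iota_inj iotaC h0 (z i) p.
have [m [G [y [G0]]]] := polyev_lowest (polyev (polyev C p) (z i)) h0 F0.
rewrite E /= => /esym Gy.
have PG : P (polyev (polyev C p) (z i) G).
  have -> : polyev (polyev C p) (z i) G = - (y * h0).
    apply/eqP; rewrite -subr_eq0 opprK mulrC; apply/eqP.
    elim: m Gy => [|m IH]; first by rewrite expr0 mul1r.
    by rewrite exprS -mulrA => /(iota_domain iota_inj)[].
  exact/(idealN idP)/PM.
exists (lead_coef G); first by rewrite lead_coef_eq0.
exists (size G).-1, (fun j => - G`_j).
move: PG; rewrite (polyevE _ _ (leqnn _)).
have -> : size G = (size G).-1.+1 by rewrite prednK // lt0n size_poly_eq0.
rewrite big_ord_recr /= addrC => PG.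
rewrite -sumrN (eq_bigr (fun j : 'I_(size G).-1 => ev G`_j * z i ^+ j)) //.
by move=> j _; rewrite rmorphN /= mulNr opprK.
Qed.

Lemma uniform_reduces (h0 : R) : P h0 -> h0 <> 0 ->
  exists2 h, h != 0 & exists r, forall i, reduces i h r.+1.
Proof.
move=> Ph0 h0n.
have /fin_all_exists[hr hrP] : forall i, exists hr : {poly K} * nat,
    hr.1 != 0 /\ reduces i hr.1 hr.2.
  by move=> i; have [h hn [r red]] := exists_reduces Ph0 h0n i; exists (h, r).
exists (\prod_i (hr i).1); first by apply/prodf_neq0 => i _; case: (hrP i).
exists (\sum_i (hr i).2)%N => i; rewrite (bigD1 i) //= [(\sum_i _)%N](bigD1 i) //=.
by rewrite addnC -addSn; apply/reducesS/reducesM; case: (hrP i).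
Qed.

Section Finite.
Variables (h : {poly K}) (r : nat).
Hypothesis h_neq0 : h != 0.
Hypothesis red : forall i, reduces i h r.+1.
Local Notation E := {ffun 'I_N -> 'I_r.+1}.

Definition bmon (f : E) : R := \prod_i z i ^+ f i.

(** R/P becomes a finite module over K[p] after inverting h(p), spanned by the monomials with all
    exponents at most r; m counts the denominators used for y. *)
Definition spanned m (y : R) := exists c : E -> {poly K},
  P (ev h ^+ m * y - \sum_f ev (c f) * bmon f).

Lemma spannedS m s y : spanned m y -> spanned (s + m) y.
Proof.
move=> [c Pc]; exists (fun f => h ^+ s * c f).
have -> : ev h ^+ (s + m) * y - \sum_f ev (h ^+ s * c f) * bmon f =
    ev h ^+ s * (ev h ^+ m * y - \sum_f ev (c f) * bmon f).
  rewrite mulrBr mulr_sumr exprD mulrA; congr (_ - _); apply: eq_bigr => f _.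
  by rewrite rmorphM rmorphXn /= mulrA.
exact: PM.
Qed.

Definition good y := exists m, spanned m y.

Lemma good_bmon f : good (bmon f).
Proof.
exists 0%N, (fun f' => (f' == f)%:R); rewrite expr0 mul1r (bigD1 f) //= eqxx.
rewrite rmorph1 mul1r big1 ?addr0 ?subrr // => f' /negbTE ->.
by rewrite rmorph0 mul0r.
Qed.

Lemma goodD x y : good x -> good y -> good (x + y).
Proof.
move=> [m sx] [n sy]; exists (n + m)%N.
have [c Pc] := spannedS n sx; have := spannedS m sy; rewrite addnC => -[c' Pc'].
exists (fun f => c f + c' f).
have -> : ev h ^+ (n + m) * (x + y) - \sum_f ev (c f + c' f) * bmon f =
    (ev h ^+ (n + m) * x - \sum_f ev (c f) * bmon f)
    + (ev h ^+ (n + m) * y - \sum_f ev (c' f) * bmon f).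
  rewrite mulrDr addrACA -opprD -big_split /=; congr (_ - _).
  by apply: eq_bigr => f _; rewrite rmorphD mulrDl.
exact: PD.
Qed.

Lemma goodM (f : {poly K}) y : good y -> good (ev f * y).
Proof.
move=> [m [c Pc]]; exists m, (fun b => f * c b).
have -> : ev h ^+ m * (ev f * y) - \sum_b ev (f * c b) * bmon b =
    ev f * (ev h ^+ m * y - \sum_b ev (c b) * bmon b).
  rewrite mulrBr mulr_sumr mulrCA; congr (_ - _); apply: eq_bigr => b _.
  by rewrite rmorphM /= mulrA.
exact: PM.
Qed.

Lemma good_mod x y : P (x - y) -> good y -> good x.
Proof.
move=> Pxy [m [c Pc]]; exists m, c.
have -> : ev h ^+ m * x - \sum_b ev (c b) * bmon b =
    ev h ^+ m * (x - y) + (ev h ^+ m * y - \sum_b ev (c b) * bmon b).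
  by rewrite mulrBr addrA subrK.
by apply: PD => //; apply: PM.
Qed.

Lemma good_cancel m y : good (ev h ^+ m * y) -> good y.
Proof.
move=> [n [c Pc]]; exists (n + m)%N, c.
by rewrite exprD -mulrA.
Qed.

Lemma good_sum (I : finType) (F : I -> R) : (forall i, good (F i)) -> good (\sum_i F i).
Proof.
move=> gF; elim/big_ind: _ => //; last exact: goodD.
exists 0%N, (fun _ => 0); rewrite mulr0 sub0r big1 ?oppr0 // => f _.
by rewrite rmorph0 mul0r.
Qed.

Definition bset (i : 'I_N) (j : 'I_r.+1) (f : E) : E :=
  [ffun l => if l == i then j else f l].

Lemma bmon_bset i j f : bmon (bset i j f) = z i ^+ j * bmon (bset i ord0 f).
Proof.
rewrite /bmon (bigD1 i) //= [in RHS](bigD1 i) //= !ffunE eqxx expr0 mul1r.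
by congr (_ * _); apply: eq_bigr => l li; rewrite !ffunE (negbTE li).
Qed.

Lemma good_var_bmon i f : good (z i * bmon f).
Proof.
have -> : bmon f = z i ^+ f i * bmon (bset i ord0 f).
  rewrite -bmon_bset; congr bmon; apply/ffunP=> l; rewrite ffunE.
  by case: eqP => [->|].
rewrite mulrA -exprS; have := ltn_ord (f i); rewrite ltnS leq_eqVlt => /orP[/eqP->|lt].
  apply: (@good_cancel 1); rewrite expr1 mulrA.
  have [c Pc] := red i.
  apply: (@good_mod _ (\sum_(j < r.+1) ev (c j) * z i ^+ j * bmon (bset i ord0 f))).
    by rewrite -mulr_suml -mulrBl mulrC; apply: PM.
  apply: good_sum => j; rewrite -mulrA -bmon_bset.
  exact/goodM/good_bmon.
rewrite -ltnS in lt; have := bmon_bset i (Ordinal lt) f => /= <-.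
exact: good_bmon.
Qed.

Lemma good_var i y : good y -> good (z i * y).
Proof.
move=> [m [c Pc]]; apply: (@good_cancel m).
apply: (@good_mod _ (\sum_f ev (c f) * (z i * bmon f))).
  have -> : ev h ^+ m * (z i * y) - \sum_f ev (c f) * (z i * bmon f) =
      z i * (ev h ^+ m * y - \sum_f ev (c f) * bmon f).
    rewrite mulrBr mulr_sumr mulrCA; congr (_ - _).
    by apply: eq_bigr => f _; rewrite mulrCA.
  exact: PM.
by apply: good_sum => f; apply/goodM/good_var_bmon.
Qed.

Lemma good_all y : good y.
Proof.
have [x <-] := g_surj y; elim/mpolyind: x => [|c m x _ _ gx].
  rewrite rmorph0 -(mul0r 1) -(rmorph0 ev); apply/goodM/good_mod/(good_bmon [ffun=> ord0]).
  rewrite /bmon big1 ?subrr // => i _; by rewrite ffunE expr0.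
rewrite rmorphD /=; apply: goodD => //.
rewrite -mul_mpolyC rmorphM /= gC -(polyevC C p); apply: goodM.
rewrite mpolyXE_id rmorph_prod /=; elim/big_rec: _ => [|i y' _ gy'].
  rewrite (_ : 1 = bmon [ffun=> ord0]); first exact: good_bmon.
  by rewrite /bmon big1 // => i _; rewrite ffunE expr0.
rewrite rmorphXn /=; elim: (m i) => [|q IH]; first by rewrite expr0 mul1r.
by rewrite exprS -mulrA; apply: good_var.
Qed.

Lemma dvdp_det_congr n (d : {poly K}) (A B : 'M[{poly K}]_n) :
  (forall i j, d %| A i j - B i j) -> d %| \det A - \det B.
Proof.
move=> AB; rewrite /determinant -sumrB; apply: (big_ind (fun x => d %| x)).
- exact: dvdp0.
- by move=> x y; apply: dvdp_add.
move=> /= s _; rewrite -mulrBr dvdp_mull //.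
elim/big_rec2: _ => [|i x y _ xy]; first by rewrite subrr dvdp0.
have -> : A i (s i) * y - B i (s i) * x =
    (A i (s i) - B i (s i)) * y + B i (s i) * (y - x) by ring.
by apply: dvdp_add; [apply: dvdp_mulr; apply: AB|apply: dvdp_mull].
Qed.

(* Multiplication by the inverse of [1 + X h] preserves the span, so a        *)
(* determinant congruent to a power of h modulo [1 + X h] must vanish.        *)
Lemma no_transcendental : False.
Proof.
pose q : {poly K} := h * 'X + 1%:P.
have sq : size q = (size h).+1 by rewrite size_MXaddC (negbTE h_neq0).
have q0 : q != 0 by rewrite -size_poly_eq0 sq.
have [u Pu] := maximal_inverse maxP (trans q0).
have /fin_all_exists[M0 spM0] : forall f : E, exists m, spanned m (u * bmon f).
  by move=> f; apply: good_all.
pose m := (\sum_f M0 f)%N.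
have /fin_all_exists[c cP] : forall f : E, exists c : E -> {poly K},
    P (ev h ^+ m * (u * bmon f) - \sum_f' ev (c f') * bmon f').
  by move=> f; rewrite /m (bigD1 f) //= addnC; apply: spannedS.
pose n := #|{: E}|.
(* This is h^m times the identity minus q times the matrix of multiplication by u, denominators
   cleared. Since u inverts q(p), it sends the vector of spanning monomials into P. *)
pose A : 'M[{poly K}]_n := \matrix_(a, b)
  ((h ^+ m)%:M a b - q * c (enum_val a) (enum_val b)).
have rows a : P (\sum_b ev (A a b) * bmon (enum_val b)).
  set f := enum_val a.
  have -> : \sum_b ev (A a b) * bmon (enum_val b) =
      ev q * (ev h ^+ m * (u * bmon f) - \sum_f' ev (c f f') * bmon f')
      - ev h ^+ m * bmon f * (ev q * u - 1).
    rewrite (eq_bigr (fun b => ev ((h ^+ m)%:M a b) * bmon (enum_val b)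
       - ev q * (ev (c f (enum_val b)) * bmon (enum_val b)))); last first.
      by move=> b _; rewrite mxE rmorphB rmorphM /= mulrBl -mulrA.
    rewrite sumrB -mulr_sumr (bigD1 a) //= mxE eqxx mulr1n big1 ?addr0; last first.
      by move=> b ab; rewrite mxE eq_sym (negbTE ab) mulr0n rmorph0 mul0r.
    rewrite rmorphXn /= -/f; set s := \sum_(f' : E) _.
    have -> : \sum_(b < n) ev (c f (enum_val b)) * bmon (enum_val b) = s.
      rewrite /s (reindex (@enum_val E predT)) //=.
      exact/onW_bij/enum_val_bij.
    by move: (ev h ^+ m) (ev q) (bmon f) s => x1 x2 x3 x4; ring.
  by apply: PB; [apply: PM|apply: PM].
(* Cramer's rule, read at the spanning monomial 1, puts the determinant itself into P. *)
have Pdet : P (ev (\det A)).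
  pose b0 : 'I_n := enum_rank [ffun=> ord0].
  have b01 : bmon (enum_val b0) = 1.
    by rewrite enum_rankK /bmon big1 // => i _; rewrite ffunE expr0.
  have -> : ev (\det A) = \sum_a ev (\adj A b0 a) * \sum_b ev (A a b) * bmon (enum_val b).
    under eq_bigr => a _ do rewrite mulr_sumr.
    rewrite exchange_big /= (bigD1 b0) //= [X in _ + X]big1 ?addr0.
      rewrite b01; under eq_bigr => a _ do rewrite mulr1 -rmorphM.
      rewrite -rmorph_sum /=; congr (ev _).
      have := mul_adj_mx A => /matrixP/(_ b0 b0); rewrite !mxE eqxx mulr1n => <-.
      by [].
    move=> b bb; under eq_bigr => a _ do rewrite mulrA -rmorphM.
    rewrite -mulr_suml -rmorph_sum /=.
    have := mul_adj_mx A => /matrixP/(_ b0 b).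
    by rewrite !mxE eq_sym (negbTE bb) mulr0n => ->; rewrite rmorph0 mul0r.
  by apply: (ideal_sum idP) => a _ _; apply/PM/rows.
have det0 : \det A = 0 by apply/eqP/negPn/negP => /trans.
have : q %| \det A - \det ((h ^+ m)%:M : 'M_n).
  apply: dvdp_det_congr => a b; rewrite [A a b]mxE addrAC subrr sub0r -mulrN.
  by rewrite dvdp_mulr.
rewrite det0 sub0r -mulN1r -polyCN mul_polyC dvdpZr ?oppr_eq0 ?oner_eq0 //.
rewrite det_scalar -exprM => qh.
have cop : coprimep q h.
  apply/Bezout_eq1_coprimepP; exists (1, - 'X) => /=.
  by rewrite /q; ring.
have : coprimep q (h ^+ (m * n)) by rewrite coprimep_expr.
move/coprimepP/(_ q (dvdpp q) qh); rewrite -size_poly_eq1 sq eqSS size_poly_eq0.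
by rewrite (negbTE h_neq0).
Qed.

End Finite.
End Algebraic.

(** If P contained no nonzero f(p), then p would be outside P and have an inverse u modulo P. The
    element pu - 1 of P is nonzero because p is not a unit, and it starts the finiteness argument
    refuted by [no_transcendental]. *)
Lemma maximal_meets_line (P : R -> Prop) (p : R) : maximal_ideal P ->
  (forall u, p * u <> 1) -> exists2 f : {poly K}, f != 0 & P (polyev C p f).
Proof.
move=> maxP nunit; apply: NNPP => none.
have trans (f : {poly K}) : f != 0 -> ~ P (polyev C p f).
  by move=> f0 Pf; apply: none; exists f.
have [u Pu] : exists u, P (p * u - 1).
  apply: maximal_inverse => // Pp; apply: (trans 'X); first by rewrite polyX_eq0.
  by rewrite polyevX.
have h0 : p * u - 1 <> 0 by move/eqP; rewrite subr_eq0 => /eqP/nunit.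
have [h hn [r red]] := uniform_reduces p maxP Pu h0.
exact (no_transcendental maxP trans hn red).
Qed.

End Nullstellensatz.

(** * Division in two variables *)

Lemma mcoeff_mulXU (K : fieldType) n (q : {mpoly K[n]}) (i : 'I_n) m :
  (q * 'X_i)@_m = if m i == 0%N then 0 else q@_(m - U_(i)).
Proof.
case: eqP => [mi|/eqP mi]; last first.
  by rewrite -{1}(@submK _ U_(i)%MM m) ?lep1mP // addmC mcoeffMX.
apply: memN_msupp_eq0; rewrite (perm_mem (msuppMX _ _)); apply/mapP => -[m' _ E].
by move: mi; rewrite E mnmDE mnm1E eqxx.
Qed.

Section TwoVariables.
Variable K : fieldType.
Local Notation B := {mpoly K[2]}.
Local Notation cst := (@mpolyC 2 K).

(** k[s,t] regarded as k[t][s], where division by polynomials monic in s is available. *)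
Definition theta : {poly {poly K}} -> B := polyev (polyev cst 'X_1) 'X_0.

HB.instance Definition _ := GRing.RMorphism.copy theta (polyev (polyev cst 'X_1) 'X_0).

Lemma mcoeff_theta (H : {poly {poly K}}) m : (theta H)@_m = H`_(m 0)`_(m 1).
Proof.
have inner (p : {poly K}) m' : (polyev cst 'X_1 p)@_m' = if m' 0 == 0%N then p`_(m' 1) else 0.
  elim/poly_ind: p m' => [|p c IH] m'; first by rewrite rmorph0 mcoeff0 coef0 if_same.
  rewrite polyevMXaddC mcoeffD mcoeffC mcoeff_mulXU IH coefD coefMX coefC.
  rewrite !mnmBE !mnm1E /= subn0 subn1 mulr_natr.
  have -> : (m' == 0%MM) = (m' 0 == 0%N) && (m' 1 == 0%N).
    apply/eqP/andP => [->|[/eqP m0 /eqP m1]]; first by rewrite !mnm0E.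
    apply/mnmP=> -[[|[|//]] iP]; rewrite mnm0E; [rewrite -[RHS]m0|rewrite -[RHS]m1].
      by congr (m' _); apply: val_inj.
    by congr (m' _); apply: val_inj.
  by case: (m' 0 == 0%N); case: (m' 1 == 0%N); rewrite ?mulr0n ?mulr1n ?addr0 ?add0r ?if_same.
elim/poly_ind: H m => [|H c IH] m; first by rewrite rmorph0 mcoeff0 !coef0.
rewrite /theta polyevMXaddC -/theta mcoeffD mcoeff_mulXU /= inner IH coefD coefMX coefC.
rewrite !mnmBE !mnm1E /= subn0 subn1.
by case: eqP => _; rewrite ?add0r ?addr0 ?coefD ?coef0 ?add0r ?addr0.
Qed.

Definition mon2 (i j : nat) : 'X_{1..2} := (U_(0%R) *+ i + U_(1%R) *+ j)%MM.

Lemma mon2E (m : 'X_{1..2}) : mon2 (m 0) (m 1) = m.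
Proof.
apply/mnmP=> i; rewrite /mon2 mnmDE !mulmnE !mnm1E.
by case: i => -[|[|//]] iP; rewrite /= ?mul1n ?mul0n ?addn0; congr (m _); apply: val_inj.
Qed.

Lemma theta_inj : injective theta.
Proof.
move=> H H' E; apply/polyP=> i; apply/polyP=> j.
have := congr1 (mcoeff (mon2 i j)) E; rewrite !mcoeff_theta.
by rewrite /mon2 !mnmDE !mulmnE !mnm1E /= !mul1n addn0.
Qed.

Lemma theta_surj (b : B) : exists H, theta H = b.
Proof.
elim/mpolyind: b => [|c m b _ _ [H <-]]; first by exists 0; rewrite rmorph0.
exists (c%:P%:P * ('X ^+ m 0 * 'X%:P ^+ m 1) + H).
rewrite rmorphD !rmorphM !rmorphXn /= /theta !polyevC !polyevX /=.
have e1 : lift ord0 ord0 = 1 :> 'I_2 by apply: val_inj.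
by rewrite polyevC polyevX -mul_mpolyC ['X_[m]]mpolyXE_id !big_ord_recl big_ord0 mulr1 e1.
Qed.

Definition polyCC (c : K) : {poly {poly K}} := c%:P%:P.

HB.instance Definition _ := GRing.RMorphism.copy polyCC (polyC \o polyC).

(** Divide a by F, which is monic in s. The remainder T satisfies G T = F W with G free of s, and
    since T has smaller s-degree than F, both W and T vanish. *)
Lemma theta_divides (f g : {poly K}) (n1 n2 : nat) (a b : B) :
  f \is monic -> g \is monic -> (0 < n1)%N -> (0 < n2)%N ->
  polyev cst ('X_1 ^+ n2) g * a = polyev cst ('X_0 ^+ n1) f * b ->
  exists c, a = polyev cst ('X_0 ^+ n1) f * c /\ b = polyev cst ('X_1 ^+ n2) g * c.
Proof.
move=> fm gm n1p n2p E.
have liftC h (x : {poly {poly K}}) : theta (polyev polyCC x h) = polyev cst (theta x) h.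
  by apply: rmorph_polyev => c; rewrite /= /theta polyevC /= polyevC.
pose F := polyev polyCC 'X^n1 f; pose G := polyev polyC 'X^n2 g.
have tF : theta F = polyev cst ('X_0 ^+ n1) f.
  by rewrite liftC rmorphXn /= {1}/theta polyevX.
have tG : theta G%:P = polyev cst ('X_1 ^+ n2) g.
  have -> : G%:P = polyev polyCC ('X^n2)%:P g by apply: rmorph_polyev.
  rewrite liftC.
  by rewrite polyC_exp rmorphXn /= {1}/theta polyevC /= polyevX.
have monic_comp (h : {poly K}) m : h \is monic -> (0 < m)%N -> polyev polyC 'X^m h \is monic.
  move=> hm m0; have -> : polyev polyC 'X^m h = h \Po 'X^m by [].
  rewrite monicE lead_coef_comp ?size_polyXn // lead_coefXn expr1n mulr1.
  by rewrite -monicE.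
have Fm : F \is monic.
  have -> : F = map_poly polyC (polyev polyC 'X^n1 f).
    rewrite /F -(map_polyXn polyC); apply: esym.
    by apply: (rmorph_polyev (g := map_poly polyC)) => c; rewrite /= map_polyC.
  by rewrite map_monic ?monic_comp.
have [[A tA] [B' tB]] := (theta_surj a, theta_surj b).
have {}E : G%:P * A = F * B'.
  by apply: theta_inj; rewrite !rmorphM /= tF tG tA tB.
have := Pdiv.RingMonic.rdivp_eq Fm A.
set Q := Pdiv.CommonRing.rdivp A F; set T := Pdiv.CommonRing.rmodp A F => AE.
have TF : (size T < size F)%N by rewrite Pdiv.CommonRing.ltn_rmodpN0 // monic_neq0.
have G0 : G != 0 by rewrite monic_neq0 // monic_comp.
have E2 : G%:P * T = F * (B' - G%:P * Q).
  by rewrite mulrBr -E AE; ring.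
have W0 : B' - G%:P * Q = 0.
  apply/eqP; apply: contraTT TF => W0; rewrite -leqNgt.
  have -> : size T = size (G%:P * T) by rewrite mul_polyC size_scale.
  rewrite E2 size_proper_mul; last first.
    by rewrite (monicP Fm) mul1r lead_coef_eq0.
  have : (0 < size (B' - G%:P * Q)%R)%N by rewrite lt0n size_poly_eq0.
  by move: (size F) (size _) => x y; lia.
have T0 : T = 0.
  by apply/eqP; move/eqP: E2; rewrite W0 mulr0 mulf_eq0 polyC_eq0 (negbTE G0).
exists (theta Q); split.
  by rewrite -tA AE T0 addr0 rmorphM /= tF mulrC.
by rewrite -tB -tG -rmorphM /=; congr theta; apply/eqP; rewrite -subr_eq0 W0.
Qed.

End TwoVariables.

(** * Cohen-Macaulayness *)

Lemma polyev_Xn_neq0 (K : fieldType) m (i : 'I_m) n (f : {poly K}) :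
  f != 0 -> (0 < n)%N -> polyev (@mpolyC m K) ('X_i ^+ n) f != 0.
Proof.
move=> f0 n0; have sf : size f = (size f).-1.+1 by rewrite prednK // lt0n size_poly_eq0.
apply: contraNneq f0 => /(congr1 (mcoeff (U_(i) *+ (n * (size f).-1))%MM)).
rewrite (polyevE _ _ (leqnn _)) sf big_ord_recr raddfD raddf_sum /= mcoeff0.
rewrite big1 ?add0r => [|j _]; rewrite -exprM mul_mpolyC mpolyXn mcoeffZ mcoeffX.
  by rewrite eqxx mulr1 => /eqP; rewrite lead_coef_eq0.
case: eqP => [/mnmP/(_ i)|_]; last by rewrite mulr0.
rewrite !mulmnE mnm1E eqxx !mul1n => /eqP; rewrite eqn_pmul2l // => /eqP E.
by have := ltn_ord j; rewrite E ltnn.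
Qed.

Section WeightedCurveCohenMacaulay.
Variables (k : fieldType) (d e : nat).
Hypotheses (d_gt0 : (0 < d)%N) (e_gt0 : (0 < e)%N).
Local Notation N := (d + e)%N.
Local Notation S := {mpoly k[N]}.
Local Notation R := (wrc_ring k d e).
Local Notation B := {mpoly k[2]}.

Definition wrc_pi : S -> R := wrc_proj k d e.

HB.instance Definition _ :=
  GRing.RMorphism.copy wrc_pi (\pi_({ideal_quot (wrc_ideal k d e)})%qT).

Definition wrc_embed (r : R) : B := wrc_map (repr r).

Lemma wrc_embedE (x : S) : wrc_embed (wrc_pi x) = wrc_map x.
Proof.
rewrite /wrc_embed; apply/eqP; rewrite -subr_eq0 /wrc_map -raddfB /=.
have : repr (wrc_pi x) - x \in wrc_ideal k d e by apply/wrc_proj_eq; apply: reprK.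
by [].
Qed.

Lemma wrc_pi_surj (r : R) : exists x, wrc_pi x = r.
Proof. exact: wrc_proj_surj. Qed.

Lemma wrc_embed_zmod : zmod_morphism wrc_embed.
Proof.
move=> r r'; have [x <-] := wrc_pi_surj r; have [y <-] := wrc_pi_surj r'.
by rewrite -rmorphB /= !wrc_embedE /wrc_map raddfB.
Qed.

Lemma wrc_embed_monoid : monoid_morphism wrc_embed.
Proof.
split=> [|r r']; first by rewrite -(rmorph1 wrc_pi) wrc_embedE /wrc_map rmorph1.
have [x <-] := wrc_pi_surj r; have [y <-] := wrc_pi_surj r'.
by rewrite -rmorphM /= !wrc_embedE /wrc_map rmorphM.
Qed.

HB.instance Definition _ := GRing.isZmodMorphism.Build R B wrc_embed wrc_embed_zmod.
HB.instance Definition _ := GRing.isMonoidMorphism.Build R B wrc_embed wrc_embed_monoid.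

Lemma wrc_embed_inj : injective wrc_embed.
Proof.
move=> r r'; have [x <-] := wrc_pi_surj r; have [y <-] := wrc_pi_surj r'.
rewrite !wrc_embedE => E; apply/wrc_proj_eq.
by rewrite inE /wrc_map raddfB /= -![_ \mPo _]/(wrc_map _) E subrr.
Qed.

Definition wrc_const (c : k) : R := wrc_pi c%:MP.
HB.instance Definition _ := GRing.RMorphism.copy wrc_const (wrc_pi \o @mpolyC N k).

Lemma wrc_embed_const c : wrc_embed (wrc_const c) = c%:MP.
Proof. by rewrite wrc_embedE /wrc_map comp_mpolyC. Qed.

Lemma wrc_noetherian : noetherian R.
Proof.
move=> I idI; case: (idI) => I0 ID IM.
have [|s sP] := @mpoly_noetherian k N (fun x => I (wrc_pi x)).
  split=> [|x y|c x]; first by rewrite rmorph0.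
    by rewrite rmorphD; apply: ID.
  by rewrite rmorphM; apply: IM.
exists (map wrc_pi s) => a; split.
  have [x <-] := wrc_pi_surj a => /sP[cg cgs ->].
  rewrite rmorph_sum /=; apply: ideal_sum; first exact: ideal_gen_ideal.
  move=> u ucg _; rewrite rmorphM /=.
  case: (ideal_gen_ideal (fun g => g \in map wrc_pi s)) => _ _; apply.
  by apply: ideal_gen_mem; apply/map_f/cgs.
apply: ideal_gen_sub => // _ /mapP[x xs ->]; apply/sP.
exact: ideal_gen_mem.
Qed.

Definition bideg_of (c : 'X_{1..2}) := exists m : 'X_{1..N}, bideg m = c.

Lemma wrc_embed_supp r c : (wrc_embed r)@_c != 0 -> bideg_of c.
Proof.
have [x <-] := wrc_pi_surj r; rewrite wrc_embedE mcoeff_wrc_map => nz.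
apply: NNPP => none; move: nz; rewrite big1 ?eqxx // => m /eqP mc.
by case: none; exists m.
Qed.

Lemma wrc_embed_image (b : B) : (forall c, b@_c != 0 -> bideg_of c) ->
  exists r, wrc_embed r = b.
Proof.
move=> supp; rewrite (mpolyE b) big_seq.
elim/big_ind: _ => [|x y [r <-] [r' <-]|c]; first by exists 0; rewrite rmorph0.
  by exists (r + r'); rewrite rmorphD.
rewrite mcoeff_msupp => /supp[m <-]; exists (wrc_const b@_(bideg m) * wrc_pi 'X_[m]).
by rewrite rmorphM /= wrc_embed_const wrc_embedE wrc_mapX // mul_mpolyC.
Qed.

(** The image of R is spanned by monomials, so the remaining monomials span a complement of it in
    k[s,t]. *)
Lemma supp_split (b : B) : exists b1 b2, [/\ b = b1 + b2,
  forall c, b1@_c != 0 -> bideg_of c & forall c, b2@_c != 0 -> ~ bideg_of c].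
Proof.
rewrite (mpolyE b); elim/big_ind: _ => [|x y [x1 [x2 [-> h1 h2]]] [y1 [y2 [-> h1' h2']]]|c _].
- by exists 0, 0; split=> [|c|c]; rewrite ?addr0 // mcoeff0 eqxx.
- have add (u v : B) (Q : 'X_{1..2} -> Prop) : (forall c, u@_c != 0 -> Q c) ->
      (forall c, v@_c != 0 -> Q c) -> forall c, (u + v)@_c != 0 -> Q c.
    move=> hu hv c; rewrite mcoeffD; have [->|nz _] := eqVneq (u@_c) 0; last exact: hu.
    by rewrite add0r; apply: hv.
  by exists (x1 + y1), (x2 + y2); split; [rewrite addrACA|apply: add|apply: add].
have term c' : (b@_c *: 'X_[c])@_c' != 0 -> c' = c.
  by rewrite mcoeffZ mcoeffX; case: (c =P c') => // _; rewrite mulr0 eqxx.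
have [bc|nbc] := classic (bideg_of c).
  exists (b@_c *: 'X_[c]), 0; split=> [|c' /term->|c']; rewrite ?addr0 //.
  by rewrite mcoeff0 eqxx.
by exists 0, (b@_c *: 'X_[c]); split=> [|c'|c' /term->]; rewrite ?add0r // mcoeff0 eqxx.
Qed.

(* k[s,t]/R is torsion free over k[t^(ed)], because removing t^(ed) from the  *)
(* bidegree of a monomial of S gives again such a bidegree.                   *)
Lemma outside_mulX (y : B) : (forall c, y@_c != 0 -> ~ bideg_of c) ->
  forall c, ('X_1 ^+ (e * d) * y)@_c != 0 -> ~ bideg_of c.
Proof.
move=> ny c; rewrite mpolyXn mulrC -mcoeff_msupp (perm_mem (msuppMX _ _)).
move=> /mapP[c']; rewrite mcoeff_msupp => /ny nc' -> [m mE]; apply: nc'.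
have [|m' [s' t']] := @tdeg_shift d e d_gt0 e_gt0 k m (c' 1).
  by rewrite -bideg1 mE mnmDE mulmnE mnm1E eqxx mul1n addnC.
exists m'; rewrite -[LHS]mon2E -[RHS]mon2E !bideg0 !bideg1 s' t' -bideg0 mE.
by rewrite mnmDE mulmnE mnm1E.
Qed.

Lemma outside_polyev (g : {poly k}) (y : B) :
  (forall c, y@_c != 0 -> ~ bideg_of c) -> forall c,
  (polyev (@mpolyC 2 k) ('X_1 ^+ (e * d)) g * y)@_c != 0 -> ~ bideg_of c.
Proof.
elim/poly_ind: g y => [|g a IH] y ny c; first by rewrite rmorph0 mul0r mcoeff0 eqxx.
rewrite polyevMXaddC mulrDl mcoeffD -mulrA.
set t := (_ * (_ * y))@_c; have [t0|nz _] := eqVneq t 0.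
  rewrite t0 add0r mul_mpolyC mcoeffZ => nz; apply: ny.
  by apply: contraNneq nz => ->; rewrite mulr0.
by apply: IH nz => c'; apply: outside_mulX.
Qed.

Definition wrc_x0 : R := wrc_pi 'X_(zn e d_gt0 0).
Definition wrc_ylast : R := wrc_pi 'X_(zn e d_gt0 (N - 1)).

Lemma embed_x0 : wrc_embed wrc_x0 = 'X_0 ^+ d.
Proof.
rewrite wrc_embedE wrc_mapX // /bideg !lin1 znE; last by lia.
by rewrite /sdeg /tdeg d_gt0 subn0 mulm0n addm0 mpolyXn.
Qed.

Lemma embed_ylast : wrc_embed wrc_ylast = 'X_1 ^+ (e * d).
Proof.
rewrite wrc_embedE wrc_mapX // /bideg !lin1 znE; last by lia.
rewrite /sdeg /tdeg; have -> : (N - 1 < d)%N = false by lia.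
have -> : (e - 1 - (N - 1 - d) = 0)%N by lia.
have -> : (e * d - (e - 1) + (N - 1 - d) = e * d)%N.
  have : (e <= e * d)%N by rewrite leq_pmulr.
  by move: (e * d)%N => ed; lia.
by rewrite mulm0n add0m mpolyXn.
Qed.

Lemma not_unit (r u : R) (i : 'I_2) n :
  (0 < n)%N -> wrc_embed r = 'X_i ^+ n -> r * u <> 1.
Proof.
case: n => // n _ ri ru; have := congr1 (mcoeff 0%MM) (congr1 wrc_embed ru).
rewrite rmorphM rmorph1 /= ri exprSr mulrAC mcoeff_mulXU mnm0E eqxx mcoeff1 eqxx.
by move/eqP; rewrite eq_sym oner_eq0.
Qed.

Lemma monic_in_maximal (P : R -> Prop) (r : R) (i : 'I_2) n :
  (0 < n)%N -> wrc_embed r = 'X_i ^+ n -> maximal_ideal P ->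
  exists2 f, f \is monic & P (polyev wrc_const r f).
Proof.
move=> n0 ri maxP.
have [|f f0 Pf] := @maximal_meets_line k R wrc_const wrc_embed wrc_embed_inj
   wrc_embed_const N wrc_pi (fun c => erefl) wrc_pi_surj P r maxP.
  by move=> u; apply: not_unit ri.
exists ((lead_coef f)^-1 *: f).
  by rewrite monicE lead_coefZ mulVf // lead_coef_eq0.
rewrite -mul_polyC rmorphM; case: (maxP) => -[_ _ PM] _ _; exact: PM.
Qed.

Lemma embed_polyev (r : R) (f : {poly k}) :
  wrc_embed (polyev wrc_const r f) = polyev (@mpolyC 2 k) (wrc_embed r) f.
Proof. by apply: rmorph_polyev => c; apply: wrc_embed_const. Qed.

(** If a2 a = a1 b in R, then [theta_divides] gives c in k[s,t] with a = a1 c and b = a2 c. Let c2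
    be the part of c outside R. Then a2 c2 lies in R, while by [outside_polyev] none of its
    monomials does; hence c2 = 0 and a is a multiple of a1 in R. *)
Lemma wrc_regular (P : R -> Prop) (f g : {poly k}) :
  is_ideal P -> ~ P 1 -> f \is monic -> g \is monic ->
  P (polyev wrc_const wrc_x0 f) -> P (polyev wrc_const wrc_ylast g) ->
  regular_sequence [:: polyev wrc_const wrc_x0 f; polyev wrc_const wrc_ylast g].
Proof.
move=> idP P1 fm gm Pf Pg; set a1 := polyev _ _ f in Pf *; set a2 := polyev _ _ g in Pg *.
have E1 : wrc_embed a1 = polyev (@mpolyC 2 k) ('X_0 ^+ d) f.
  by rewrite embed_polyev embed_x0.
have E2 : wrc_embed a2 = polyev (@mpolyC 2 k) ('X_1 ^+ (e * d)) g.
  by rewrite embed_polyev embed_ylast.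
have ed0 : (0 < e * d)%N by rewrite muln_gt0 e_gt0.
split; last first.
  move=> one; apply: P1; apply: ideal_gen_sub one => // h.
  by rewrite !inE => /orP[] /eqP->.
move=> [_ a|[_ a|//]] /=.
  move/ideal_gen_nil => E.
  have a10 : wrc_embed a1 != 0 by rewrite E1 polyev_Xn_neq0 ?monic_neq0.
  have [a1z|->] := iota_domain wrc_embed_inj E; last by exists [::]; rewrite ?big_nil.
  by rewrite a1z rmorph0 eqxx in a10.
move=> /ideal_gen1[b E].
have := congr1 wrc_embed E; rewrite !rmorphM /= E1 E2 => Eb.
have [c [ca cb]] := theta_divides fm gm d_gt0 ed0 Eb.
have [c1 [c2 [cE in1 out2]]] := supp_split c.
have [r1 r1E] := wrc_embed_image in1.
have G0 : polyev (@mpolyC 2 k) ('X_1 ^+ (e * d)) g != 0.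
  by rewrite polyev_Xn_neq0 ?monic_neq0.
have c20 : c2 = 0.
  have G2 : polyev (@mpolyC 2 k) ('X_1 ^+ (e * d)) g * c2 = wrc_embed (b - a2 * r1).
    by rewrite rmorphB rmorphM /= cb E2 r1E cE mulrDr addrAC subrr add0r.
  suff : polyev (@mpolyC 2 k) ('X_1 ^+ (e * d)) g * c2 == 0.
    by rewrite mulf_eq0 (negbTE G0) => /eqP.
  apply/eqP/mpolyP=> l; rewrite mcoeff0; apply/eqP/negPn/negP => nz.
  by apply: (outside_polyev out2 nz); rewrite G2 in nz; apply: wrc_embed_supp nz.
have -> : a = r1 * a1.
  by apply: wrc_embed_inj; rewrite rmorphM /= ca E1 r1E cE c20 addr0 mulrC.
case: (ideal_gen_ideal (fun g => g \in [:: a1])) => _ _; apply.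
by apply: ideal_gen_mem; rewrite inE.
Qed.

Lemma wrc_Cohen_Macaulay : Cohen_Macaulay R.
Proof.
split=> [|P maxP]; first exact: wrc_noetherian.
have ed0 : (0 < e * d)%N by rewrite muln_gt0 e_gt0.
have [f fm Pf] := monic_in_maximal d_gt0 embed_x0 maxP.
have [g gm Pg] := monic_in_maximal ed0 embed_ylast maxP.
have [idP P1 _] := maxP; have primP := maximal_is_prime maxP.
have reg := wrc_regular idP P1 fm gm Pf Pg.
set a1 := polyev _ _ f in Pf reg; set a2 := polyev _ _ g in Pg reg.
exists 2%N; split.
- exists [:: a1; a2]; split=> // a; by rewrite !inE => /orP[] /eqP->.
- by move=> s rs _; apply: (regular_sequence_bound wrc_embed_inj wrc_embed_const rs).
- have [Q [primQ Qa1 nQa2 QP]] := prime_between wrc_noetherian primP reg Pf Pg.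
  have a10 : a1 <> 0.
    move=> a10; have := @polyev_Xn_neq0 k 2 0 d f (monic_neq0 fm) d_gt0.
    by rewrite -embed_x0 -embed_polyev -/a1 a10 rmorph0 eqxx.
  have prim0 : prime_ideal (fun a : R => a = 0).
    split=> [||a b]; first by split=> // [x y -> ->|x y ->]; rewrite ?addr0 ?mulr0.
      exact/eqP/oner_neq0.
    by move/(iota_domain wrc_embed_inj).
  exists (fun i => if i is i'.+1 then if i' is _.+1 then P else Q else fun a => a = 0).
  split=> [[|[|[|]]]|[|[|]]|] //= _; split=> //.
  + by move=> a ->; case: primQ => -[].
  + by exists a1.
  + by exists a2.
by move=> m Q; apply: (prime_chain_bound wrc_embed_inj wrc_embed_const).
Qed.

End WeightedCurveCohenMacaulay.

Theorem theorem1 (k : fieldType) (d e : nat)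
    (hd : (1 <= d)%N) (he : (1 <= e)%N) :
  let I : {mpoly k[d + e]} -> Prop := fun p => p \in wrc_ideal k d e in
  let M := wrc_matrix k d e in
  [/\ Cohen_Macaulay (wrc_ring k d e),
      (forall p, I p <-> ideal_gen (fun g => exists a b, g = minor2 M a b) p)
      /\ (forall (r : 'I_2) (j : 'I_(d + e - 1)),
            if (r == 0) && (j == (d - 1)%N :> nat)
            then M r j = wrc_x k d e (d - 1) ^+ e
            else exists i, M r j = 'X_i),
      @free_resolution {mpoly k[d + e]} (EN {mpoly k[d + e]} (d + e - 1))
        (EN_bd M) (wrc_ring k d e) (wrc_proj k d e) &
      exists le : rel 'X_{1..(d + e)}, monomial_order le /\
      exists Q : 'X_{1..(d + e)} -> Prop,
        (forall m, Q m -> quadratic_monomial m) /\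
        (forall p, initial_ideal le I p <-> monomial_ideal Q p)].
Proof.
split; [exact: wrc_Cohen_Macaulay|split|exact: wrc_free_resolution|].
- exact: wrc_idealP.
- move=> r j; have [->|r1] := eqVneq r 0; last first.
    have -> : r = 1 by apply/val_inj; case: r r1 => -[|[|]].
    by exists (hi j); rewrite wrc_matrix1.
  case: (altP (j =P (d - 1)%N :> nat)) => [jd|jd] /=.
    by rewrite mxE jd ltnn !eqxx.
  exists (lo j); rewrite wrc_matrix0 // /topm /top_exp.
  by rewrite (negbTE jd) mulm1n.
exists (@mon_le d e); split; first exact: mon_le_order.
exists (@quad_lead d e); split; last by move=> p; apply: wrc_initial_ideal.
by move=> m [a [b [_ ->]]]; exists a, b.
Qed.
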